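(* Let $0<\lambda\le\Lambda$, $p,q>n$ and $M\ge0$. There is a modulus of continuity $\sigma$, depending only on $\lambda,\Lambda,p,q,n$ and $M$, such that the following holds. Let $a^{ij}$ be measurable on $B_1$ with $(a^{ij}(x))$ symmetric and $\lambda I\le(a^{ij}(x))\le\Lambda I$ for a.e. $x$. Suppose $w\in W^{2,p}(B_1)$, $w\ge0$, with $\|w\|_{W^{2,p}(B_1)}=M$, satisfies $a^{ij}D_{ij}w=\chi_{\{w>0\}}$ a.e. in $B_1$ and $0\in\partial\{w>0\}$. Let $\epsilon>0$, suppose $\|a^{ij}-\delta^{ij}\|_{L^q(B_1)}<\epsilon$, and let $u\ge0$ be the solution of $$\Delta u=\chi_{\{u>0\}}\ \text{ in }B_1,\qquad u= w\ \text{ on }\partial B_1 .$$ Then $$\big|\{\Lambda(u)\,\triangle\,\Lambda(w)\}\cap B_1\big|\le\sigma(\epsilon).$$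
   Context: $B_1$ is the open unit ball of $\mathbb R^n$ centered at $0$. Repeated indices are summed; $\chi_D$ is the characteristic function of $D$; $\delta^{ij}$ is the Kronecker delta. $\Lambda(v):=\{v=0\}$ is the zero set of $v$ in $B_1$ (not to be confused with the ellipticity constant $\Lambda$); $A\triangle B=(A\setminus B)\cup(B\setminus A)$; $\Delta u$ is the Laplacian; $|\cdot|$ is Lebesgue measure. A modulus of continuity is a nondecreasing function $\sigma:(0,\infty)\to[0,\infty)$ with $\sigma(\epsilon)\to0$ as $\epsilon\to0^+$. *)

(* Defs.v *)
From HB Require Import structures.
From mathcomp Require Import all_boot all_order all_algebra.
From mathcomp Require Import all_classical all_reals all_analysis.

Set Implicit Arguments.
Unset Strict Implicit.
Unset Printing Implicit Defensive.

Import Order.TTheory GRing.Theory Num.Theory.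
Import numFieldNormedType.Exports.

Local Open Scope classical_set_scope.
Local Open Scope ring_scope.

(* Points of R^n are row vectors; the dimension is written n.+1, so it is at
   least 1. The topology of 'rV[R]_n.+1 is the usual one, but the library norm
   (and [ball]) is the sup norm, hence the Euclidean norm below. *)

Section euclidean.
Context {R : realType} {n : nat}.
Implicit Types x : 'rV[R]_n.+1.

Definition enorm x : R := Num.sqrt (\sum_i x ord0 i ^+ 2).

Definition unit_ball : set 'rV[R]_n.+1 := [set x | enorm x < 1].
Definition closed_unit_ball : set 'rV[R]_n.+1 := [set x | enorm x <= 1].
Definition unit_sphere : set 'rV[R]_n.+1 := [set x | enorm x = 1].

Definition boundary (A : set 'rV[R]_n.+1) := closure A `\` interior A.

End euclidean.

(* Lebesgue measure on R^n: the outer measure obtained from countable covers by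
   half-open boxes, restricted to its Caratheodory-measurable sets. *)

Section lebesgue_outer.
Context {R : realType} {n : nat}.
Local Notation pt := 'rV[R]_n.+1.
Local Open Scope ereal_scope.

Definition box (ab : pt * pt) : set pt :=
  [set x | forall i, (ab.1 ord0 i < x ord0 i <= ab.2 ord0 i)%R].

Definition box_vol (ab : pt * pt) : R :=
  (\prod_i Num.max 0 (ab.2 ord0 i - ab.1 ord0 i))%R.

Definition box_cover (A : set pt) : set ((pt * pt)^nat) :=
  [set B | A `<=` \bigcup_k box (B k)].

Definition lebesgue_outer (A : set pt) : \bar R :=
  ereal_inf [set \sum_(k <oo) (box_vol (B k))%:E | B in box_cover A].

Lemma box_vol_ge0 ab : 0 <= (box_vol ab)%:E.
Proof. by rewrite lee_fin; apply: prodr_ge0 => i _; rewrite le_max lexx. Qed.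

Lemma box_vol0 : box_vol (0%R, 0%R) = 0%R.
Proof. by rewrite /box_vol big_ord_recl /= subrr maxxx mul0r. Qed.

Lemma lebesgue_outer_ge0 A : 0 <= lebesgue_outer A.
Proof.
apply: le_ereal_inf_tmp => _ [B _ <-].
by apply: nneseries_ge0 => k _ _; exact: box_vol_ge0.
Qed.

Lemma lebesgue_outer0 : lebesgue_outer set0 = 0.
Proof.
apply/eqP; rewrite eq_le lebesgue_outer_ge0 andbT.
apply: ereal_inf_lbound; exists (fun=> (0%R, 0%R)); first exact: sub0set.
by rewrite eseries0// => k _ _; rewrite box_vol0.
Qed.

Lemma le_lebesgue_outer : {homo lebesgue_outer : A B / A `<=` B >-> A <= B}.
Proof.
move=> A B AB; apply/ereal_inf_le_tmp => _ [C BC <-].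
by exists C => //; exact: subset_trans BC.
Qed.

Lemma lebesgue_outer_sigma_subadditive : sigma_subadditive lebesgue_outer.
Proof.
move=> A; have [[i ioo]|] := pselect (exists i, lebesgue_outer (A i) = +oo).
  rewrite (eseries_pinfty _ _ ioo) ?leey// => k _.
  by rewrite -ltNye (lt_le_trans _ (lebesgue_outer_ge0 _)).
rewrite -forallNE => Aoo.
suff add2e (e : {posnum R}) : lebesgue_outer (\bigcup_n A n) <=
    \sum_(i <oo) lebesgue_outer (A i) + e%:num%:E.
  by apply/lee_addgt0Pr => _/posnumP[].
rewrite (le_trans _ (epsilon_trick _ _ _))//; last first.
  by move=> k; exact: lebesgue_outer_ge0.
pose P k (B : (pt * pt)^nat) := box_cover (A k) B /\
  \sum_(j <oo) (box_vol (B j))%:E <=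
    lebesgue_outer (A k) + (e%:num / (2 ^ k.+1)%:R)%:E.
have [G PG] : {G : ((pt * pt)^nat)^nat & forall k, P k (G k)}.
  apply: (@choice _ _ P) => k; rewrite /P /lebesgue_outer.
  set S := (X in ereal_inf X); move infS : (ereal_inf S) => iS.
  case: iS infS => [r Sr|Soo|Soo].
  - have en1 : (0 < e%:num / (2 ^ k.+1)%:R)%R by [].
    have /(lb_ereal_inf_adherent en1) : ereal_inf S \is a fin_num by rewrite Sr.
    by move=> [_ [B AB <-] xS]; exists B; split => //; rewrite -Sr; exact/ltW.
  - by have := Aoo k; rewrite /lebesgue_outer Soo.
  - by have := lebesgue_outer_ge0 (A k); rewrite /lebesgue_outer Soo.
pose v (jk : nat * nat) := (box_vol (G jk.1 jk.2))%:E.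
have v_ge0 jk : 0 <= v jk by exact: box_vol_ge0.
apply: (@le_trans _ _ (\esum_(jk in setT) v jk)).
  apply: ereal_inf_lbound => /=.
  have /card_esym/ppcard_eqP[f] := card_nat2.
  exists (fun k => G (f k).1 (f k).2).
    move=> x [i _ Aix]; have [j _ Gx] := (PG i).1 _ Aix.
    by exists (f^-1%FUN (i, j)) => //=; rewrite invK ?inE.
  rewrite -[LHS]/(\sum_(k <oo) v (f k)).
  by rewrite -(esum_pred_image v _ xpredT) ?[fun=> _]set_true// image_eq.
rewrite (_ : esum _ _ = \sum_(i <oo) \sum_(j <oo) v (i, j)); last first.
  pose J : nat -> set (nat * nat) := fun i => [set (i, j) | j in setT].
  rewrite (_ : setT = \bigcup_k J k); last first.
    by rewrite predeqE => -[a b]; split => // _; exists a => //; exists b.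
  rewrite esum_bigcupT /=; last 2 first.
    - apply/trivIsetP => i j _ _ ij.
      rewrite predeqE => -[k m] /=; split => //= -[] [_] _ [<-{k} _].
      by move=> [m' _] [] /esym/eqP; rewrite (negbTE ij).
    - by move=> jk; exact: v_ge0.
  rewrite -(image_id [set: nat]) -fun_true esum_pred_image//; last first.
    by move=> k _; exact: esum_ge0.
  apply: eq_eseriesr => /= j _.
  rewrite -(esum_pred_image v (pair j) predT)//=; last first.
    by move=> ? ? _ _; exact: (@can_inj _ _ _ snd).
  by congr esum; rewrite predeqE => -[a b]; split; move=> [i _ <-]; exists i.
apply: lee_nneseries => [k _ _|k _]; last exact: (PG k).2.
by apply: nneseries_ge0 => j _ _; exact: v_ge0.
Qed.

HB.instance Definition _ := isOuterMeasure.Build R pt lebesgue_outer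
  lebesgue_outer0 lebesgue_outer_ge0 le_lebesgue_outer
  lebesgue_outer_sigma_subadditive.

End lebesgue_outer.

(* A copy of R^n carrying the sigma-algebra of Lebesgue measurable sets. *)
Notation Rn_leb R n := (caratheodory_type (@lebesgue_outer R n)).

Definition lebesgue {R : realType} {n : nat} (A : set (Rn_leb R n)) : \bar R :=
  lebesgue_outer A.

HB.instance Definition _ (R : realType) (n : nat) :=
  isMeasure.Build _ _ _ (@lebesgue R n)
    (@caratheodory_measure0 _ _ (@lebesgue_outer R n))
    (@caratheodory_measure_ge0 _ _ (@lebesgue_outer R n))
    (@caratheodory_measure_sigma_additive _ _ (@lebesgue_outer R n)).

Section sobolev.
Context {R : realType} {n : nat}.
Local Notation pt := 'rV[R]_n.+1.
Implicit Types (D K : set pt) (f g v phi : pt -> R) (s : seq 'I_n.+1) (p : R).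

(* A word s = [:: i1; ...; ik] stands for the operator D_i1 ... D_ik. *)
Definition partials s phi : pt -> R :=
  foldr (fun i (f : pt -> R) (x : pt) => 'D_(delta_mx ord0 i) f x) phi s.

Definition test_function D phi :=
  (forall s x, differentiable (partials s phi) x) /\
  exists K, [/\ compact K, K `<=` D & forall x, ~ K x -> phi x = 0].

Definition Lp_norm D p f : \bar R :=
  Lnorm (@lebesgue R n) p%:E (EFin \o (f \_ D)).

Definition Lp D p : set (pt -> R) :=
  [set f | measurable_fun (D : set (Rn_leb R n)) (f : Rn_leb R n -> R) /\
           (Lp_norm D p f < +oo)%E].

Definition Lp_loc D p : set (pt -> R) :=
  [set f | measurable_fun (D : set (Rn_leb R n)) (f : Rn_leb R n -> R) /\
           forall K, compact K -> K `<=` D -> (Lp_norm K p f < +oo)%E].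

Definition is_weak_derivative D s v g :=
  [/\ Lp_loc D 1 v, Lp_loc D 1 g &
      forall phi, test_function D phi ->
        Rintegral (@lebesgue R n) D (fun x => v x * partials s phi x) =
        (-1) ^+ size s *
        Rintegral (@lebesgue R n) D (fun x => g x * phi x)].

(* The weak derivative, unique up to null sets, and 0 if there is none. *)
Definition weak_derivative D s v : pt -> R :=
  xget (fun=> 0) [set g | is_weak_derivative D s v g].

Definition sobolev (X : set (pt -> R)) D (k : nat) : set (pt -> R) :=
  [set v | X v /\ forall s, (size s <= k)%N ->
             exists2 g, is_weak_derivative D s v g & X g].

Definition W2 p D := sobolev (Lp D p) D 2.
Definition W2_loc p D := sobolev (Lp_loc D p) D 2.

(* (\sum_(|alpha| <= 2) |D^alpha v|_p^p)^(1/p), each multi-index alpha being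
   counted once: the second-order ones are the pairs i <= j. *)
Definition W2_norm p D v : \bar R :=
  ((Lp_norm D p v `^ p
    + \sum_(i < n.+1) Lp_norm D p (weak_derivative D [:: i] v) `^ p
    + \sum_(i < n.+1) \sum_(j < n.+1 | (i <= j)%N)
        Lp_norm D p (weak_derivative D [:: i; j] v) `^ p) `^ p^-1)%E.

End sobolev.

Section obstacle_problem.
Context {R : realType} {n : nat}.
Local Notation pt := 'rV[R]_n.+1.
Local Notation B1 := (@unit_ball R n).
Implicit Types (a : pt -> 'M[R]_n.+1) (v w : pt -> R) (lambda Lambda : R).

Definition zero_set v : set pt := [set x | B1 x /\ v x = 0].
Definition positivity_set v : set pt := [set x | B1 x /\ 0 < v x].

Definition elliptic lambda Lambda a :=
  (forall i j, measurable_fun (B1 : set (Rn_leb R n))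
     ((fun x => a x i j) : Rn_leb R n -> R)) /\
  {ae @lebesgue R n, forall x, B1 x ->
     (a x)^T = a x /\
     forall xi : pt, lambda * enorm xi ^+ 2
       <= \sum_i \sum_j a x i j * xi ord0 i * xi ord0 j
       <= Lambda * enorm xi ^+ 2}.

(* v >= 0 and a^{ij} D_ij v = chi_{v > 0} a.e. in the unit ball; v is the
   representative that is continuous up to the boundary, so that {v > 0}, its
   boundary, {v = 0} and the boundary values are meaningful pointwise. *)
Definition obstacle_solution a v :=
  [/\ {within closed_unit_ball, continuous v},
      forall x, B1 x -> 0 <= v x &
      {ae @lebesgue R n, forall x, B1 x ->
         \sum_i \sum_j a x i j * weak_derivative B1 [:: i; j] v x
         = \1_(positivity_set v) x}].

Definition laplace_obstacle_solution v :=
  [/\ {within closed_unit_ball, continuous v},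
      forall x, B1 x -> 0 <= v x &
      {ae @lebesgue R n, forall x, B1 x ->
         \sum_i weak_derivative B1 [:: i; i] v x
         = \1_(positivity_set v) x}].

End obstacle_problem.

Definition modulus_of_continuity {R : realType} (sigma : R -> R) :=
  [/\ forall s t : R, 0 < s -> s <= t -> sigma s <= sigma t,
      forall t : R, 0 < t -> 0 <= sigma t &
      sigma x @[x --> 0^'+] --> 0].

(* Main.v *)
Require Import Defs.
From mathcomp Require Import all_boot all_order all_algebra.
From mathcomp Require Import all_classical all_reals all_analysis.
From mathcomp Require Import measurable_realfun ring lra.

(** Write v = u - w, extended by 0 outside the ball, and g for its Laplacian.
    Almost everywhere g = h - f, where h is the indicator of {u > 0} minus that
    of {w > 0} and f is the sum of (delta_ij - a_ij) D_ij w. Both obstacle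
    problems have the same boundary values, and three facts give the theorem.

    Monotonicity. Since u, w >= 0, the function h has the sign of v and vanishes
    where v does, and |h| is the indicator of the symmetric difference of the
    two contact sets. Kato's inequality says that the integral of g psi(v) is at
    most 0 for psi nondecreasing, Lipschitz and 0 near 0; when psi tends to the
    sign function it becomes the L^1 contraction: the integral of |h|, which is the measure to be
    estimated, is at most the integral of |f| ([kato], [l1_contraction]).

    Smallness. Ellipticity bounds delta - a uniformly, its L^q norm is at most
    epsilon, and D_ij w is bounded in L^p by M. Cutting the product at suitable
    heights bounds the integral of |f| by a sum of powers of epsilon
    ([le_Rintegral_interpolation], [residual_bound]).

    Symmetry. The Sobolev norm controls D_ij w only for i <= j, and the weak
    derivatives are selected independently of each other, so D_ij w = D_ji w
    a.e. has to be proved: a locally integrable function that is orthogonal to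
    every smooth test function is null ([du_bois_reymond]). Its integrals over
    boxes vanish, boxes form a pi-system, and Lebesgue measure is defined by
    covers with boxes, so the integrals over all measurable sets vanish.

    Kato's inequality is the core. It is proved without mollifying v, from the
    identity between the integrals of g phi and of v times the Laplacian of phi
    alone, with a well chosen phi. Take a smooth partition of unity (k_j) whose
    members are translates of one bump along a fine grid, let c_j be the average
    of v against k_j, and let phi be the normalised sum of the psi(c_j) k_j.
    Uniform continuity of v makes phi uniformly close to psi(v), and phi is
    supported inside the ball because psi vanishes near 0. The second derivative
    of k_j is nearly the second difference of the neighbouring bumps, so the
    integral of v times the Laplacian of phi is nearly a sum over j of psi(c_j)
    times a second difference of c at j. Summation by parts on the discrete
    torus shows that such a sum is nonpositive ([sum_second_difference_le0]).
    The error is of the order of the grid spacing, which tends to 0 while the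
    size of the bumps is fixed; then the size of the bumps tends to 0. *)

Set Implicit Arguments.
Unset Strict Implicit.
Unset Printing Implicit Defensive.

Import Order.TTheory GRing.Theory Num.Theory.
Import numFieldNormedType.Exports.

Local Open Scope classical_set_scope.
Local Open Scope ring_scope.

(** * Smooth functions of one variable *)
Section smooth_functions.
Context {R : realType}.
Implicit Types (f g df : R -> R) (k : nat) (a c s t x : R).

(** The derivative is taken at every point, so that k-fold derivability is
    stable under sums, products and inverses by induction on k. *)
Fixpoint times_derivable k f : Prop :=
  if k is k'.+1 then
    (forall x, derivable f x 1) /\ times_derivable k' f^`()%classic
  else True.

Definition smooth f := forall k, times_derivable k f.

Lemma derive1_of_is_derive f df :
  (forall x, is_derive x 1 f (df x)) -> f^`()%classic = df.
Proof. by move=> fdf; apply/funext => x; rewrite derive1E derive_val. Qed.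

Lemma times_derivable_step k f df : (forall x, is_derive x 1 f (df x)) ->
  times_derivable k df -> times_derivable k.+1 f.
Proof.
by move=> fdf kdf; split; [move=> x; case: (fdf x)
                         | rewrite (derive1_of_is_derive fdf)].
Qed.

Lemma times_derivableW k f : times_derivable k.+1 f -> times_derivable k f.
Proof.
elim: k f => [//|k IH] f [df ddf]; split => //.
by apply: IH; case: ddf => ? ?; split.
Qed.

Lemma is_derive_derivable1 f x : derivable f x 1 -> is_derive x 1 f (f^`()%classic x).
Proof. by move=> df; rewrite derive1E; exact: derivableP. Qed.

Lemma smooth_derivable f x : smooth f -> derivable f x 1.
Proof. by move=> /(_ 1%N) []. Qed.

Lemma smooth_derive1 f : smooth f -> smooth f^`()%classic.
Proof. by move=> sf k; have [] := sf k.+1. Qed.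

Lemma smooth_continuous f : smooth f -> continuous f.
Proof.
move=> sf x; apply/differentiable_continuous/derivable1_diffP.
exact: smooth_derivable.
Qed.

Lemma times_derivable_cst k c : times_derivable k (fun=> c).
Proof.
elim: k c => [//|k IH] c; apply: (@times_derivable_step _ _ (fun=> 0)) => // x.
Qed.

Lemma times_derivableD k f g : times_derivable k f -> times_derivable k g ->
  times_derivable k (fun x => f x + g x).
Proof.
elim: k f g => [//|k IH] f g [df kf] [dg kg].
apply: (@times_derivable_step _ _ (fun x => f^`()%classic x + g^`()%classic x)); last exact: IH.
by move=> x; apply: is_deriveD; exact: is_derive_derivable1.
Qed.

Lemma times_derivableM k f g : times_derivable k f -> times_derivable k g ->
  times_derivable k (fun x => f x * g x).
Proof.
elim: k f g => [//|k IH] f g fS gS; have [df kf] := fS; have [dg kg] := gS.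
apply: (@times_derivable_step _ _ (fun x => f x * g^`()%classic x + g x * f^`()%classic x)).
  by move=> x; apply: is_deriveM; exact: is_derive_derivable1.
by apply: times_derivableD; apply: IH => //; exact: times_derivableW.
Qed.

Lemma times_derivable_affine k f a c : times_derivable k f ->
  times_derivable k (fun x => f (a * x + c)).
Proof.
elim: k f => [//|k IH] f [df kf].
apply: (@times_derivable_step _ _ (fun x => a * f^`()%classic (a * x + c))).
  move=> x.
  have -> : (fun x => f (a * x + c)) = f \o (fun x => a * x + c) by [].
  rewrite mulrC.
  apply: (@is_derive1_comp _ f (fun x => a * x + c)).
    exact: is_derive_derivable1.
  by apply: is_derive_eq; rewrite /GRing.scale /=; ring.
exact: (times_derivableM (times_derivable_cst k a) (IH _ kf)).
Qed.

Lemma times_derivableV k f : (forall x, f x != 0) -> times_derivable k f ->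
  times_derivable k (fun x => (f x)^-1).
Proof.
move=> f0; elim: k => [//|k IH] fS; have [df kf] := fS.
have dV x : is_derive x 1 (fun x => (f x)^-1)
    (-1 * (f^`()%classic x * ((f x)^-1 * (f x)^-1))).
  apply: is_derive_eq.
    by apply: is_deriveV => //; exact: is_derive_derivable1.
  rewrite /GRing.scale /= -exprVn derive1E; ring.
apply: (times_derivable_step dV).
apply: times_derivableM; first exact: times_derivable_cst.
by do 2?[apply: times_derivableM => //]; apply: IH; exact: times_derivableW.
Qed.

(** This gives the derivative of exp(-1/t) at the origin, where the calculus
    rules do not apply. *)
Lemma is_derive_quadratic_bound f c :
  (forall t, `|f t| <= c * t ^+ 2) -> is_derive (0 : R) 1 f 0.
Proof.
move=> fc.
have f0 : f 0 = 0.
  by apply/eqP; rewrite -normr_le0 (le_trans (fc 0))// expr0n mulr0.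
have c0 : 0 <= c by have := le_trans (normr_ge0 _) (fc 1); rewrite expr1n mulr1.
have cv : h^-1 *: (f (h *: 1 + 0) - f 0) @[h --> 0^'] --> (0 : R).
  apply/cvgr0Pnorm_le => e e0.
  near=> h.
  rewrite f0 subr0 addr0 normrZ normfV /GRing.scale /= mulr1.
  have h0 : 0 < `|h| by rewrite normr_gt0; near: h; exact: nbhs_dnbhs_neq.
  rewrite ler_pdivrMl//.
  have hd : `|h| <= e / (c + 1).
    by near: h; apply: dnbhs0_le; rewrite divr_gt0// ltr_wpDl.
  apply: (le_trans (fc h)); rewrite -real_normK ?num_real// expr2 mulrCA.
  rewrite ler_wpM2l//; apply: (le_trans (ler_wpM2l c0 hd)).
  by rewrite mulrCA ler_piMr ?(ltW e0)// ler_pdivrMr ?mul1r ?lerDl// ltr_wpDl.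
split; first by apply/cvg_ex; exists 0.
exact/cvg_lim.
Unshelve. all: by end_near. Qed.

(** The family t^-m exp(-1/t), extended by 0 to t <= 0: its linear span is
    closed under derivation, hence consists of smooth functions. *)
Definition flat m t : R := if 0 < t then t^-1 ^+ m * expR (- t^-1) else 0.

Lemma expr_expRN_bounded m s : 0 < s -> s ^+ m * expR (- s) <= m`!%:R.
Proof.
case: m => [|m] s0; first by rewrite mul1r expR_le1 oppr_le0 ltW.
rewrite expRN ler_pdivrMr ?expR_gt0// mulrC -ler_pdivrMr ?ltr0n ?fact_gt0//.
by apply: le_trans (expR_ge1Dxn m (ltW s0)); rewrite lerDr.
Qed.

(** Exponential decay beats the powers of 1/t, with two powers to spare: this is
    what makes the derivative at 0 vanish for every m at once. *)
Lemma flat_bound m t : `|flat m t| <= m.+2`!%:R * t ^+ 2.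
Proof.
rewrite /flat; case: ifPn => [t0|_]; last by rewrite normr0 mulr_ge0 ?sqr_ge0.
rewrite ger0_norm ?mulr_ge0 ?exprn_ge0 ?invr_ge0 ?expR_ge0 ?(ltW t0)//.
have t1 : 0 < t^-1 by rewrite invr_gt0.
rewrite -ler_pdivrMr ?exprn_gt0//.
apply: le_trans (expr_expRN_bounded m.+2 t1).
suff -> : t^-1 ^+ m.+2 = t^-1 ^+ m / t ^+ 2 by rewrite mulrAC.
by rewrite -exprVn -exprD addn2.
Qed.

Lemma is_derive_flat m t :
  is_derive t 1 (flat m) (- m%:R * flat m.+1 t + flat m.+2 t).
Proof.
have [t0|t0|->] := ltgtP t 0.
- have -> : - m%:R * flat m.+1 t + flat m.+2 t = 0.
    by rewrite /flat ltNge (ltW t0) /= mulr0 addr0.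
  apply: (@near_eq_is_derive _ _ _ (fun=> 0)).
  near=> x; rewrite /flat ifF//; apply/negbTE; rewrite -leNgt ltW//; near: x.
  exact: lt_nbhsl.
- have -> : - m%:R * flat m.+1 t + flat m.+2 t =
            - (t^-1 ^+ 2) * (m%:R * t^-1 ^+ m.-1 - t^-1 ^+ m) * expR (- t^-1).
    rewrite /flat t0; case: m => [|m]; rewrite /= ?exprS; ring.
  pose F := fun x : R => x^-1 ^+ m * expR (- x^-1).
  apply: (@near_eq_is_derive _ _ _ F).
    near=> x; rewrite /flat ifT//; near: x; exact: lt_nbhsr.
  have dV : is_derive t 1 (fun x : R => x^-1) (- (t^-1 ^+ 2)).
    apply: is_derive_eq; first by apply: is_deriveV; rewrite gt_eqF.
    by rewrite /GRing.scale /= mulr1 exprVn.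
  have dE : is_derive t 1 (fun x : R => expR (- x^-1)) (expR (- t^-1) * (t^-1 ^+ 2)).
    apply: (@is_derive1_comp _ expR (fun x => - x^-1)).
    by rewrite -[X in is_derive _ _ _ X]opprK; exact: is_deriveN.
  have dX : is_derive t 1 (fun x : R => x^-1 ^+ m) (m%:R * t^-1 ^+ m.-1 * - (t^-1 ^+ 2)).
    have -> : (fun x : R => x^-1 ^+ m) = (fun x : R => x^-1) ^+ m.
      by apply/funext => x; rewrite exprfctE.
    apply: is_derive_eq.
    by rewrite /GRing.scale /= -mulr_natl.
  apply: (@is_derive_eq _ _ _ F t 1 _ _ (is_deriveM dX dE)).
  rewrite /GRing.scale /=; ring.
- rewrite /flat ltxx mulr0 addr0.
  exact: is_derive_quadratic_bound (flat_bound m).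
Unshelve. all: by end_near. Qed.

Lemma smooth_flat m : smooth (flat m).
Proof.
move=> k; elim: k m => [//|k IH] m.
apply: (times_derivable_step (is_derive_flat m)).
by apply: times_derivableD => //; apply: times_derivableM => //;
  exact: times_derivable_cst.
Qed.

(** The classical smooth transition from 0 (for t <= 0) to 1 (for t >= 1). *)
Definition step t : R := flat 0 t / (flat 0 t + flat 0 (1 - t)).

Lemma flat_gt0 m t : 0 < t -> 0 < flat m t.
Proof. by move=> t0; rewrite /flat t0 mulr_gt0 ?expR_gt0 ?exprn_gt0 ?invr_gt0. Qed.

Lemma flat_eq0 m t : t <= 0 -> flat m t = 0.
Proof. by move=> t0; rewrite /flat ltNge t0. Qed.

Lemma flat_ge0 m t : 0 <= flat m t.
Proof.
by have [/flat_gt0/ltW//|/flat_eq0->] := ltP 0 t.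
Qed.

Lemma step_den_gt0 t : 0 < flat 0 t + flat 0 (1 - t).
Proof.
have [t0|t0] := ltP 0 t; first by rewrite ltr_pwDl ?flat_gt0 ?flat_ge0.
by rewrite ltr_wpDl ?flat_gt0 ?flat_ge0//; lra.
Qed.

Lemma smooth_step : smooth step.
Proof.
move=> k; apply: times_derivableM; first exact: smooth_flat.
apply: times_derivableV => [x|]; first by rewrite gt_eqF// step_den_gt0.
apply: times_derivableD; first exact: smooth_flat.
have := times_derivable_affine (-1) 1 (smooth_flat 0 k).
by under eq_fun do rewrite mulN1r addrC.
Qed.

Lemma step_le0 t : t <= 0 -> step t = 0.
Proof. by move=> t0; rewrite /step flat_eq0// mul0r. Qed.

Lemma step_ge1 t : 1 <= t -> step t = 1.
Proof.
move=> t1; rewrite /step (@flat_eq0 0 (1 - t)) ?subr_le0// addr0 divff//.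
by rewrite gt_eqF// flat_gt0// (lt_le_trans _ t1).
Qed.

Lemma step_itv t : 0 <= step t <= 1.
Proof.
rewrite /step divr_ge0 ?flat_ge0 ?(ltW (step_den_gt0 _))//=.
by rewrite ler_pdivrMr ?step_den_gt0// mul1r lerDl flat_ge0.
Qed.

End smooth_functions.


(** * A smooth bump and its translates *)
Section bump.
Context {R : realType}.
Implicit Types (f g : R -> R) (c t s x : R).

Lemma smoothD f g : smooth f -> smooth g -> smooth (fun x => f x + g x).
Proof. by move=> sf sg k; exact: times_derivableD. Qed.

Lemma smoothZ c f : smooth f -> smooth (fun x => c * f x).
Proof.
by move=> sf k; apply: times_derivableM => //; exact: times_derivable_cst.
Qed.

Lemma smooth_affine f a c : smooth f -> smooth (fun x => f (a * x + c)).
Proof. by move=> sf k; exact: times_derivable_affine. Qed.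

Lemma smooth_is_derive f x : smooth f -> is_derive x 1 f (f^`()%classic x).
Proof. by move=> sf; apply: is_derive_derivable1; exact: smooth_derivable. Qed.

(** Being a difference of two translates of a transition function, the bump has
    translates that sum to a constant by telescoping, whatever the exact shape
    of the transition. *)
Definition bump t := step (t + 1) - step t.

Lemma smooth_bump : smooth (bump : R -> R).
Proof.
have := smoothD (smooth_affine 1 1 smooth_step) (smoothZ (-1) smooth_step).
by under eq_fun do rewrite mul1r mulN1r.
Qed.

Lemma bump_eq0 t : 1 <= `|t| -> bump t = 0.
Proof.
rewrite /bump ler_normr => /orP[t1|t1].
  by rewrite !step_ge1 ?subrr//; lra.
by rewrite !step_le0 ?subrr//; lra.
Qed.

Lemma bump_itv t : 0 <= bump t <= 1.
Proof.
have /andP[s0 s1] := step_itv t; have /andP[S0 S1] := step_itv (t + 1).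
rewrite /bump; have [t0|t0] := leP 0 t.
  by rewrite (@step_ge1 _ (t + 1)) ?lerDr//; lra.
by rewrite (step_le0 (ltW t0)) subr0 S0 S1.
Qed.

Lemma sum_shift_telescope (a : nat -> R) m K :
  \sum_(k < K) (a k - a (k + m)%N) = \sum_(k < m) a k - \sum_(k < m) a (K + k)%N.
Proof.
elim: K => [|K IH]; first by rewrite big_ord0 subrr.
rewrite big_ord_recr /= IH.
have -> : \sum_(k < m) a (K + k)%N = a K + \sum_(k < m) a (K.+1 + k)%N - a (K + m)%N.
  apply/eqP; rewrite eq_sym subr_eq; apply/eqP.
  rewrite -(big_ord_recr m (fun k => a (K + k)%N)) big_ord_recl /= addn0.
  by congr (_ + _); apply: eq_bigr => i _; rewrite addSnnS.
ring.
Qed.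

(** With spacing 1/m, the sum of the bumps telescopes with shift m: the first m
    transitions equal 1 at t and the last m vanish there. *)
Lemma bump_partition m K t : (0 < m)%N -> 1 <= t -> t + 1 <= K%:R / m%:R ->
  \sum_(k < K) bump (t - k%:R / m%:R) = m%:R.
Proof.
move=> m0 t1 tK.
have m0R : (0 : R) < m%:R by rewrite ltr0n.
pose a k : R := step (t + 1 - k%:R / m%:R).
under eq_bigr => k _.
  have -> : bump (t - k%:R / m%:R) = a k - a (k + m)%N.
    rewrite /bump /a natrD mulrDl divff ?gt_eqF//.
    by congr (step _ - step _); ring.
  over.
rewrite sum_shift_telescope.
under eq_bigr => k _.
  rewrite /a step_ge1; first over.
  by have : (k%:R : R) / m%:R <= 1; [rewrite ler_pdivrMr// mul1r ler_nat ltnW|lra].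
under [X in _ - X]eq_bigr => k _.
  rewrite /a step_le0; first over.
  rewrite natrD mulrDl; have : 0 <= (k%:R : R) / m%:R by rewrite divr_ge0.
  by lra.
by rewrite sumr_const big1 // subr0 card_ord.
Qed.

Lemma mean_value_bound f (B : R) x : (forall s, derivable f s 1) -> 0 <= x ->
  (forall s, 0 <= s <= x -> `|f^`()%classic s| <= B) -> `|f x - f 0| <= B * x.
Proof.
move=> df x0 fB.
have [||c cx ->] := @MVT_segment R f (fun s => f^`()%classic s) 0 x x0.
- by move=> s _; exact: is_derive_derivable1.
- apply: continuous_subspaceT => s.
  exact/differentiable_continuous/derivable1_diffP.
rewrite subr0 normrM (ger0_norm x0) ler_wpM2r//; apply: fB.
by move: cx; rewrite in_itv.
Qed.

Lemma derive1_eq0_outside f : (forall t, 1 < `|t| -> f t = 0) ->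
  forall t, 1 < `|t| -> f^`()%classic t = 0.
Proof.
move=> f0 t t1; rewrite derive1E.
have cN : {for t, continuous (fun x : R => `|x|)} by exact: norm_continuous.
rewrite (@near_eq_derive _ _ _ _ (fun=> 0)) ?derive_cst//.
near=> x; apply: f0; near: x.
exact: (cvgr_gt _ cN _ t1).
Unshelve. all: by end_near. Qed.

Lemma smooth_bounded f : smooth f -> (forall t, 1 < `|t| -> f t = 0) ->
  exists C, forall t, `|f t| <= C.
Proof.
move=> sf f0.
have cf : {within `[-1, 1], continuous (fun t => `|f t|)}.
  apply: continuous_subspaceT => t; apply: continuous_comp; last exact: norm_continuous.
  exact: smooth_continuous.
have [|c _ fc] := EVT_max _ cf; first lra.
exists `|f c| => t; have [t1|t1] := ltP 1 `|t|; first by rewrite f0// normr0.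
by apply: fc; rewrite in_itv /= -ler_norml.
Qed.

Lemma increment_bound f B t x : smooth f -> (forall s, `|f^`()%classic s| <= B) ->
  0 <= x -> `|f (t + x) - f t| <= B * x /\ `|f (t - x) - f t| <= B * x.
Proof.
move=> sf fB x0.
have inc a : `|a| = 1 -> `|f (a * x + t) - f t| <= B * x.
  move=> a1; have dg s : is_derive s 1 (fun s => f (a * s + t)) (a * f^`()%classic (a * s + t)).
    rewrite mulrC; apply: (@is_derive1_comp _ f (fun x => a * x + t)).
      exact: smooth_is_derive.
    by apply: is_derive_eq; rewrite /GRing.scale /=; ring.
  have := @mean_value_bound (fun s => f (a * s + t)) B x _ x0.
  rewrite mulr0 add0r (derive1_of_is_derive dg); apply.
    by move=> s; case: (dg s).
  by move=> s _; rewrite normrM a1 mul1r.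
split; first by have := inc 1 (normr1 _); rewrite mul1r (addrC x).
by have := inc (-1) (normrN1 _); rewrite mulN1r (addrC (- x)).
Qed.

(** Taylor's formula by two integrations in x: the remainder and its derivative
    in x vanish at x = 0, and its second derivative in x is controlled by the
    bound on the third derivative of f. *)
Lemma second_difference_bound f C t x : smooth f ->
  (forall s, `|f^`()%classic^`()%classic^`()%classic s| <= C) -> 0 <= x ->
  `|f (t + x) + f (t - x) - 2 * f t - x ^+ 2 * f^`()%classic^`()%classic t|
    <= 2 * C * x ^+ 3.
Proof.
move=> sf fC x0.
have sf1 := smooth_derive1 sf; have sf2 := smooth_derive1 sf1.
have d_affine g a s : smooth g ->
    is_derive s 1 (fun s => g (t + a * s)) (a * g^`()%classic (t + a * s)).
  move=> sg; rewrite mulrC; apply: (@is_derive1_comp _ g (fun x => t + a * x)).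
    exact: smooth_is_derive.
  by apply: is_derive_eq; rewrite /GRing.scale /=; ring.
set f1 := f^`()%classic in sf1 fC *; set f2 := f1^`()%classic in sf2 fC *.
pose F s := f (t + 1 * s) + f (t + (-1) * s) - (2 * f t + s ^+ 2 * f2 t).
pose F1 s := f1 (t + 1 * s) - f1 (t + (-1) * s) - (2 * f2 t) * s.
pose F2 s := f2 (t + 1 * s) + f2 (t + (-1) * s) - 2 * f2 t.
have r1 (a b c d : R) : a - b - 2 * c * d = 1 * a + -1 * b - 2 * c * d by ring.
have r2 (a b c : R) : a + b - 2 * c = 1 * a - -1 * b - 2 * c by ring.
have dlin c s : is_derive s 1 (fun s => c * s) c.
  by apply: is_derive_eq; rewrite /GRing.scale /=; ring.
have dsqr a c s : is_derive s 1 (fun s => a + s ^+ 2 * c) (2 * c * s).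
  by apply: is_derive_eq; rewrite /GRing.scale /=; ring.
have dF s : is_derive s 1 F (F1 s).
  have -> : F1 s = 1 * f1 (t + 1 * s) + -1 * f1 (t + -1 * s) - 2 * f2 t * s.
    exact: r1.
  exact: is_deriveB (is_deriveD (d_affine f 1 s sf) (d_affine f (-1) s sf))
    (dsqr _ _ _).
have dF1 s : is_derive s 1 F1 (F2 s).
  have -> : F2 s = 1 * f2 (t + 1 * s) - -1 * f2 (t + -1 * s) - 2 * f2 t.
    exact: r2.
  exact: is_deriveB (is_deriveB (d_affine f1 1 s sf1) (d_affine f1 (-1) s sf1))
    (dlin _ _).
have r3 (a b c : R) : a + b - 2 * c = (a - c) + (b - c) by ring.
have C0 : 0 <= C := le_trans (normr_ge0 _) (fC 0).
have F2C s : 0 <= s <= x -> `|F2 s| <= 2 * C * x.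
  move=> /andP[s0 sx]; have [i1 i2] := @increment_bound f2 C t s sf2 fC s0.
  rewrite /F2 mul1r mulN1r.
  rewrite r3.
  apply: (le_trans (ler_normD _ _)); apply: (le_trans (lerD i1 i2)).
  by have Csx := ler_wpM2l C0 sx; rewrite -mulrA mulr_natl mulr2n lerD.
have F1C s : 0 <= s <= x -> `|F1 s| <= 2 * C * x * x.
  move=> /andP[s0 sx].
  have := @mean_value_bound F1 (2 * C * x) s (fun s => @ex_derive _ _ _ _ _ _ _ (dF1 s)) s0.
  rewrite (derive1_of_is_derive dF1).
  have -> : F1 0 = 0 by rewrite /F1 !mulr0 !addr0 subr0 subrr.
  rewrite subr0 => H; apply: le_trans (H _) _.
    by move=> r /andP[r0 rs]; apply: F2C; rewrite r0 (le_trans rs).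
  by rewrite ler_wpM2l// !mulr_ge0.
have := @mean_value_bound F (2 * C * x * x) x (fun s => @ex_derive _ _ _ _ _ _ _ (dF s)) x0.
rewrite (derive1_of_is_derive dF).
have -> : F 0 = 0 by rewrite /F !mulr0 !addr0 expr0n mul0r addr0 r3 !subrr addr0.
rewrite subr0 /F mul1r mulN1r opprD addrA => H; apply: le_trans (H F1C) _.
by rewrite !exprS expr0 mulr1 !mulrA.
Qed.

Lemma bump_second_difference : exists2 C : R, 0 <= C &
  forall t x, 0 <= x ->
  `|bump (t + x) + bump (t - x) - 2 * bump t
    - x ^+ 2 * (bump : R -> R)^`()%classic^`()%classic t| <= C * x ^+ 3.
Proof.
have z0 t : 1 < `|t| -> bump t = 0 :> R by move=> /ltW; exact: bump_eq0.
have z3 := derive1_eq0_outside (derive1_eq0_outside (derive1_eq0_outside z0)).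
have s3 := smooth_derive1 (smooth_derive1 (smooth_derive1 smooth_bump)).
have [C fC] := smooth_bounded s3 z3.
have C0 : 0 <= C := le_trans (normr_ge0 _) (fC 0).
exists (2 * C); first by rewrite mulr_ge0.
by move=> t x; exact: (second_difference_bound t smooth_bump fC).
Qed.

End bump.

(** * Products of one-variable functions *)
Section product_functions.
Context {R : realType} {n : nat}.
Local Notation pt := 'rV[R]_n.+1.
Implicit Types (F G : 'I_n.+1 -> R -> R) (x v : pt) (i j : 'I_n.+1)
  (w : seq 'I_n.+1) (f g : pt -> R).

(** Reduces directional derivatives to derivatives in one variable. *)
Lemma is_derive_line f x v d :
  is_derive (0 : R) 1 (fun h => f (h *: v + x)) d -> is_derive x v f d.
Proof.
have E : (fun h : R => h^-1 *: (((fun h => f (h *: v + x)) \o shift 0) (h *: 1) -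
    f (0 *: v + x))) = (fun h : R => h^-1 *: ((f \o shift x) (h *: v) - f x)).
  by apply/funext => h /=; rewrite addr0 scale0r add0r /GRing.scale /= mulr1.
by case; rewrite /derivable /derive E => df <-; split.
Qed.

(** Products of one-variable functions are the only test functions that occur
    below: their partial derivatives are products of the same kind, so that
    calculus in one variable suffices. *)
Definition prodf F x : R := \prod_i F i (x ord0 i).

Definition upd F j (g : R -> R) i := if i == j then g else F i.

Definition smooth_family F := forall i, smooth (F i).

Lemma smooth_upd F j (g : R -> R) :
  smooth_family F -> smooth g -> smooth_family (upd F j g).
Proof. by move=> sF sg i; rewrite /upd; case: ifP. Qed.

Lemma prodf_upd F j (g : R -> R) x :
  prodf (upd F j g) x = g (x ord0 j) * \prod_(i | i != j) F i (x ord0 i).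
Proof.
rewrite /prodf (bigD1 j)//= /upd eqxx; congr (_ * _).
by apply: eq_bigr => i /negbTE ->.
Qed.

Lemma upd_id F j : upd F j (F j) = F.
Proof. by apply/funext => i; rewrite /upd; case: eqP => [->|]. Qed.

Lemma is_derive_prodf F x j : smooth_family F ->
  is_derive x (delta_mx ord0 j) (prodf F) (prodf (upd F j (F j)^`()%classic) x).
Proof.
move=> sF; apply: is_derive_line.
set c := \prod_(i | i != j) F i (x ord0 i).
have -> : (fun h : R => prodf F (h *: delta_mx ord0 j + x)) =
          (fun h => c * F j (1 * h + x ord0 j)).
  apply/funext => h; rewrite -[in LHS](upd_id F j) prodf_upd mulrC; congr (_ * _).
    apply: eq_bigr => i ij; rewrite !mxE eqxx (negbTE ij) mulr0 add0r//.
  by rewrite !mxE !eqxx mulr1 mul1r.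
rewrite prodf_upd -/c mulrC.
have dj : is_derive (0 : R) 1 (fun h => F j (1 * h + x ord0 j)) ((F j)^`()%classic (x ord0 j)).
  have -> : (F j)^`()%classic (x ord0 j) = (F j)^`()%classic (1 * 0 + x ord0 j) * 1.
    by rewrite mulr0 add0r mulr1.
  apply: (@is_derive1_comp _ (F j) (fun h => 1 * h + x ord0 j)).
    exact: smooth_is_derive.
  by apply: is_derive_eq; rewrite /GRing.scale /=; ring.
exact: (is_deriveZ c dj).
Qed.

Lemma differentiable_prodf F x : smooth_family F -> differentiable (prodf F) x.
Proof.
move=> sF; rewrite /prodf; elim: (index_enum _) => [|i s IH].
  under eq_fun do rewrite big_nil; exact: differentiable_cst.
under eq_fun do rewrite big_cons.
apply: differentiableM => //.
apply: (@differentiable_comp _ _ _ _ (fun x => x ord0 i) (F i)).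
  exact: differentiable_coord.
exact/derivable1_diffP/smooth_derivable.
Qed.

Definition partial_family w F : 'I_n.+1 -> R -> R :=
  foldr (fun j G => upd G j (G j)^`()%classic) F w.

Lemma smooth_partial_family w F : smooth_family F -> smooth_family (partial_family w F).
Proof.
move=> sF; elim: w => [//|j w IH] /=.
by apply: smooth_upd => //; apply: smooth_derive1; exact: IH.
Qed.

(** Sums of products are test functions as soon as the sum, not necessarily each
    term, has compact support: the grid functions of Kato's inequality use this. *)
Definition comb (I : Type) (r : seq I) (c : I -> R) (F : I -> 'I_n.+1 -> R -> R) x : R :=
  \sum_(a <- r) c a * prodf (F a) x.

Section comb.
Context {I : Type}.
Implicit Types (r : seq I) (c : I -> R) (Fs : I -> 'I_n.+1 -> R -> R).

Lemma is_derive_comb r c Fs x j : (forall a, smooth_family (Fs a)) ->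
  is_derive x (delta_mx ord0 j) (comb r c Fs)
    (comb r c (fun a => partial_family [:: j] (Fs a)) x).
Proof.
move=> sF; rewrite /comb; elim: r => [|a r IH].
  by under eq_fun do rewrite big_nil; rewrite big_nil; exact: is_derive_cst.
under eq_fun do rewrite big_cons; rewrite big_cons.
apply: is_deriveD IH; exact: is_deriveZ (is_derive_prodf _ _ _).
Qed.

Lemma partials_comb w r c Fs : (forall a, smooth_family (Fs a)) ->
  partials w (comb r c Fs) = comb r c (fun a => partial_family w (Fs a)).
Proof.
move=> sF; elim: w => [//|j w IH] /=.
rewrite IH; apply/funext => x.
have := @is_derive_comb r c _ x j (fun a => smooth_partial_family w (sF a)).
by move=> /@derive_val ->.
Qed.

Lemma differentiable_comb r c Fs x : (forall a, smooth_family (Fs a)) ->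
  differentiable (comb r c Fs) x.
Proof.
move=> sF; rewrite /comb; elim: r => [|a r IH].
  by under eq_fun do rewrite big_nil; exact: differentiable_cst.
under eq_fun do rewrite big_cons.
by apply: differentiableD => //; apply: differentiableZ; exact: differentiable_prodf.
Qed.

Lemma test_function_comb (D K : set pt) r c Fs : (forall a, smooth_family (Fs a)) ->
  compact K -> K `<=` D -> (forall x, ~ K x -> comb r c Fs x = 0) ->
  test_function D (comb r c Fs).
Proof.
move=> sF cK KD c0; split; last by exists K.
move=> w x; rewrite partials_comb//; apply: differentiable_comb => a.
exact: smooth_partial_family.
Qed.

End comb.

Lemma partial_familyC i j F : partial_family [:: i; j] F = partial_family [:: j; i] F.
Proof.
apply/funext => k; rewrite /partial_family /= /upd.
by have [->|ij] := eqVneq i j; case: (eqVneq k i) => [->|ki]; rewrite ?eqxx ?(negbTE ij)//;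
 case: (eqVneq k j) => [->|kj]; rewrite ?eqxx ?(eq_sym j) ?(negbTE ij) ?(negbTE ki).
Qed.

End product_functions.

(** * Lebesgue measure on R^n *)
Section lebesgue_facts.
Context {R : realType} {n : nat}.
Local Notation pt := 'rV[R]_n.+1.
Local Notation X := (Rn_leb R n).
Local Notation mu := (@lebesgue R n).
Implicit Types (i j : 'I_n.+1) (x y : pt) (A : set pt).

Definition set_coord x i (c : R) : pt :=
  \row_j (if j == i then c else x ord0 j).

(** Cutting a box by a coordinate hyperplane does not increase the volume, also
    when one of the pieces is empty; the extrema make the endpoints right in all
    cases. *)
Lemma box_vol_split i (c : R) (ab : pt * pt) :
  box_vol (ab.1, set_coord ab.2 i (Num.min (ab.2 ord0 i) c)) +
  box_vol (set_coord ab.1 i (Num.max (ab.1 ord0 i) c), ab.2) <= box_vol ab.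
Proof.
case: ab => a b; rewrite /box_vol /= !(bigD1 (P := xpredT) i)//=.
rewrite !mxE eqxx.
rewrite (eq_bigr (fun j => Num.max 0 (b ord0 j - a ord0 j))); last first.
  by move=> j /negbTE ji; rewrite mxE ji.
rewrite [X in _ + _ * X](eq_bigr (fun j => Num.max 0 (b ord0 j - a ord0 j))); last first.
  by move=> j /negbTE ji; rewrite mxE ji.
rewrite -mulrDl ler_wpM2r//.
  by apply: prodr_ge0 => j _; rewrite le_max lexx.
set s := a ord0 i; set t := b ord0 i; rewrite /Num.max /Num.min.
by do 10?[case: ltP => ?]; lra.
Qed.

(** The Caratheodory criterion for a half-space: cut each box of a cover in two. *)
Lemma measurable_halfspace i (c : R) : measurable ([set x | x ord0 i <= c] : set X).
Proof.
apply: le_caratheodory_measurable; set H := [set x : pt | x ord0 i <= c] => A.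
apply: le_ereal_inf_tmp => _ [B AB <-].
pose B1 k := ((B k).1, set_coord (B k).2 i (Num.min ((B k).2 ord0 i) c)).
pose B2 k := (set_coord (B k).1 i (Num.max ((B k).1 ord0 i) c), (B k).2).
have l1 : (lebesgue_outer (A `&` H) <=
           \sum_(k <oo) (box_vol (B1 k))%:E)%E.
  apply: ereal_inf_lbound; exists B1 => // x [/AB [k _ Bkx] xc].
  exists k => // j; rewrite /= mxE; have [ji|//] := eqVneq j i.
  by have := Bkx j; rewrite ji le_min xc andbT.
have l2 : (lebesgue_outer (A `&` ~` H) <=
           \sum_(k <oo) (box_vol (B2 k))%:E)%E.
  apply: ereal_inf_lbound; exists B2 => // x [/AB [k _ Bkx] xc].
  exists k => // j; rewrite /= mxE; have [ji|//] := eqVneq j i.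
  move/negP: xc; rewrite -ltNge => xc.
  by have := Bkx j; rewrite ji gt_max xc andbT.
apply: (le_trans (leeD l1 l2)).
rewrite -nneseriesD; [|by move=> *; exact: box_vol_ge0..].
apply: lee_nneseries => k _; first by rewrite adde_ge0 ?box_vol_ge0.
by rewrite -EFinD lee_fin box_vol_split.
Qed.

Lemma measurable_coord i : measurable_fun setT ((fun x => x ord0 i) : X -> R).
Proof.
apply: (measurability _ (RGenOInfty.measurableE R)) => _ [_ [c ->] <-].
rewrite setTI.
have -> : (fun x : X => x ord0 i) @^-1` `]c, +oo[%classic = ~` [set x | x ord0 i <= c].
  by apply/seteqP; split => x /=; rewrite in_itv /= andbT ltNge => /negP.
by apply: measurableC; exact: measurable_halfspace.
Qed.

Lemma measurable_coord_comp i (f : R -> R) : measurable_fun setT f ->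
  measurable_fun setT ((fun x => f (x ord0 i)) : X -> R).
Proof. by move=> mf; apply: measurableT_comp (measurable_coord i). Qed.

Lemma measurable_box (ab : pt * pt) : measurable (box ab : set X).
Proof.
have -> : box ab = \bigcap_(i in [set: 'I_n.+1])
    ((fun x : X => x ord0 i) @^-1` `]ab.1 ord0 i, ab.2 ord0 i]%classic).
  apply/seteqP; split => x /= bx i; first by move=> _ /=; rewrite in_itv; exact: bx.
  by have /= := bx i Logic.I; rewrite in_itv.
apply: fin_bigcap_measurable => // i _.
by rewrite -[_ @^-1` _]setTI; apply: measurable_coord.
Qed.

Lemma measurable_enorm : measurable_fun setT (@enorm R n : X -> R).
Proof.
apply: (@measurableT_comp _ _ _ _ _ _ (Num.sqrt : R -> R)).
  exact: continuous_measurable_fun (@sqrt_continuous R).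
apply: measurable_sum => i; apply: measurable_funX.
exact: measurable_coord.
Qed.

Lemma measurable_unit_ball : measurable (@unit_ball R n : set X).
Proof.
have -> : @unit_ball R n = (@enorm R n : X -> R) @^-1` `]-oo, 1[%classic.
  by apply/seteqP; split => x /=; rewrite in_itv.
by rewrite -[_ @^-1` _]setTI; exact: measurable_enorm.
Qed.

Lemma lebesgue_box_le (ab : pt * pt) : (mu (box ab) <= (box_vol ab)%:E)%E.
Proof.
apply: ereal_inf_lbound; exists (fun k => if k == 0%N then ab else (0, 0)).
  by move=> x bx; exists 0%N.
rewrite (@nneseriesD1 _ _ 0%N xpredT)//=; last first.
  by move=> k _; exact: box_vol_ge0.
by rewrite eseries0 ?adde0// => k _ /negbTE ->; rewrite box_vol0.
Qed.

Lemma lebesgue_box_lty (ab : pt * pt) : (mu (box ab) < +oo)%E.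
Proof. exact: le_lt_trans (lebesgue_box_le ab) (ltry _). Qed.

Lemma coord_le_enorm x i : `|x ord0 i| <= enorm x.
Proof.
rewrite /enorm -sqrtr_sqr ler_sqrt ?sqr_ge0//; last first.
  by apply: sumr_ge0 => j _; exact: sqr_ge0.
by rewrite (bigD1 i)//= lerDl; apply: sumr_ge0 => j _; exact: sqr_ge0.
Qed.

Lemma unit_ball_coord x i : unit_ball x -> -1 < x ord0 i < 1.
Proof. by move=> x1; rewrite -ltr_norml (le_lt_trans (coord_le_enorm x i)). Qed.

Lemma lebesgue_unit_ball_lty : (mu (@unit_ball R n) < +oo)%E.
Proof.
apply: le_lt_trans (lebesgue_box_lty (const_mx (-1), const_mx 1)).
apply: le_lebesgue_outer => x x1 i; rewrite !mxE.
by have /andP[-> /ltW] := unit_ball_coord i x1.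
Qed.

(** Translating the boxes of a cover preserves their volumes. *)
Lemma lebesgue_outer_translate_le y A :
  (lebesgue_outer [set x | A (x + y)%R] <= lebesgue_outer A)%E.
Proof.
apply: le_ereal_inf_tmp => _ [B AB <-].
apply: ereal_inf_lbound; exists (fun k => ((B k).1 - y, (B k).2 - y)).
  move=> x /AB [k _ Bkx]; exists k => // i; have := Bkx i.
  by rewrite /= !mxE ltrBlDr lerBrDr.
apply: eq_eseriesr => k _; congr EFin; apply: eq_bigr => i _.
by rewrite /= !mxE opprB addrA subrK.
Qed.

Lemma lebesgue_outer_translate y A :
  lebesgue_outer [set x | A (x + y)%R] = lebesgue_outer A.
Proof.
apply/eqP; rewrite eq_le lebesgue_outer_translate_le /=.
have := lebesgue_outer_translate_le (- y) [set x | A (x + y)].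
by congr (_ <= _)%E; congr lebesgue_outer; apply/seteqP; split => x /=; rewrite subrK.
Qed.

Lemma measurable_translate y : measurable_fun setT ((fun x => x + y) : X -> X).
Proof.
move=> _ A mA; rewrite setTI.
suff : caratheodory_measurable (@lebesgue_outer R n) [set x | A (x + y)] by [].
have {}mA : caratheodory_measurable (@lebesgue_outer R n) A := mA.
move=> B; rewrite -(lebesgue_outer_translate (- y) B) (mA [set x | B (x - y)]).
rewrite -(lebesgue_outer_translate (- y) (B `&` _)).
rewrite -(lebesgue_outer_translate (- y) (B `&` ~` _)).
congr (_ + _)%E; congr lebesgue_outer; apply/seteqP;
  by split => x /=; rewrite subrK.
Qed.

Lemma ge0_integral_translate y (f : X -> \bar R) : measurable_fun setT f ->
  (forall x, 0 <= f x)%E ->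
  (\int[mu]_x f (x + y)%R = \int[mu]_x f x)%E.
Proof.
move=> mf f0.
have mt := measurable_translate y.
transitivity (\int[pushforward mu ((fun x => x + y)%R : X -> X)]_x f x)%E.
  by rewrite (ge0_integral_pushforward mt _ measurableT mf).
pose mt_mu := measure_function_pushforward__canonical__measure_function_Measure mu mt.
apply: (@eq_measure_integral _ X R setT mu mt_mu f) => A mA _.
exact: lebesgue_outer_translate.
Qed.

End lebesgue_facts.

(** * Real-valued integrals *)
Section real_integrals.
Context d (T : measurableType d) {R : realType} (mu : {measure set T -> \bar R}).
Implicit Types (D E : set T) (f g b : T -> R).

Lemma ae_imply (P Q : T -> Prop) : (forall x, P x -> Q x) ->
  {ae mu, forall x, P x} -> {ae mu, forall x, Q x}.
Proof. by move=> PQ; apply: filterS. Qed.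

Lemma ae_imply2 (P P' Q : T -> Prop) : (forall x, P x -> P' x -> Q x) ->
  {ae mu, forall x, P x} -> {ae mu, forall x, P' x} -> {ae mu, forall x, Q x}.
Proof. by move=> PQ; apply: filterS2. Qed.

Lemma ae_forall (I : finType) (P : I -> T -> Prop) :
  (forall i, {ae mu, forall x, P i x}) -> {ae mu, forall x, forall i, P i x}.
Proof. by move=> aeP; apply: filter_forall. Qed.

Lemma integrable_measurable D f :
  mu.-integrable D (EFin \o f) -> measurable_fun D f.
Proof. by move=> fi; apply/measurable_EFinP; exact: measurable_int fi. Qed.

Lemma integrableM_bounded D f b (c : R) : measurable D ->
  mu.-integrable D (EFin \o f) -> measurable_fun D b ->
  (forall x, D x -> `|b x| <= c) -> mu.-integrable D (EFin \o (fun x => f x * b x)).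
Proof.
move=> mD fi mb bc; have mf := integrable_measurable fi.
apply: (@le_integrable _ _ _ mu _ mD _ (fun x => `|c|%:E * (EFin \o f) x)%E).
- by apply/measurable_EFinP; exact: measurable_funM.
- move=> x Dx; rewrite -[X in (_ <= `|X|)%E]EFinM /= lee_fin !normrM normr_id.
  by rewrite mulrC ler_wpM2r//; exact: le_trans (bc x Dx) (ler_norm _).
- exact: integrableZl.
Qed.

Lemma integrable_mul_indic D E f : measurable D -> measurable E -> E `<=` D ->
  mu.-integrable E (EFin \o f) ->
  mu.-integrable D (EFin \o (fun x => f x * \1_E x)).
Proof.
move=> mD mE ED fE.
have := (integrable_restrict mu mE mD (EFin \o f)).1.
rewrite setIidr// => /(_ fE); apply: eq_integrable => // x _.
by rewrite /= restrict_EFin /= patch_indic.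
Qed.

Lemma integrable_bounded_support D E f (c : R) : measurable D -> measurable E ->
  E `<=` D -> (mu E < +oo)%E -> measurable_fun D f ->
  (forall x, D x -> `|f x| <= c) -> (forall x, D x -> ~ E x -> f x = 0) ->
  mu.-integrable D (EFin \o f).
Proof.
move=> mD mE ED Efin mf fc f0.
have fE : mu.-integrable E (EFin \o f).
  apply: measurable_bounded_integrable => //; first exact: measurable_funS mf.
  exists c; split; first exact: num_real.
  by move=> M cM x Ex; apply: le_trans (ltW cM); apply: fc; exact: ED.
have := integrable_mul_indic mD mE ED fE.
apply: eq_integrable => // x; rewrite inE => Dx /=; congr EFin.
have [Ex|nEx] := pselect (E x); first by rewrite indicE mem_set// mulr1.
by rewrite f0// mul0r.
Qed.

Lemma Rintegral_setT D f : (forall x, ~ D x -> f x = 0) ->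
  Rintegral mu D f = Rintegral mu setT f.
Proof.
move=> f0; rewrite Rintegral_mkcond; apply: eq_Rintegral => x _.
rewrite /patch; case: ifPn => // /negP; rewrite inE => nDx.
by rewrite f0.
Qed.

Lemma ae_eq_Rintegral D f g : measurable D -> measurable_fun D f ->
  measurable_fun D g -> {ae mu, forall x, D x -> f x = g x} ->
  Rintegral mu D f = Rintegral mu D g.
Proof.
move=> mD mf mg fg; rewrite /Rintegral; congr (fine _).
apply: ae_eq_integral => //; [exact/measurable_EFinP..|].
by apply: ae_imply fg => x fx Dx; rewrite fx.
Qed.

Lemma Rintegral_sum D (I : Type) (s : seq I) (h : I -> T -> R) : measurable D ->
  (forall i, mu.-integrable D (EFin \o h i)) ->
  mu.-integrable D (EFin \o (fun x => \sum_(i <- s) h i x)) /\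
  Rintegral mu D (fun x => \sum_(i <- s) h i x) = \sum_(i <- s) Rintegral mu D (h i).
Proof.
move=> mD ih; elim: s => [|i s [IH1 IH2]].
  split; last by rewrite big_nil; under eq_Rintegral do rewrite big_nil;
    rewrite Rintegral_cst// mul0r.
  have := integrable0 mu D; apply: eq_integrable => // x _ /=.
  by rewrite big_nil.
split; last by rewrite big_cons -IH2 -RintegralD//;
  apply: eq_Rintegral => x _; rewrite big_cons.
have := integrableD mD (ih i) IH1; apply: eq_integrable => // x _ /=.
by rewrite big_cons.
Qed.

Lemma le_Rintegral_setT D f : measurable D -> mu.-integrable setT (EFin \o f) ->
  (forall x, 0 <= f x) -> Rintegral mu D f <= Rintegral mu setT f.
Proof.
move=> mD fi f0; rewrite -(setUv D) Rintegral_setU ?setUv//; last 2 first.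
- exact: measurableC.
- by apply/disj_setPS; rewrite setICr.
by rewrite lerDl Rintegral_ge0.
Qed.

(** Positivity of the integral of a kernel without computing it: finitely many
    functions with the same integral c add up to a positive constant on a set of
    positive measure, so c > 0. *)
Lemma partition_mass_gt0 (J : finType) (k : J -> T -> R) D (c M : R) :
  measurable D -> (0 < mu D)%E -> (mu D < +oo)%E -> 0 < M ->
  (forall j, mu.-integrable setT (EFin \o k j)) -> (forall j x, 0 <= k j x) ->
  (forall j, Rintegral mu setT (k j) = c) ->
  (forall x, D x -> \sum_j k j x = M) -> 0 < c.
Proof.
move=> mD D0 Dfin M0 ki k0 kc kM.
have iD j : mu.-integrable D (EFin \o k j).
  by apply: (@integrableS _ _ _ mu setT).
have [_ sE] := @Rintegral_sum D _ (index_enum J) k mD iD.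
have : 0 < \sum_j Rintegral mu D (k j).
  rewrite -sE (@eq_Rintegral _ _ _ mu D (fun=> M)); last first.
    by move=> x; rewrite inE => /kM.
  by rewrite Rintegral_cst// mulr_gt0// fine_gt0// D0.
apply: contraTT; rewrite -!leNgt => c0; apply: sumr_le0 => j _.
by apply: le_trans c0; rewrite -(kc j); exact: le_Rintegral_setT.
Qed.

(** The pairing of f with g is close to the corresponding second difference of
    the pairings of f with three kernels, when g is uniformly close to the second
    difference of these kernels. *)
Lemma Rintegral_comb_approx D f (k1 k2 k3 : T -> R) g (a e : R) : measurable D ->
  mu.-integrable D (EFin \o f) -> measurable_fun D k1 -> measurable_fun D k2 ->
  measurable_fun D k3 -> measurable_fun D g ->
  (forall x, `|k1 x| <= 1) -> (forall x, `|k2 x| <= 1) -> (forall x, `|k3 x| <= 1) ->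
  (forall x, `|g x - a * (k1 x + k2 x - 2 * k3 x)| <= e) ->
  `|Rintegral mu D (fun x => f x * g x) -
    a * (Rintegral mu D (fun x => f x * k1 x) + Rintegral mu D (fun x => f x * k2 x)
      - 2 * Rintegral mu D (fun x => f x * k3 x))|
  <= e * Rintegral mu D (fun x => `|f x|).
Proof.
move=> mD fi mk1 mk2 mk3 mg k1b k2b k3b gk.
have if1 (k : T -> R) : measurable_fun D k -> (forall x, `|k x| <= 1) ->
    mu.-integrable D (EFin \o (fun x => f x * k x)).
  by move=> mk kb; apply: (@integrableM_bounded _ _ _ 1).
have fk1 := if1 _ mk1 k1b; have fk2 := if1 _ mk2 k2b; have fk3 := if1 _ mk3 k3b.
pose k x := a * (k1 x + k2 x - 2 * k3 x).
have mk : measurable_fun D k.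
  apply: measurable_funM => //; apply: measurable_funB; first exact: measurable_funD.
  exact: measurable_funM.
have kb x : `|k x| <= `|a| * 4.
  rewrite normrM ler_wpM2l//; move: (k1b x) (k2b x) (k3b x).
  by rewrite !ler_norml => /andP[? ?] /andP[? ?] /andP[? ?]; lra.
have gb x : `|g x| <= e + `|a| * 4.
  by rewrite -(subrK (k x) (g x)); apply: le_trans (ler_normD _ _) _; exact: lerD.
have fk : mu.-integrable D (EFin \o (fun x => f x * k x)).
  exact: (integrableM_bounded mD fi mk (fun x _ => kb x)).
have fg : mu.-integrable D (EFin \o (fun x => f x * g x)).
  exact: (integrableM_bounded mD fi mg (fun x _ => gb x)).
have -> : a * (Rintegral mu D (fun x => f x * k1 x) + Rintegral mu D (fun x => f x * k2 x)
      - 2 * Rintegral mu D (fun x => f x * k3 x)) = Rintegral mu D (fun x => f x * k x).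
  have i3 : mu.-integrable D (EFin \o (fun x => 2 * (f x * k3 x))).
    by have := integrableZl mD 2 fk3; apply: eq_integrable.
  have i12 : mu.-integrable D (EFin \o (fun x => f x * k1 x + f x * k2 x)).
    by have := integrableD mD fk1 fk2; apply: eq_integrable.
  have i123 : mu.-integrable D (EFin \o (fun x => f x * k1 x + f x * k2 x - 2 * (f x * k3 x))).
    by have := integrableB mD i12 i3; apply: eq_integrable.
  rewrite -(RintegralZl _ mD fk3) -RintegralD// -RintegralB// -RintegralZl//.
  by apply: eq_Rintegral => x _; rewrite /k; ring.
rewrite -RintegralB//.
have idiff : mu.-integrable D (EFin \o (fun x => f x * g x - f x * k x)).
  by have := integrableB mD fg fk; apply: eq_integrable.
apply: le_trans (le_normr_Rintegral mD idiff) _.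
have inf : mu.-integrable D (EFin \o (fun x => `|f x|)) := integrable_norm fi.
rewrite -RintegralZl//; apply: le_Rintegral => //.
- exact: integrable_norm.
- by have := integrableZl mD e inf; apply: eq_integrable.
- by move=> x _; rewrite -mulrBr normrM mulrC ler_wpM2r.
Qed.

Lemma Rintegral_dominated_cvg D (f_ : nat -> T -> R) f g : measurable D ->
  (forall k, measurable_fun D (f_ k)) -> measurable_fun D f ->
  {ae mu, forall x, D x -> f_ ^~ x @ \oo --> f x} ->
  mu.-integrable D (EFin \o g) -> (forall k x, D x -> `|f_ k x| <= g x) ->
  Rintegral mu D (f_ k) @[k --> \oo] --> Rintegral mu D f.
Proof.
move=> mD mf_ mf f_f gi f_g.
have [|//||fi _ cv] := @dominated_convergence _ _ _ mu D mD (fun k => EFin \o f_ k)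
  (EFin \o f) (EFin \o g) (fun k => (measurable_EFinP _ _).2 (mf_ k))
  ((measurable_EFinP _ _).2 mf).
- move: f_f; apply: filterS => x fx Dx; apply/fine_cvgP; split; first exact: nearW.
  exact: fx.
- by apply: aeW => x k Dx; rewrite lee_fin; exact: f_g.
apply: fine_cvg; rewrite fineK//; exact: integrable_fin_num.
Qed.

Lemma indic_setU_setI (A B : set T) x :
  (\1_(A `|` B) x : R) = \1_A x + \1_B x - \1_(A `&` B) x.
Proof.
rewrite !indicE in_setU in_setI.
by case: (x \in A); case: (x \in B) => /=; ring.
Qed.

Lemma indic_le1 (A : set T) x : `|\1_A x : R| <= 1.
Proof. by rewrite indicE; case: (x \in A); rewrite ?normr1 ?normr0. Qed.

End real_integrals.

(** * Functions with null integrals over a pi-system *)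

(** A function whose integrals over the members of a pi-system vanish is null on
    Q, when measurable sets can be approximated from outside by countable unions
    of members. Stability under intersection gives null integrals over finite
    unions by inclusion-exclusion, then over countable unions by dominated
    convergence, then over measurable sets by approximation. *)
Section pi_system_uniqueness.
Context d (T : measurableType d) {R : realType} (mu : {measure set T -> \bar R}).
Variables (I : Type) (B : I -> set T) (meet : I -> I -> I).
Hypotheses (mB : forall i, measurable (B i))
  (B_meet : forall i j, B (meet i j) = B i `&` B j).
Variable Q : set T.
Hypotheses (mQ : measurable Q) (Q_fin : (mu Q < +oo)%E).
Hypothesis B_approx : forall E (e : R), measurable E -> E `<=` Q -> 0 < e ->
  exists2 C : nat -> I, E `<=` \bigcup_k B (C k) &
    (mu (\bigcup_k B (C k)) <= mu E + e%:E)%E.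

Section signed.
Variable G : T -> R.
Hypotheses (iG : mu.-integrable Q (EFin \o G))
  (G_B : forall i, Rintegral mu Q (fun x => G x * \1_(B i) x) = 0).

Let nu A := Rintegral mu Q (fun x => G x * \1_A x).

Let iGA A : measurable A -> mu.-integrable Q (EFin \o (fun x => G x * \1_A x)).
Proof.
move=> mA; apply: (@integrableM_bounded _ _ _ mu _ _ _ 1) => //.
by move=> x _; exact: indic_le1.
Qed.

Let nuU A A' : measurable A -> measurable A' ->
  nu (A `|` A') = nu A + nu A' - nu (A `&` A').
Proof.
move=> mA mA'; rewrite /nu -RintegralD//; [|exact: iGA..].
rewrite -RintegralB//; last 2 first.
- apply: eq_integrable (integrableD _ (iGA mA) (iGA mA')) => //.
- by apply: iGA; exact: measurableI.
by apply: eq_Rintegral => x _; rewrite indic_setU_setI; ring.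
Qed.

Let nu0 : nu set0 = 0.
Proof.
by rewrite /nu; under eq_Rintegral do rewrite indic0 mulr0; rewrite Rintegral_cst ?mul0r.
Qed.

Let nu_cvg (F : nat -> set T) A : (forall k, measurable (F k)) -> measurable A ->
  {ae mu, forall x, Q x -> (\1_(F k) x : R) @[k --> \oo] --> (\1_A x : R)} ->
  nu (F k) @[k --> \oo] --> nu A.
Proof.
move=> mF mA FA.
apply: (@Rintegral_dominated_cvg _ _ _ mu Q (fun k x => G x * \1_(F k) x)
  (fun x => G x * \1_A x) (fun x => `|G x|)) => //.
- by move=> k; exact: integrable_measurable (iGA _).
- exact: integrable_measurable (iGA _).
- by move: FA; apply: filterS => x Fx Qx; apply: cvgM (Fx Qx); exact: cvg_cst.
- exact: integrable_norm.
- by move=> k x Qx; rewrite normrM ler_piMr// indic_le1.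
Qed.

Let nu_finite_union (C : nat -> I) k :
  nu (\bigcup_(l < k) B (C l)) = 0 /\
  forall i, nu (B i `&` \bigcup_(l < k) B (C l)) = 0.
Proof.
have mC k' : measurable (\bigcup_(l < k') B (C l)) by exact: bigcup_measurable.
elim: k => [|k [IH IHB]].
  by rewrite bigcup0; [split => // i; rewrite setI0 | move=> i].
have -> : \bigcup_(l < k.+1) B (C l) = \bigcup_(l < k) B (C l) `|` B (C k).
  apply/seteqP; split => x.
    move=> [l /=]; rewrite ltnS leq_eqVlt => /orP[/eqP ->|lk] Cx; first by right.
    by left; exists l.
  move=> [[l /= lk] Cx|Cx]; last by exists k => /=.
  by exists l => //=; rewrite ltnS ltnW.
split => [|i].
  by rewrite nuU// IH [nu (B _)]G_B setIC IHB subr0 addr0.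
rewrite setIUr nuU; [|by apply: measurableI..].
rewrite IHB -B_meet [nu (B _)]G_B.
have -> : B i `&` \bigcup_(l < k) B (C l) `&` B (meet i (C k)) =
          B (meet i (C k)) `&` \bigcup_(l < k) B (C l).
  by rewrite B_meet; apply/seteqP; split => x /= [[]] //; tauto.
by rewrite IHB subr0 addr0.
Qed.

Let nu_union (C : nat -> I) : nu (\bigcup_k B (C k)) = 0.
Proof.
have cv : nu (\bigcup_(l < k) B (C l)) @[k --> \oo] --> nu (\bigcup_k B (C k)).
  apply: nu_cvg; [by move=> k; exact: bigcup_measurable|exact: bigcup_measurable|].
  apply: aeW => x _; apply: cvg_near_cst.
  have [[k _ Cx]|nx] := pselect ((\bigcup_k B (C k)) x).
    exists k.+1 => // l /= kl; rewrite !indicE !mem_set//; first by exists k.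
    by exists k => //=.
  apply: nearW => k; rewrite !indicE !memNset//.
  by move=> [l _ Cx]; apply: nx; exists l.
rewrite -(cvg_lim _ cv)//.
under eq_fun do rewrite (nu_finite_union C _).1.
by rewrite lim_cst.
Qed.

Let nu_measurable E : measurable E -> E `<=` Q -> nu E = 0.
Proof.
move=> mE EQ.
have /choice [C CE] (k : nat) : exists C : nat -> I, E `<=` \bigcup_k B (C k) /\
    (mu (\bigcup_k B (C k)) <= mu E + (2^-1 ^+ k.+1)%:E)%E.
  have [|C EC muC] := @B_approx E (2^-1 ^+ k.+1) mE EQ; first by rewrite exprn_gt0.
  by exists C.
pose U k := \bigcup_l B (C k l); pose D k := U k `\` E.
have mU k : measurable (U k) by exact: bigcup_measurable.
have mD k : measurable (D k) by exact: measurableD.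
have muE : mu E \is a fin_num.
  by rewrite ge0_fin_numE// (le_lt_trans _ Q_fin)// le_measure ?inE.
(* The excess sets D k have summable measures, so almost every point lies in
   finitely many of them (Borel-Cantelli) and their indicators tend to 0. *)
have muD k : (mu (D k) <= (2^-1 ^+ k.+1)%:E)%E.
  have [EU muU] := CE k.
  rewrite -(@leeD2lE _ (mu E))//; apply: le_trans muU.
  rewrite -measureU//; last by rewrite /D setDE setIC -setIA setICl setI0.
  by rewrite setDUK.
have D0 : mu (lim_sup_set D) = 0.
  apply: lim_sup_set_cvg0 => //.
  apply: (@le_lt_trans _ _ (\sum_(k <oo) (2^-1 ^+ k.+1)%:E)%E).
    exact: lee_nneseries.
  apply: (@le_lt_trans _ _ 1%:E); last exact: ltry.
  apply: le_trans (@epsilon_trick0 R 1 xpredT ler01).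
  apply: lee_nneseries => k _; first by rewrite lee_fin exprn_ge0.
  by rewrite lee_fin mul1r exprVn natrX.
have cv : nu (D k) @[k --> \oo] --> nu set0.
  apply: nu_cvg => //.
  exists (lim_sup_set D); split => //.
    apply: bigcap_measurable => // k _; exact: bigcup_measurable.
  move=> x /= /not_implyP[Qx nx] k _; apply: contrapT => nD; apply: nx.
  apply: cvg_near_cst; exists k => // l /= kl; rewrite !indicE in_set0 memNset//.
  by move=> Dx; apply: nD; exists l.
have nuD k : nu (D k) = - nu E.
  have [EU _] := CE k.
  have : nu (E `|` D k) = 0 by rewrite setDUK// nu_union.
  rewrite nuU// (_ : E `&` D k = set0) ?nu0 ?subr0.
    by move/eqP; rewrite addrC addr_eq0 => /eqP.
  by rewrite /D setDE setIC -setIA setICl setI0.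
move: cv; under eq_fun do rewrite nuD; rewrite nu0 => /cvg_lim.
by rewrite lim_cst// => /(_ (@Rhausdorff R)) /eqP; rewrite oppr_eq0 => /eqP.
Qed.

(** Test against the indicator of the set where G is positive. *)
Lemma ae_le0_of_pi_system : {ae mu, forall x, Q x -> G x <= 0}.
Proof.
pose E := Q `&` [set x | 0 < G x].
have mG := integrable_measurable iG.
have mE : measurable E.
  have := mG mQ `]0, +oo[%classic (measurable_itv _).
  by congr measurable; apply/seteqP; split => x /= [Qx]; rewrite in_itv/= andbT.
have nuE := nu_measurable mE (@subIsetl _ _ _).
have GE0 x : Q x -> 0 <= G x * \1_E x.
  move=> Qx; rewrite indicE; have [|] := boolP (x \in E); last by rewrite mulr0.
  by rewrite inE => -[_ /ltW]; rewrite mulr1.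
have : (\int[mu]_(x in Q) `|(EFin \o (fun x => G x * \1_E x)%R) x| = 0)%E.
  have E0 : (\int[mu]_(x in Q) (G x * \1_E x)%:E = 0)%E.
    rewrite -[LHS]fineK; last exact: integrable_fin_num (iGA mE).
    by congr EFin; exact: nuE.
  rewrite -[RHS]E0; apply: eq_integral => x; rewrite inE => Qx.
  by rewrite /= ger0_norm// GE0.
move/(ae_eq_integral_abs _ mQ (measurable_int _ (iGA mE))).
apply: filterS => x xE Qx; have := xE Qx => /=.
rewrite leNgt => -[] /eqP; apply: contraL => Gx.
by rewrite indicE mem_set ?mulr1 ?gt_eqF.
Qed.

End signed.

Lemma ae_eq0_of_pi_system (G : T -> R) : mu.-integrable Q (EFin \o G) ->
  (forall i, Rintegral mu Q (fun x => G x * \1_(B i) x) = 0) ->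
  {ae mu, forall x, Q x -> G x = 0}.
Proof.
move=> iG GB.
have iNG : mu.-integrable Q (EFin \o (fun x => - G x)).
  by have := integrableN iG; apply: eq_integrable.
have NGB i : Rintegral mu Q (fun x => - G x * \1_(B i) x) = 0.
  under eq_Rintegral do rewrite -mulrN1 mulrAC.
  rewrite RintegralZr ?GB ?mul0r//.
  apply: (@integrableM_bounded _ _ _ mu _ _ _ 1) => //.
  by move=> x _; exact: indic_le1.
have := ae_le0_of_pi_system iNG NGB; have := ae_le0_of_pi_system iG GB.
apply: filterS2 => x G0 NG0 Qx; apply/eqP; rewrite eq_le G0//=.
by have := NG0 Qx; rewrite oppr_le0.
Qed.

End pi_system_uniqueness.

(** * The lemma of du Bois-Reymond *)
Section du_bois_reymond.
Context {R : realType} {n : nat}.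
Local Notation pt := 'rV[R]_n.+1.
Local Notation X := (Rn_leb R n).
Local Notation mu := (@lebesgue R n).
Local Notation B1 := (@unit_ball R n).
Implicit Types (a b x y : pt) (ab : pt * pt).

Lemma continuous_sqr_enorm : continuous (fun x : pt => \sum_i x ord0 i ^+ 2 : R).
Proof.
apply: continuous_big => [|i _ x]; first exact: add_continuous.
apply: (@continuous_comp _ _ _ (fun x : pt => x ord0 i) (fun t : R => t ^+ 2)).
  exact: coord_continuous.
exact: exprn_continuous.
Qed.

Lemma unit_ballE x : B1 x <-> \sum_i x ord0 i ^+ 2 < 1.
Proof.
rewrite /unit_ball /enorm /= -{1}(@sqrtr1 R) ltr_sqrt//.
Qed.

Lemma near_coordP x (P : pt -> Prop) : (\forall y \near x, P y) ->
  exists2 e : R, 0 < e & forall y, (forall i, `|y ord0 i - x ord0 i| < e) -> P y.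
Proof.
move=> /nbhs_ballP[e /= e0 eP]; exists e => // y yx; apply: eP.
by split => // i j; rewrite ord1; have := yx j; rewrite distrC.
Qed.

Lemma unit_ball_open x : B1 x ->
  exists2 e : R, 0 < e & forall y, (forall i, `|y ord0 i - x ord0 i| < e) -> B1 y.
Proof.
move=> /unit_ballE x1.
have /near_coordP[e e0 eP] : \forall y \near x, \sum_i (y : pt) ord0 i ^+ 2 < 1.
  by move: (@continuous_sqr_enorm x) => /cvgr_lt; apply.
by exists e => // y yx; apply/unit_ballE; exact: eP.
Qed.

Definition closed_box a b : set pt :=
  [set x | forall i, a ord0 i <= x ord0 i <= b ord0 i].

Lemma compact_closed_box a b : compact (closed_box a b).
Proof.
have -> : closed_box a b = [set v : 'rV[R]_n.+1 | forall i,
    `[a ord0 i, b ord0 i]%classic (v ord0 i)].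
  by apply/seteqP; split => x h i; have := h i; rewrite /= in_itv.
exact: rV_compact (fun i => @segment_compact R (a ord0 i) (b ord0 i)).
Qed.

Lemma measurable_closed_box a b : measurable (closed_box a b : set X).
Proof.
have -> : closed_box a b = \bigcap_(i in [set: 'I_n.+1])
    ((fun x : X => x ord0 i) @^-1` `[a ord0 i, b ord0 i]%classic).
  apply/seteqP; split => x /= bx i; first by move=> _ /=; rewrite in_itv; exact: bx.
  by have /= := bx i Logic.I; rewrite in_itv.
apply: fin_bigcap_measurable => // i _.
by rewrite -[_ @^-1` _]setTI; apply: measurable_coord.
Qed.

Lemma measurable_prodf (F : 'I_n.+1 -> R -> R) : (forall i, continuous (F i)) ->
  measurable_fun setT (prodf F : X -> R).
Proof.
move=> cF; apply: measurable_prod => i _; apply: measurable_coord_comp.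
exact: continuous_measurable_fun.
Qed.

(** The definition of the outer measure, as the approximation property that the
    pi-system argument asks for. *)
Lemma box_approx (E : set X) (e : R) : (mu E < +oo)%E -> 0 < e ->
  exists2 C : nat -> pt * pt, E `<=` \bigcup_k box (C k) &
    (mu (\bigcup_k box (C k)) <= mu E + e%:E)%E.
Proof.
move=> Efin e0.
have muE : lebesgue_outer E \is a fin_num.
  by rewrite ge0_fin_numE// lebesgue_outer_ge0.
have [_ [C CE <-] lt] := lb_ereal_inf_adherent e0 muE.
exists C => //; apply: le_trans (ltW lt).
apply: (@le_trans _ _ (\sum_(k <oo) mu (box (C k)))%E).
  exact: lebesgue_outer_sigma_subadditive.
by apply: lee_nneseries => // k _; exact: lebesgue_box_le.
Qed.

Definition box_meet ab1 ab2 : pt * pt :=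
  (\row_i Num.max (ab1.1 ord0 i) (ab2.1 ord0 i),
   \row_i Num.min (ab1.2 ord0 i) (ab2.2 ord0 i)).

Lemma box_meetE ab1 ab2 : box (box_meet ab1 ab2) = box ab1 `&` box ab2.
Proof.
apply/seteqP; split => x /=.
  move=> h; split => i; have := h i; rewrite !mxE gt_max le_min;
    by move=> /andP[/andP[a1 a2] /andP[b1 b2]]; apply/andP.
by move=> [h1 h2] i; rewrite !mxE gt_max le_min andbACA; apply/andP.
Qed.

Variable G : X -> R.
Hypotheses (mG : measurable_fun (B1 : set X) G)
  (iG : forall K : set pt, compact K -> K `<=` B1 -> measurable (K : set X) ->
    mu.-integrable K (EFin \o G))
  (G_test : forall (F : 'I_n.+1 -> R -> R) (K : set pt), smooth_family F ->
    compact K -> K `<=` B1 -> measurable (K : set X) ->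
    (forall x, ~ K x -> prodf F x = 0) ->
    Rintegral mu B1 (fun x => G x * prodf F x) = 0).

(** A smooth approximation of the indicator of ]a, b] for large m: it is 0 for
    t <= a, rises to 1 on [a, a + 1/m] and falls to 0 on [b, b + 1/m]. The transition lies to
    the right of both endpoints, so that the limit m -> oo is exact at every
    point, including a and b. *)
Definition ramp (m : R) (a b t : R) : R := step (m * t + - (m * a)) + -1 * step (m * t + - (m * b)).

Lemma smooth_ramp m (s t : R) : smooth (ramp m s t).
Proof.
apply: smoothD; first exact: smooth_affine smooth_step.
by apply: smoothZ; exact: smooth_affine smooth_step.
Qed.

Lemma ramp_le1 m (s t u : R) : `|ramp m s t u| <= 1.
Proof.
rewrite /ramp; have /andP[? ?] := step_itv (m * u + - (m * s)).
by have /andP[? ?] := step_itv (m * u + - (m * t)); rewrite ler_norml; lra.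
Qed.

Lemma ramp_eq0_lt m (s t u : R) : 0 <= m -> s <= t -> u <= s -> ramp m s t u = 0.
Proof.
move=> m0 st us; rewrite /ramp !step_le0 ?mulr0 ?addr0// -mulrBr.
  by rewrite mulr_ge0_le0// subr_le0 (le_trans us).
by rewrite mulr_ge0_le0// subr_le0.
Qed.

Lemma ramp_eq0_gt m (s t u : R) : 0 < m -> s <= t -> t + m^-1 <= u -> ramp m s t u = 0.
Proof.
move=> m0 st tu; have h : 1 <= m * (u - t).
  by rewrite -ler_pdivrMl// mulr1 lerBrDl.
rewrite /ramp !step_ge1 ?mulr1 ?subrr// -mulrBr//.
by apply: (le_trans h); rewrite ler_pM2l// lerD2l lerN2.
Qed.

Lemma ramp_eq1 m (s t u : R) : 0 < m -> s + m^-1 <= u -> u <= t -> ramp m s t u = 1.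
Proof.
move=> m0 su ut; rewrite /ramp step_ge1 ?step_le0 ?mulr0 ?addr0// -mulrBr.
  by rewrite mulr_ge0_le0 ?subr_le0 ?(ltW m0).
by rewrite -ler_pdivrMl// mulr1 lerBrDl.
Qed.

(** Approximate the indicator of the box by products of ramps; the margin eta
    leaves room inside the ball for their supports. *)
Lemma Rintegral_box_eq0 a b (eta : R) : 0 < eta ->
  (forall i, a ord0 i <= b ord0 i) -> closed_box a (b + const_mx eta) `<=` B1 ->
  Rintegral mu B1 (fun x => G x * \1_(box (a, b)) x) = 0.
Proof.
move=> eta0 ab KB; set K := closed_box _ _ in KB.
have mK : measurable (K : set X) := measurable_closed_box _ _.
have cK : compact K := @compact_closed_box _ _.
pose m k : R := eta^-1 + k%:R.
have m0 k : 0 < m k by rewrite ltr_wpDr ?invr_gt0.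
have m_eta k : (m k)^-1 <= eta.
  by rewrite -[leRHS]invrK lef_pV2 ?posrE ?invr_gt0// lerDl.
pose F k i := ramp (m k) (a ord0 i) (b ord0 i).
have sF k : smooth_family (F k) by move=> i; exact: smooth_ramp.
have F_out k x : ~ K x -> prodf (F k) x = 0.
  apply: contra_notP => /eqP /prodf_neq0 F0 i.
  have {F0}Fi : F k i (x ord0 i) != 0 by exact: F0.
  have := Fi; apply: contraR; rewrite negb_and -!ltNge !mxE => /orP[lt|lt]; apply/eqP.
    by apply: ramp_eq0_lt => //; exact: ltW.
  by apply: ramp_eq0_gt => //; apply: le_trans (ltW lt); rewrite lerD2l.
have F_le k x : `|prodf (F k) x| <= 1.
  rewrite /prodf normr_prod; apply: prodr_ile1 => i _.
  by rewrite normr_ge0 ramp_le1.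
have mF k : measurable_fun (B1 : set X) (prodf (F k) : X -> R).
  apply: measurable_funTS; apply: measurable_prodf => i.
  exact/smooth_continuous/sF.
have cv : Rintegral mu B1 (fun x => G x * prodf (F k) x) @[k --> \oo] -->
          Rintegral mu B1 (fun x => G x * \1_(box (a, b)) x).
  apply: (@Rintegral_dominated_cvg _ _ _ mu (B1 : set X) (fun k x => G x * prodf (F k) x)
    (fun x => G x * \1_(box (a, b)) x) (fun x => `|G x * \1_K x|)).
  - exact: measurable_unit_ball.
  - by move=> k; exact: measurable_funM.
  - by apply: measurable_funM => //; apply: measurable_indic; exact: measurable_box.
  - apply: aeW => x _; apply: cvgM; first exact: cvg_cst.
    have m_small e : 0 < e -> \forall k \near \oo, (m k)^-1 <= e.
      move=> e0; have := @nbhs_infty_ger R e^-1; apply: filterS => k ke.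
      rewrite -[leRHS]invrK lef_pV2 ?posrE ?invr_gt0//.
      by rewrite (le_trans ke)// lerDr invr_ge0 ltW.
    apply: cvg_near_cst.
    have [bx|nbx] := pselect (box (a, b) x).
      rewrite indicE mem_set//=.
      have : \forall k \near \oo, forall i, (m k)^-1 <= x ord0 i - a ord0 i.
        apply: filter_forall => i; apply: m_small.
        by rewrite subr_gt0; have /andP[] := bx i.
      apply: filterS => k kx; rewrite /prodf big1// => i _.
      apply: ramp_eq1 => //; first by rewrite addrC -lerBrDr.
      by have /andP[] := bx i.
    rewrite indicE memNset//=.
    have [i ni] : exists i, ~ (a ord0 i < x ord0 i <= b ord0 i).
      by apply/existsNP => h; exact: nbx.
    suff : \forall k \near \oo, F k i (x ord0 i) = 0.
      by apply: filterS => k Fi0; rewrite /prodf (bigD1 i)//= Fi0 mul0r.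
    move/negP: ni; rewrite negb_and -leNgt -ltNge => /orP[xa|bx].
      by apply: nearW => k; apply: ramp_eq0_lt => //; exact: ltW.
    have := m_small _ (etrans (subr_gt0 _ _) bx); apply: filterS => k kx.
    by apply: ramp_eq0_gt => //; rewrite addrC -lerBrDr.
  - apply: integrable_norm; apply: integrable_mul_indic => //.
      exact: measurable_unit_ball.
    exact: iG.
  - move=> k x Bx; rewrite !normrM ler_wpM2l// indicE.
    have [|/negP] := boolP (x \in K); first by rewrite normr1 F_le.
    by rewrite inE => /F_out ->; rewrite !normr0.
rewrite -(cvg_lim _ cv)//; under eq_fun do rewrite (G_test (sF _) cK KB mK (F_out _)).
by rewrite lim_cst.
Qed.

(** The pi-system argument on one box: its intersections with other boxes are
    boxes that stay inside the ball, or degenerate, and then empty. *)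
Lemma ae_eq0_on_box a b (eta : R) : 0 < eta -> closed_box a (b + const_mx eta) `<=` B1 ->
  {ae mu, forall x, box (a, b) x -> G x = 0}.
Proof.
move=> eta0 KB.
have boxK : box (a, b) `<=` closed_box a (b + const_mx eta).
  move=> x bx i; have /andP[ax xb] := bx i; rewrite !mxE (ltW ax)/=.
  by rewrite (le_trans xb)// lerDl ltW.
have iQ : mu.-integrable (box (a, b)) (EFin \o G).
  apply: (@integrableS _ _ _ mu (closed_box a (b + const_mx eta))) => //.
  - exact: measurable_closed_box.
  - exact: measurable_box.
  - by apply: iG => //; [exact: compact_closed_box|exact: measurable_closed_box].
apply: (ae_eq0_of_pi_system (@measurable_box R n) box_meetE (measurable_box (a, b))
  (lebesgue_box_lty (a, b)) _ iQ) => [E e mE EQ e0|ab].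
  by apply: box_approx => //; apply: le_lt_trans (lebesgue_box_lty (a, b));
    exact: le_lebesgue_outer.
have -> : Rintegral mu (box (a, b)) (fun x => G x * \1_(box ab) x) =
          Rintegral mu B1 (fun x => G x * \1_(box (box_meet (a, b) ab)) x).
  rewrite -[X in Rintegral mu X _ = _](@setIidr _ B1); last first.
    exact: subset_trans boxK KB.
  rewrite Rintegral_mkcondr; apply: eq_Rintegral => x _.
  rewrite box_meetE patch_indic /=.
  by rewrite setIC indicI /= mulrA.
have [le_ab|] := pselect (forall i, (box_meet (a, b) ab).1 ord0 i <=
                                    (box_meet (a, b) ab).2 ord0 i).
  rewrite [box_meet _ _]surjective_pairing.
  apply: (Rintegral_box_eq0 eta0) => // x xK; apply: KB => i; have := xK i.
  rewrite !mxE ge_max => /andP[/andP[-> _]]/= => /le_trans; apply.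
  by rewrite lerD2r ge_min lexx.
move=> /existsNP[i /negP]; rewrite -ltNge => lt.
have b0 x : box (box_meet (a, b) ab) x = False.
  apply/propext; split => // /(_ i) /andP[h1 h2].
  by have := lt_trans lt (lt_le_trans h1 h2); rewrite ltxx.
have -> : box (box_meet (a, b) ab) = set0 by apply/funext => x; rewrite b0.
under eq_Rintegral do rewrite indic0 mulr0.
by rewrite Rintegral_cst ?mul0r//; exact: measurable_unit_ball.
Qed.

Definition grid_lo (k : nat) (z : 'rV[int]_n.+1) : pt := \row_i ((z ord0 i)%:~R / k.+1%:R).

Definition grid_hi (k : nat) (z : 'rV[int]_n.+1) : pt :=
  grid_lo k z + const_mx k.+1%:R^-1.

(** The ball is a countable union of half-open grid cubes that stay inside it
    when enlarged by one mesh; countability globalises the local statement. *)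
Lemma unit_ball_grid_box x : B1 x -> exists k z,
  closed_box (grid_lo k z) (grid_hi k z + const_mx k.+1%:R^-1) `<=` B1 /\
  box (grid_lo k z, grid_hi k z) x.
Proof.
move=> /unit_ball_open[e e0 eB].
have [k ke] : exists k : nat, k.+1%:R^-1 < e / 2.
  have e20 : 0 < e / 2 by rewrite divr_gt0.
  have [k _ /(_ k (leqnn k)) kP] := @near_infty_natSinv_lt R (PosNum e20).
  by exists k.
exists k, (\row_i (Num.ceil (x ord0 i * k.+1%:R) - 1)).
have k0 : (0 : R) < k.+1%:R by [].
have bx i : grid_lo k (\row_i (Num.ceil (x ord0 i * k.+1%:R) - 1)) ord0 i < x ord0 i <=
    grid_hi k (\row_i (Num.ceil (x ord0 i * k.+1%:R) - 1)) ord0 i.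
  rewrite !mxE ltr_pdivrMr// -[X in _ <= _ + X]mul1r -mulrDl ler_pdivlMr//.
  by rewrite intrD rmorphN /= subrK -intrN -intrD; exact: ceil_itv.
split => [y yK|//]; apply: eB => i.
have := yK i; have := bx i; rewrite /grid_hi !mxE.
set u := _ / _; set h := k.+1%:R^-1 in ke *; move=> /andP[h1 h2] /andP[h3 h4].
by rewrite ltr_norml; apply/andP; split; lra.
Qed.

Lemma du_bois_reymond : {ae mu, forall x, B1 x -> G x = 0}.
Proof.
pose P (m : nat) (x : X) :=
  if unpickle m is Some (k, z) then
    closed_box (grid_lo k z) (grid_hi k z + const_mx k.+1%:R^-1) `<=` B1 ->
    box (grid_lo k z, grid_hi k z) x -> G x = 0
  else True.
have : \forall x \ae mu, forall m, P m x.
  apply: ae_foralln => m; rewrite /P; case: unpickle => [[k z]|]; last exact: aeW.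
  have [KB|nKB] := pselect (closed_box (grid_lo k z)
      (grid_hi k z + const_mx k.+1%:R^-1) `<=` B1); last by apply: aeW => x /nKB.
  have k0 : (0 : R) < k.+1%:R^-1 by rewrite invr_gt0.
  by apply: ae_imply (ae_eq0_on_box k0 KB) => x bx _; exact: bx.
apply: ae_imply => x Px /unit_ball_grid_box[k [z [KB bx]]].
by have := Px (pickle (k, z)); rewrite /P pickleK; apply.
Qed.

End du_bois_reymond.

(** * Summation by parts on a discrete torus *)
Section torus.
Context {R : realType}.

(** Summation by parts turns the sum into minus a sum of products of increments
    of psi o f and of f, which have the same sign. Only the bijectivity of the
    shift matters: working on a torus, there are no boundary terms. *)
Lemma sum_second_difference_le0 (J : finType) (s s' : J -> J) (f : J -> R)
    (psi : R -> R) : cancel s s' -> cancel s' s ->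
  (forall a b, a <= b -> psi a <= psi b) ->
  \sum_j psi (f j) * (f (s j) + f (s' j) - 2 * f j) <= 0.
Proof.
move=> sK s'K mono.
have -> : \sum_j psi (f j) * (f (s j) + f (s' j) - 2 * f j) =
    \sum_j psi (f j) * (f (s j) - f j) - \sum_j psi (f j) * (f j - f (s' j)).
  by rewrite -sumrB; apply: eq_bigr => j _; ring.
rewrite [X in _ - X](reindex_inj (can_inj sK)) /= -sumrB; apply: sumr_le0 => j _.
rewrite sK -mulrBl; have [le|/ltW le] := leP (f j) (f (s j)).
  by rewrite mulr_le0_ge0 ?subr_ge0 ?subr_le0 ?mono.
by rewrite mulr_ge0_le0 ?subr_ge0 ?subr_le0 ?mono.
Qed.

Definition shift_coord N K (i : 'I_N) (s : 'I_K -> 'I_K) (j : {ffun 'I_N -> 'I_K}) :=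
  [ffun i' => if i' == i then s (j i') else j i'].

Lemma shift_coordK N K (i : 'I_N) (s s' : 'I_K -> 'I_K) :
  cancel s s' -> cancel (shift_coord i s) (shift_coord i s').
Proof.
by move=> sK j; apply/ffunP => i'; rewrite !ffunE; case: eqP => // _; rewrite sK.
Qed.

End torus.

(** * A partition of unity along a grid *)
Section kernel.
Context {R : realType} {n : nat}.
Local Notation pt := 'rV[R]_n.+1.
Local Notation X := (Rn_leb R n).
Local Notation mu := (@lebesgue R n).
Local Notation B1 := (@unit_ball R n).
Implicit Types (x y t : pt) (l m : nat).

(** The kernel with parameter t is a bump of size 1/l centred at t/l. The centre
    is measured in units of the size, so that the grid step 1/m is the same for
    all l. *)
Definition kern_family l t (i : 'I_n.+1) (u : R) : R := bump (l%:R * u + - t ord0 i).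

Definition kern l t x : R := prodf (kern_family l t) x.

Lemma smooth_kern_family l t : smooth_family (kern_family l t).
Proof. by move=> i; apply: smooth_affine; exact: smooth_bump. Qed.

Lemma measurable_kern l t : measurable_fun setT (kern l t : X -> R).
Proof.
by apply: measurable_prodf => i; apply: smooth_continuous; exact: smooth_kern_family.
Qed.

Lemma kern_ge0 l t x : 0 <= kern l t x.
Proof. by apply: prodr_ge0 => i _; have /andP[] := bump_itv (l%:R * x ord0 i + - t ord0 i). Qed.

Lemma kern_le1 l t x : kern l t x <= 1.
Proof. by apply: prodr_ile1 => i _; exact: bump_itv. Qed.

Lemma kern_neq0 l t x : kern l t x != 0 ->
  forall i, `|l%:R * x ord0 i - t ord0 i| < 1.
Proof.
move=> /prodf_neq0 k0 i; rewrite ltNge; apply: contra (k0 i isT) => le1.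
by rewrite /kern_family bump_eq0.
Qed.

Lemma kern_translate l t x : (0 < l)%N ->
  kern l t x = kern l 0 (x + - (l%:R^-1 *: t)).
Proof.
move=> l0; apply: eq_bigr => i _; rewrite /kern_family !mxE oppr0 addr0; congr bump.
by rewrite mulrDr mulrN mulrA divff ?mul1r// pnatr_eq0 -lt0n.
Qed.

(** With K = 6 l m, each coordinate of the nodes runs through [-3l, 3l[ with step
    1/m, that is, through [-3, 3[ for the centres t/l: kernels centred near the
    faces of this cube do not meet the unit ball. *)
Definition node l m K (j : {ffun 'I_n.+1 -> 'I_K}) : pt :=
  \row_i ((j i)%:R / m%:R - 3 * l%:R).

(** Distributivity reduces the sum over the grid to the partition of unity in
    each coordinate. *)
Lemma kern_partition l m K x : (0 < l)%N -> (0 < m)%N -> K = (6 * l * m)%N -> B1 x ->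
  \sum_(j : {ffun 'I_n.+1 -> 'I_K}) kern l (node l m j) x = m%:R ^+ n.+1.
Proof.
move=> l0 m0 KE Bx.
transitivity (\prod_(i < n.+1) \sum_(k < K)
    bump (l%:R * (x ord0 i + 3) - k%:R / m%:R)).
  rewrite bigA_distr_bigA; apply: eq_bigr => j _; apply: eq_bigr => i _.
  by rewrite /kern_family !mxE; congr bump; ring.
rewrite -[in RHS](card_ord n.+1) -prodr_const; apply: eq_bigr => i _.
have /andP[x1 x2] := unit_ball_coord i Bx.
have l1 : (1 : R) <= l%:R by rewrite ler1n.
apply: bump_partition => //.
  by rewrite -[leLHS]mul1r ler_pM//; lra.
rewrite KE natrM mulfK ?pnatr_eq0 ?lt0n_neq0// natrM.
have : l%:R * (x ord0 i + 3) <= l%:R * 4 by rewrite ler_pM2l//; lra.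
by lra.
Qed.

Lemma kern_support_closed_box l t x : (0 < l)%N -> kern l t x != 0 ->
  closed_box (l%:R^-1 *: t - const_mx 1) (l%:R^-1 *: t + const_mx 1) x.
Proof.
move=> l0 k0 i; rewrite !mxE.
have l1 : (1 : R) <= l%:R by rewrite ler1n.
have h : `|x ord0 i - l%:R^-1 * t ord0 i| < 1.
  have : `|l%:R * (x ord0 i - l%:R^-1 * t ord0 i)| < 1.
    rewrite mulrBr mulrA divff ?mul1r; first exact: kern_neq0.
    by rewrite pnatr_eq0 -lt0n.
  rewrite normrM ger0_norm//; apply: le_lt_trans; rewrite ler_peMl//.
by move: h; rewrite ltr_norml => /andP[? ?]; apply/andP; split; lra.
Qed.

Lemma integrable_kern l t : (0 < l)%N -> mu.-integrable setT (EFin \o kern l t).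
Proof.
move=> l0; set K := closed_box (l%:R^-1 *: t - const_mx 1) (l%:R^-1 *: t + const_mx 1).
have mK : measurable (K : set X) := measurable_closed_box _ _.
have Kfin : (mu K < +oo)%E.
  apply: le_lt_trans (lebesgue_box_lty (l%:R^-1 *: t - const_mx 2, l%:R^-1 *: t + const_mx 2)).
  apply: le_lebesgue_outer => y Ky i; have := Ky i; rewrite !mxE => /andP[? ?].
  by apply/andP; split; lra.
apply: (@integrable_bounded_support _ _ _ mu setT K _ 1 measurableT mK _ Kfin
  (measurable_kern l t)) => //.
  by move=> y _; rewrite ger0_norm ?kern_ge0// kern_le1.
move=> y _; apply: contra_notP => /eqP k0; exact: kern_support_closed_box.
Qed.

(** The common integral of all kernels of size 1/l, by translation invariance. *)
Definition kern_mass l : R := Rintegral mu setT (kern l 0).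

Lemma Rintegral_kern l t : (0 < l)%N -> Rintegral mu setT (kern l t) = kern_mass l.
Proof.
move=> l0; rewrite /kern_mass /Rintegral; congr (fine _).
rewrite -(@ge0_integral_translate R n (- (l%:R^-1 *: t)) (EFin \o kern l 0)).
- by apply: eq_integral => x _; rewrite /= -kern_translate.
- by apply/measurable_EFinP; exact: measurable_kern.
- by move=> x; rewrite lee_fin kern_ge0.
Qed.

(** The kernels add up to a positive constant on the ball, and have the same
    integral. *)
Lemma kern_mass_gt0 l : (0 < l)%N -> (0 < mu B1)%E -> 0 < kern_mass l.
Proof.
move=> l0 B10.
apply: (@partition_mass_gt0 _ _ _ mu {ffun 'I_n.+1 -> 'I_(6 * l * 1)}
  (fun j => kern l (node l 1 j)) B1 (kern_mass l) (1%:R ^+ n.+1)).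
- exact: measurable_unit_ball.
- exact: B10.
- exact: lebesgue_unit_ball_lty.
- by rewrite expr1n.
- by move=> j; exact: integrable_kern.
- by move=> j x; exact: kern_ge0.
- by move=> j; exact: Rintegral_kern.
- by move=> x; exact: kern_partition.
Qed.

End kernel.

(** * Averages of a continuous function supported in the ball *)
Section extended_function.
Context {R : realType} {n : nat}.
Local Notation pt := 'rV[R]_n.+1.
Local Notation X := (Rn_leb R n).
Local Notation mu := (@lebesgue R n).
Local Notation B1 := (@unit_ball R n).
Implicit Types (x y t : pt) (l m : nat).

Variable v : pt -> R.
Hypotheses (cv : continuous v) (v0 : forall x, ~ B1 x -> v x = 0)
  (mv : measurable_fun setT (v : X -> R)).

(** Compactness of a larger cube, and v = 0 outside the ball: a point outside the
    cube and its neighbours lie outside the ball. *)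
Lemma uniform_continuity (w : R) : 0 < w -> exists2 d : R, 0 < d &
  forall x y, (forall i, `|y ord0 i - x ord0 i| <= d) -> `|v y - v x| <= w.
Proof.
move=> w0; pose A := closed_box (const_mx (- 2)) (const_mx 2 : pt).
have cA : compact A by exact: compact_closed_box.
pose P (d : R) x := forall y, (forall i, `|y ord0 i - x ord0 i| <= d) -> `|v y - v x| <= w.
have near_P : \forall d \near (0 : R)^'+, A `<=` P d.
  apply: (compact_near_coveringP _).1 => // x _.
  have /near_coordP[e e0 eP] : \forall y \near x, `|v y - v x| < w / 2.
    have w2 : 0 < w / 2 by rewrite divr_gt0.
    by move: (@cv x) => /cvgrPdistC_lt /(_ _ w2).
  have e2 : 0 < e / 2 by rewrite divr_gt0.
  exists (ball x (e / 2), [set d : R | d < e / 2]) => /=.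
    by split; [exact: nbhsx_ballx|exact: nbhs_right_lt].
  move=> [x' d] /= [[_ xx'] de] y yx'.
  have hx' : `|v x' - v x| < w / 2.
    apply: eP => i; have := xx' ord0 i; rewrite /ball /= distrC => /lt_trans; apply.
    by lra.
  have hy : `|v y - v x| < w / 2.
    apply: eP => i; have := xx' ord0 i; rewrite /ball /= distrC => h1.
    have := ler_normD (y ord0 i - x' ord0 i) (x' ord0 i - x ord0 i).
    by rewrite subrKA; have := yx' i; lra.
  have := ler_normB (v y - v x) (v x' - v x).
  by rewrite opprB addrA subrK; lra.
near (0 : R)^'+ => d0.
have AP : A `<=` P d0 by near: d0.
have d00 : 0 < d0 by near: d0; exact: nbhs_right_gt.
exists (Num.min d0 1); first by rewrite lt_min d00 ltr01.
move=> x y yx; have [Ax|nAx] := pselect (A x).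
  by apply: AP => // i; apply: (le_trans (yx i)); rewrite ge_min lexx.
have {}yx i : `|y ord0 i - x ord0 i| <= 1.
  by apply: (le_trans (yx i)); rewrite ge_min lexx orbT.
rewrite (v0 (x := x)) ?v0 ?subrr ?normr0 ?ltW// => /unit_ball_coord B; apply: nAx => i;
  rewrite !mxE.
- have /andP[? ?] := B i; have := yx i; rewrite ler_norml => /andP[? ?].
  by apply/andP; split; lra.
- by have /andP[? ?] := B i; apply/andP; split; lra.
Unshelve. all: by end_near. Qed.

Lemma bounded_v : exists2 M : R, 0 <= M & forall x, `|v x| <= M.
Proof.
pose A := closed_box (const_mx (- 1)) (const_mx 1 : pt).
have A0 : A !=set0 by exists 0 => i; rewrite !mxE; apply/andP; split; lra.
have cN : {within A, continuous (fun x => `|v x|)}.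
  apply: continuous_subspaceT => x.
  by apply: (@continuous_comp _ _ _ v (fun u : R => `|u|)); [exact: cv|exact: norm_continuous].
have [c _ cmax] := compact_EVT_max A0 (@compact_closed_box _ _ _ _) cN.
exists `|v c| => // x; have [Ax|nAx] := pselect (A x); first by apply: cmax; rewrite inE.
rewrite v0 ?normr0// => Bx; apply: nAx => i; rewrite !mxE.
by have /andP[? ?] := unit_ball_coord i Bx; apply/andP; split; apply: ltW.
Qed.

Lemma integrable_v : mu.-integrable setT (EFin \o (v : X -> R)).
Proof.
have [M M0 vM] := bounded_v.
apply: (@integrable_bounded_support _ _ _ mu setT B1 v M measurableT).
- exact: measurable_unit_ball.
- by [].
- exact: lebesgue_unit_ball_lty.
- exact: mv.
- by move=> x _; exact: vM.
- by move=> x _; exact: v0.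
Qed.

(** Divided by the integral of the kernel, this is a local average of v; without
    the division it is linear in the kernel, hence turns differences of kernels
    into differences in t. *)
Definition kern_integral l t : R := Rintegral mu setT (fun x => v x * kern l t x).

Lemma integrable_v_mul (b : X -> R) (c : R) : measurable_fun setT b ->
  (forall x, `|b x| <= c) -> mu.-integrable setT (EFin \o (fun x => v x * b x)).
Proof.
move=> mb bc.
by apply: (@integrableM_bounded _ _ _ mu setT v b c measurableT integrable_v mb) => x _.
Qed.

Lemma integrable_v_kern l t : mu.-integrable setT (EFin \o (fun x => v x * kern l t x)).
Proof.
apply: (@integrable_v_mul _ 1); first exact: measurable_kern.
by move=> x; rewrite ger0_norm ?kern_ge0 ?kern_le1.
Qed.

Lemma kern_integral_approx l t (w c : R) : (0 < l)%N ->
  (forall x, kern l t x != 0 -> `|v x - c| <= w) ->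
  `|kern_integral l t - @kern_mass R n l * c| <= w * @kern_mass R n l.
Proof.
move=> l0 vc.
have ik := @integrable_kern R n l t l0.
have ick : mu.-integrable setT (EFin \o (fun x => c * kern l t x)).
  by have := integrableZl measurableT c ik; apply: eq_integrable.
have -> : kern_integral l t - @kern_mass R n l * c =
    Rintegral mu setT (fun x => v x * kern l t x - c * kern l t x).
  rewrite RintegralB//; last exact: integrable_v_kern.
  by rewrite RintegralZl// Rintegral_kern// mulrC.
rewrite -(Rintegral_kern t l0).
have id : mu.-integrable setT (EFin \o (fun x => v x * kern l t x - c * kern l t x)).
  by have := integrableB measurableT (integrable_v_kern l t) ick; apply: eq_integrable.
apply: le_trans (le_normr_Rintegral measurableT id) _.
rewrite -RintegralZl//; apply: le_Rintegral => //.
- exact: integrable_norm.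
- by have := integrableZl measurableT w ik; apply: eq_integrable.
move=> x _; rewrite -/(kern l t x) -mulrBl normrM (ger0_norm (kern_ge0 _ _ _)).
have [->|kx] := eqVneq (kern l t x) 0; first by rewrite !mulr0.
by rewrite ler_wpM2r ?kern_ge0// vc.
Qed.

(** Kernels centred far from the ball do not see v: this makes v periodic on the
    grid, which can thus be regarded as a torus. *)
Lemma kern_integral_eq0 l t i : (0 < l)%N -> 2 * l%:R <= `|t ord0 i| -> kern_integral l t = 0.
Proof.
move=> l0 tl; rewrite /kern_integral (@eq_Rintegral _ _ _ mu setT (fun=> 0)).
  by rewrite Rintegral_cst// mul0r.
move=> x _; have [->|/kern_neq0/(_ i) kx] := eqVneq (kern l t x) 0; first by rewrite mulr0.
rewrite v0 ?mul0r// => /(unit_ball_coord i) /andP[x1 x2].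
have l1 : (1 : R) <= l%:R by rewrite ler1n.
have /ltW xl : `|l%:R * x ord0 i| < l%:R.
  by rewrite normrM ger0_norm// gtr_pMr ?ltr0n// ltr_norml x1.
have := ler_normB (l%:R * x ord0 i) (l%:R * x ord0 i - t ord0 i).
by rewrite subKr; move: kx tl xl l1; lra.
Qed.

End extended_function.

(** * Second derivatives of the kernels as differences in the parameter *)
Section kernel_laplacian.
Context {R : realType} {n : nat}.
Local Notation pt := 'rV[R]_n.+1.
Local Notation X := (Rn_leb R n).
Local Notation mu := (@lebesgue R n).
Local Notation B1 := (@unit_ball R n).
Implicit Types (x y t : pt) (l m : nat) (i : 'I_n.+1).

Lemma derive1_affine (f : R -> R) (a c : R) : smooth f ->
  (fun u => f (a * u + c))^`()%classic = (fun u => a * f^`()%classic (a * u + c)).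
Proof.
move=> sf; apply: derive1_of_is_derive => u; rewrite mulrC.
apply: (@is_derive1_comp _ f (fun u => a * u + c)); first exact: smooth_is_derive.
by apply: is_derive_eq; rewrite /GRing.scale /=; ring.
Qed.

Definition kern_d2 l t i x : R := prodf (partial_family [:: i; i] (kern_family l t)) x.

Let rest l t i x := \prod_(i' | i' != i) kern_family l t i' (x ord0 i').

Lemma kern_d2E l t i x : kern_d2 l t i x =
  l%:R ^+ 2 * (bump : R -> R)^`()%classic^`()%classic (l%:R * x ord0 i - t ord0 i) * rest l t i x.
Proof.
rewrite /kern_d2 /= prodf_upd; congr (_ * _); last first.
  by apply: eq_bigr => i' /negbTE i'i; rewrite /upd i'i.
rewrite {1}/upd eqxx /kern_family derive1_affine; last exact: smooth_bump.
have -> : (fun u => l%:R * (bump : R -> R)^`()%classic (l%:R * u + - t ord0 i))^`()%classic =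
    (fun u => l%:R * (l%:R * (bump : R -> R)^`()%classic^`()%classic (l%:R * u + - t ord0 i))).
  apply: derive1_of_is_derive => u.
  have sb : smooth ((bump : R -> R)^`()%classic) := smooth_derive1 smooth_bump.
  have := is_deriveZ l%:R (smooth_is_derive u (smooth_affine l%:R (- t ord0 i) sb)).
  by rewrite derive1_affine.
by rewrite expr2 !mulrA.
Qed.

Definition nudge t i (h : R) : pt := t + h *: delta_mx ord0 i.

Lemma nudgeE t i h i' : nudge t i h ord0 i' = t ord0 i' + (if i' == i then h else 0).
Proof. by rewrite !mxE eqxx /=; case: eqP => _; rewrite ?mulr1 ?mulr0. Qed.

Lemma kern_nudge l t i h x :
  kern l (nudge t i h) x = bump (l%:R * x ord0 i - t ord0 i - h) * rest l t i x.
Proof.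
rewrite /kern /prodf (bigD1 i)//= /kern_family nudgeE eqxx; congr (bump _ * _).
  by ring.
by apply: eq_bigr => i' /negbTE i'i; rewrite nudgeE i'i addr0.
Qed.

Lemma nudge0 t i : nudge t i 0 = t.
Proof. by rewrite /nudge scale0r addr0. Qed.

(** The kernel depends on l x - t only, so derivatives in x are differences in t
    up to the factor l^2; the error is a third order Taylor remainder in the step
    1/m, divided by the square of the step. *)
Lemma kern_d2_approx : exists2 C : R, 0 <= C & forall l m t i x, (0 < m)%N ->
  `|kern_d2 l t i x - l%:R ^+ 2 * m%:R ^+ 2 * (kern l (nudge t i m%:R^-1) x
      + kern l (nudge t i (- m%:R^-1)) x - 2 * kern l t x)| <= l%:R ^+ 2 * C / m%:R.
Proof.
have [C C0 bC] := @bump_second_difference R; exists C => // l m t i x m0.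
have m1 : (0 : R) < m%:R by rewrite ltr0n.
have rest01 : `|rest l t i x| <= 1.
  rewrite /rest normr_prod; apply: prodr_ile1 => i' _.
  have /andP[b0 b1] := bump_itv (l%:R * x ord0 i' + - t ord0 i').
  by rewrite normr_ge0 /kern_family ger0_norm.
have kt : kern l t x = bump (l%:R * x ord0 i - t ord0 i) * rest l t i x.
  by rewrite -[in LHS](nudge0 t i) kern_nudge subr0.
rewrite !kern_nudge kern_d2E kt opprK.
have mV0 : 0 <= m%:R^-1 :> R by rewrite invr_ge0 ltW.
have := bC (l%:R * x ord0 i - t ord0 i) _ mV0.
set s := l%:R * x ord0 i - t ord0 i; set D := _^`()%classic s.
set r := rest l t i x in rest01 *; set h := m%:R^-1 => hC.
have -> : l%:R ^+ 2 * D * r - l%:R ^+ 2 * m%:R ^+ 2 *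
    (bump (s - h) * r + bump (s + h) * r - 2 * (bump s * r)) =
  - (l%:R ^+ 2 * m%:R ^+ 2 * (bump (s + h) + bump (s - h) - 2 * bump s - h ^+ 2 * D) * r).
  have hm : m%:R * h = 1 by rewrite /h divff// gt_eqF.
  have -> : l%:R ^+ 2 * D * r = l%:R ^+ 2 * (m%:R * h) ^+ 2 * D * r.
    by rewrite hm expr1n mulr1.
  by ring.
have lm0 : 0 <= l%:R ^+ 2 * m%:R ^+ 2 :> R by rewrite mulr_ge0// exprn_ge0.
rewrite normrN normrM normrM (ger0_norm lm0).
apply: (@le_trans _ _ (l%:R ^+ 2 * m%:R ^+ 2 * (C * h ^+ 3) * 1)).
  by rewrite ler_pM// ?mulr_ge0// ler_wpM2l.
rewrite mulr1 le_eqVlt; apply/orP; left; apply/eqP.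
have -> : l%:R ^+ 2 * m%:R ^+ 2 * (C * h ^+ 3) = l%:R ^+ 2 * C * h * (m%:R * h) ^+ 2 by ring.
by rewrite /h divff ?gt_eqF// expr1n mulr1.
Qed.

Lemma measurable_kern_d2 l t i : measurable_fun setT (kern_d2 l t i : X -> R).
Proof.
apply: measurable_prodf => i'; apply: smooth_continuous.
by apply: smooth_partial_family; exact: smooth_kern_family.
Qed.

Lemma kern_d2_bounded l t i : exists c, forall x, `|kern_d2 l t i x| <= c.
Proof.
have [C C0 dC] := kern_d2_approx.
exists (l%:R ^+ 2 * C / 1 + l%:R ^+ 2 * 4) => x.
have := dC l 1%N t i x isT.
set k1 := kern l (nudge t i _) x; set k2 := kern l (nudge t i _) x; set k := kern l t x.
have : `|l%:R ^+ 2 * 1%:R ^+ 2 * (k1 + k2 - 2 * k)| <= l%:R ^+ 2 * 4 :> R.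
  rewrite expr1n mulr1 normrM ger0_norm ?exprn_ge0// ler_wpM2l ?exprn_ge0// ler_norml.
  have := kern_ge0 l (nudge t i 1%:R^-1) x; have := kern_le1 l (nudge t i 1%:R^-1) x.
  have := kern_ge0 l (nudge t i (- 1%:R^-1)) x; have := kern_le1 l (nudge t i (- 1%:R^-1)) x.
  have := kern_ge0 l t x; have := kern_le1 l t x.
  by rewrite -/k -/k1 -/k2; lra.
set w := _ * (k1 + k2 - 2 * k) => h1 h2.
rewrite -(subrK w (kern_d2 l t i x)); apply: le_trans (ler_normD _ _) _.
exact: lerD.
Qed.

End kernel_laplacian.

(** * Kato's inequality *)
Section kato.
Context {R : realType} {n : nat}.
Local Notation pt := 'rV[R]_n.+1.
Local Notation X := (Rn_leb R n).
Local Notation mu := (@lebesgue R n).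
Local Notation B1 := (@unit_ball R n).
Implicit Types (x y t : pt) (l m : nat) (i : 'I_n.+1).

(** The distributional identity, restricted to the test functions used here. The
    Laplacian is split into one integral for each pure second derivative. *)
Definition weak_laplacian (f : pt -> R) (g : X -> R) : Prop :=
  forall (J : finType) (c : J -> R) (Fs : J -> 'I_n.+1 -> R -> R) (K : set pt),
    (forall a, smooth_family (Fs a)) -> compact K -> K `<=` B1 ->
    measurable (K : set X) -> (forall x, ~ K x -> comb (index_enum J) c Fs x = 0) ->
    Rintegral mu B1 (fun x => g x * comb (index_enum J) c Fs x) =
    \sum_i Rintegral mu B1 (fun x => f x *
      comb (index_enum J) c (fun a => partial_family [:: i; i] (Fs a)) x).

Variable v : pt -> R.
Hypotheses (cv : continuous v) (v0 : forall x, ~ B1 x -> v x = 0)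
  (mv : measurable_fun setT (v : X -> R)).

Let intv : mu.-integrable setT (EFin \o (v : X -> R)) := integrable_v cv v0 mv.

(** The cyclic successor on the grid is a step of length 1/m: when it wraps
    around, both sides vanish, since both parameters are far from the ball. *)
Lemma kern_integral_succ l m i (j : {ffun 'I_n.+1 -> 'I_(6 * l * m)}) : (0 < l)%N -> (0 < m)%N ->
  kern_integral v l (node l m (shift_coord i (@ordS _) j)) = kern_integral v l (nudge (node l m j) i m%:R^-1).
Proof.
move=> l0 m0; have l1 : (1 : R) <= l%:R by rewrite ler1n.
have m1 : (0 : R) < m%:R by rewrite ltr0n.
have [lt|ge] := ltnP (j i).+1 (6 * l * m).
  congr kern_integral; apply/rowP => i'; rewrite nudgeE !mxE ffunE; case: eqP => [->|_].
    by rewrite /= modn_small// -natr1; ring.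
  by rewrite addr0.
have jE : (j i).+1 = (6 * l * m)%N by apply/eqP; rewrite eqn_leq ge ltn_ord.
rewrite !(@kern_integral_eq0 _ _ _ v0 _ _ i)//.
  rewrite nudgeE eqxx mxE.
  have -> : (j i)%:R / m%:R - 3 * l%:R + m%:R^-1 = (j i).+1%:R / m%:R - 3 * l%:R :> R.
    by rewrite -natr1; ring.
  rewrite jE natrM mulfK ?gt_eqF// natrM ler_normr; apply/orP; left; lra.
rewrite mxE ffunE eqxx /= jE modnn mul0r add0r normrN normrM !ger0_norm//; lra.
Qed.

Lemma kern_integral_pred l m i (j : {ffun 'I_n.+1 -> 'I_(6 * l * m)}) : (0 < l)%N -> (0 < m)%N ->
  kern_integral v l (node l m (shift_coord i (@ord_pred _) j)) =
  kern_integral v l (nudge (node l m j) i (- m%:R^-1)).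
Proof.
move=> l0 m0; have l1 : (1 : R) <= l%:R by rewrite ler1n.
have m1 : (1 : R) <= m%:R by rewrite ler1n.
have mV : 0 <= (m%:R^-1 : R) <= 1 by rewrite invr_ge0 invf_le1 ?(lt_le_trans ltr01)// m1 ler0n.
have K0 : (0 < 6 * l * m)%N by rewrite !muln_gt0 l0.
have [lt|] := ltnP 0 (j i).
  congr kern_integral; apply/rowP => i'; rewrite nudgeE !mxE ffunE; case: eqP => [->|_].
    have -> : (ord_pred (j i) : nat) = (j i).-1.
      rewrite /= -(prednK lt) addSn /= -{2}(modn_small (m := (j i).-1) (d := 6 * l * m)).
        by rewrite modnDr.
      by rewrite (leq_trans _ (ltn_ord (j i)))// prednK.
    by rewrite -[in RHS](prednK lt) -natr1; ring.
  by rewrite addr0.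
rewrite leqn0 => /eqP jE.
rewrite !(@kern_integral_eq0 _ _ _ v0 _ _ i)//.
  rewrite nudgeE eqxx mxE jE mul0r add0r ler_normr; apply/orP; right.
  by move: mV l1 => /andP[]; lra.
rewrite mxE ffunE eqxx /= jE add0n modn_small ?prednK//.
have -> : (6 * l * m).-1%:R = 6 * l%:R * m%:R - 1 :> R.
  by rewrite -subn1 natrB// !natrM.
rewrite mulrBl mulfK ?gt_eqF ?(lt_le_trans ltr01)// ler_normr; apply/orP; left.
by move: mV l1 => /andP[]; lra.
Qed.

Lemma integrable_v_kern_d2 l t i :
  mu.-integrable setT (EFin \o (fun x => v x * kern_d2 l t i x)).
Proof.
have [c kc] := @kern_d2_bounded R n l t i.
exact: (integrable_v_mul cv v0 mv (measurable_kern_d2 l t i) kc).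
Qed.

Definition l1_norm : R := Rintegral mu setT (fun x => `|v x|).

Variable C : R.
Hypotheses (C0 : 0 <= C) (d2C : forall l m t i x, (0 < m)%N ->
  `|kern_d2 l t i x - l%:R ^+ 2 * m%:R ^+ 2 * (kern l (nudge t i m%:R^-1) x
      + kern l (nudge t i (- m%:R^-1)) x - 2 * kern l t x)| <= l%:R ^+ 2 * C / m%:R).

Lemma kern_integral_d2 l m t i : (0 < m)%N ->
  `|Rintegral mu setT (fun x => v x * kern_d2 l t i x) -
    l%:R ^+ 2 * m%:R ^+ 2 * (kern_integral v l (nudge t i m%:R^-1) +
      kern_integral v l (nudge t i (- m%:R^-1)) - 2 * kern_integral v l t)| <= l%:R ^+ 2 * C / m%:R * l1_norm.
Proof.
move=> m0; have kb s x : `|kern l s x : R| <= 1.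
  by rewrite ger0_norm ?kern_ge0 ?kern_le1.
apply: (@Rintegral_comb_approx _ _ _ mu setT v (kern l (nudge t i m%:R^-1))
  (kern l (nudge t i (- m%:R^-1))) (kern l t) (kern_d2 l t i) _ _ measurableT intv
  (measurable_kern _ _) (measurable_kern _ _) (measurable_kern _ _)
  (measurable_kern_d2 l t i) (kb _) (kb _) (kb _)) => x.
exact: d2C.
Qed.

Variable g : X -> R.
Hypotheses (ig : forall K : set pt, compact K -> K `<=` B1 -> measurable (K : set X) ->
    mu.-integrable K (EFin \o g))
  (lap : weak_laplacian v g).

Definition superlevel (d : R) : set pt := [set x | d <= `|v x|].

Lemma superlevel_ball (d : R) : 0 < d -> superlevel d `<=` B1.
Proof.
move=> d0 x /= dx; apply: contrapT => nBx; move: dx.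
by rewrite /superlevel /= v0// normr0 leNgt d0.
Qed.

Lemma compact_superlevel (d : R) : 0 < d -> compact (superlevel d).
Proof.
move=> d0; apply: (@subclosed_compact _ _ (closed_box (const_mx (-1)) (const_mx 1))).
- have -> : superlevel d = (fun x => `|v x|) @^-1` [set u | d <= u].
    by apply/seteqP; split.
  apply: closed_comp; last exact: closed_ge.
  move=> x _; apply: (@continuous_comp _ _ _ v (fun u : R => `|u|)); first exact: cv.
  exact: norm_continuous.
- exact: compact_closed_box.
- move=> x /(superlevel_ball d0) Bx i; rewrite !mxE.
  by have /andP[? ?] := unit_ball_coord i Bx; apply/andP; split; apply: ltW.
Qed.

Lemma measurable_superlevel (d : R) : measurable (superlevel d : set X).
Proof.
have -> : superlevel d = (fun x : X => `|v x|) @^-1` `[d, +oo[%classic.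
  by apply/seteqP; split => x /=; rewrite in_itv/= andbT.
rewrite -[_ @^-1` _]setTI.
by apply: (measurableT_comp (@normr_measurable R setT) mv).
Qed.

Variables (psi : R -> R) (L delta : R).
Hypotheses (psi_mono : forall a b, a <= b -> psi a <= psi b)
  (psi_le1 : forall a, `|psi a| <= 1)
  (psi_lip : forall a b, `|psi a - psi b| <= L * `|a - b|)
  (psi0 : forall a, `|a| <= delta -> psi a = 0)
  (mpsi : measurable_fun setT psi) (delta0 : 0 < delta) (B1_gt0 : (0 < mu B1)%E).

(** The size 1/l of the kernels is chosen so that v oscillates by at most w on
    their supports; m is still free. *)
Section step.
Variables (w : R) (l m : nat).
Hypotheses (w0 : 0 < w) (w_delta : 4 * w <= delta) (l0 : (0 < l)%N) (m0 : (0 < m)%N)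
  (osc : forall x y, (forall i, `|y ord0 i - x ord0 i| <= l%:R^-1) -> `|v y - v x| <= w).

Let J := {ffun 'I_n.+1 -> 'I_(6 * l * m)}.
Let kap := @kern_mass R n l.
Let coef (j : J) : R := (m%:R ^+ n.+1)^-1 * psi (kern_integral v l (node l m j) / kap).
Let phi := comb (index_enum J) coef (fun j => kern_family l (node l m j)).

Let kap0 : 0 < kap. Proof. exact: kern_mass_gt0. Qed.

Let mN0 : 0 < (m%:R : R) ^+ n.+1. Proof. by rewrite exprn_gt0 ?ltr0n. Qed.

Let near_node x (j : J) : kern l (node l m j) x != 0 ->
  `|kern_integral v l (node l m j) / kap - v x| <= 2 * w.
Proof.
move=> kx; set t := node l m j.
have lR : (0 : R) < l%:R by rewrite ltr0n.
have close y : kern l t y != 0 -> `|v y - v (l%:R^-1 *: t)| <= w.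
  move=> /kern_neq0 ky; apply: osc => i.
  have -> : y ord0 i - (l%:R^-1 *: t) ord0 i = l%:R^-1 * (l%:R * y ord0 i - t ord0 i).
    by rewrite [in LHS]mxE mulrBr mulKf// gt_eqF.
  have lV : 0 < l%:R^-1 :> R by rewrite invr_gt0.
  by rewrite normrM (gtr0_norm lV) ler_piMr ?(ltW lV)//; exact: ltW (ky i).
have : `|kern_integral v l t - kap * v x| <= 2 * w * kap.
  apply: kern_integral_approx => // y ky.
  have := ler_normB (v y - v (l%:R^-1 *: t)) (v x - v (l%:R^-1 *: t)).
  rewrite opprB addrA subrK; have := close y ky; have := close x kx; lra.
have -> : kern_integral v l t - kap * v x = (kern_integral v l t / kap - v x) * kap.
  by rewrite mulrBl divfK ?gt_eqF// mulrC.
by rewrite normrM (gtr0_norm kap0) ler_pM2r.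
Qed.

Let phi_approx x : B1 x -> `|phi x - psi (v x)| <= L * (2 * w).
Proof.
move=> Bx.
have -> : phi x - psi (v x) = \sum_(j : J) (m%:R ^+ n.+1)^-1 *
    (kern l (node l m j) x * (psi (kern_integral v l (node l m j) / kap) - psi (v x))).
  rewrite -mulr_sumr; under eq_bigr do rewrite mulrBr.
  rewrite sumrB -mulr_suml kern_partition// mulrBr mulrA mulVf ?gt_eqF// mul1r.
  rewrite mulr_sumr; congr (_ - _); apply: eq_bigr => j _.
  by rewrite /coef -/(kern l (node l m j) x); ring.
apply: le_trans (ler_norm_sum _ _ _) _.
have -> : L * (2 * w) = \sum_(j : J) (m%:R ^+ n.+1)^-1 * (kern l (node l m j) x * (L * (2 * w))).
  by rewrite -mulr_sumr -mulr_suml kern_partition// mulKf// gt_eqF.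
apply: ler_sum => j _.
have kx0 : 0 <= kern l (node l m j) x := kern_ge0 _ _ _.
rewrite normrM gtr0_norm ?invr_gt0// ler_wpM2l ?invr_ge0 ?(ltW mN0)// normrM ger0_norm//.
have [kz|kx] := eqVneq (kern l (node l m j) x) 0; first by rewrite kz !mul0r lexx.
rewrite ler_wpM2l//; apply: le_trans (psi_lip _ _) _.
have L0 : 0 <= L by have := le_trans (normr_ge0 _) (psi_lip 1 0); rewrite subr0 normr1 mulr1.
by rewrite ler_wpM2l// near_node.
Qed.

Let phi_support x : ~ superlevel (delta / 2) x -> phi x = 0.
Proof.
move=> /negP; rewrite -ltNge => vx; rewrite /phi /comb big1// => j _.
rewrite -/(kern l (node l m j) x).
have [->|kx] := eqVneq (kern l (node l m j) x) 0; first by rewrite mulr0.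
rewrite /coef psi0 ?mulr0 ?mul0r//.
have := near_node kx.
have := ler_normD (kern_integral v l (node l m j) / kap - v x) (v x).
by rewrite subrK; move: w_delta vx; lra.
Qed.

Let coef_le (j : J) : `|coef j| <= (m%:R ^+ n.+1)^-1.
Proof.
by rewrite /coef normrM gtr0_norm ?invr_gt0// ler_piMr// invr_ge0 ltW.
Qed.

(** The grid sum is a nonpositive main term plus an error for each node; in
    dimension N, the number (6 l m)^N of nodes is compensated by the factor m^-N
    in phi. *)
Let second_order_le i :
  Rintegral mu B1 (fun x => v x *
    comb (index_enum J) coef (fun j => partial_family [:: i; i] (kern_family l (node l m j))) x)
  <= (6 * l)%:R ^+ n.+1 * (l%:R ^+ 2 * C / m%:R * l1_norm).
Proof.
rewrite Rintegral_setT; last by move=> x /v0 ->; rewrite mul0r.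
pose h (j : J) x := coef j * (v x * kern_d2 l (node l m j) i x).
have ih j : mu.-integrable setT (EFin \o (h j : X -> R)).
  have := integrableZl measurableT (coef j) (integrable_v_kern_d2 l (node l m j) i).
  by apply: eq_integrable.
rewrite (@eq_Rintegral _ _ _ mu setT (fun x => \sum_(j : J) h j x)); last first.
  by move=> x _; rewrite /comb mulr_sumr; apply: eq_bigr => j _; rewrite /h /kern_d2; ring.
have [_ ->] := @Rintegral_sum _ _ _ mu setT _ (index_enum J) h measurableT ih.
pose f (j : J) := kern_integral v l (node l m j).
pose s := shift_coord i (@ordS (6 * l * m)); pose s' := shift_coord i (@ord_pred (6 * l * m)).
pose e := l%:R ^+ 2 * C / m%:R * l1_norm.
have hj j : Rintegral mu setT (h j) <=
    (m%:R ^+ n.+1)^-1 * (l%:R ^+ 2 * m%:R ^+ 2) *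
      (psi (f j / kap) * (f (s j) + f (s' j) - 2 * f j)) + (m%:R ^+ n.+1)^-1 * e.
  rewrite /h RintegralZl//; last exact: integrable_v_kern_d2.
  have := kern_integral_d2 l (node l m j) i m0; rewrite -kern_integral_succ// -kern_integral_pred// -/(f _) -/(f _) -/(f _).
  set I := Rintegral _ _ _; set D := f _ + _ - _; rewrite -/e => Ie.
  have -> : coef j * I = (m%:R ^+ n.+1)^-1 * (l%:R ^+ 2 * m%:R ^+ 2) * (psi (f j / kap) * D)
      + coef j * (I - l%:R ^+ 2 * m%:R ^+ 2 * D).
    by rewrite /coef -/(f j); ring.
  rewrite lerD2l; apply: le_trans (ler_norm _) _; rewrite normrM.
  by apply: ler_pM => //; exact: coef_le.
apply: le_trans (ler_sum _ (fun j _ => hj j)) _.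
rewrite big_split /= -mulr_sumr sumr_const card_ffun !card_ord -[leRHS]add0r.
apply: lerD.
  apply: mulr_ge0_le0.
    by apply: mulr_ge0; [rewrite invr_ge0 ltW|apply: mulr_ge0; exact: exprn_ge0].
  apply: (@sum_second_difference_le0 R J s s' f (fun a => psi (a / kap))).
  - by apply: shift_coordK; exact: ordSK.
  - by apply: shift_coordK; exact: ord_predK.
  - by move=> a b ab; apply: psi_mono; rewrite ler_pM2r ?invr_gt0.
rewrite -/e -[leLHS]mulr_natl natrX mulrA natrM exprMn -!mulrA.
by rewrite (mulrA (m%:R ^+ n.+1)) divff ?mul1r// gt_eqF.
Qed.

(** The first term bounds the distance from phi to psi(v), the second one the
    error in the summation by parts. The latter tends to 0 as m -> oo with l
    fixed. *)
Lemma kato_grid_estimate :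
  Rintegral mu B1 (fun x => g x * psi (v x)) <=
  L * (2 * w) * Rintegral mu B1 (fun x => `|g x * \1_(superlevel (delta / 2)) x|)
  + n.+1%:R * ((6 * l)%:R ^+ n.+1 * (l%:R ^+ 2 * C / m%:R * l1_norm)).
Proof.
set K := superlevel (delta / 2).
have d20 : 0 < delta / 2 by rewrite divr_gt0.
have mK : measurable (K : set X) := @measurable_superlevel _.
have KB : K `<=` B1 := @superlevel_ball _ d20.
have cK : compact K := @compact_superlevel _ d20.
have mB : measurable (B1 : set X) := @measurable_unit_ball R n.
pose gK x := g x * \1_K x.
have igK : mu.-integrable B1 (EFin \o gK).
  by apply: integrable_mul_indic => //; exact: ig.
have mpv : measurable_fun (B1 : set X) (fun x => psi (v x)).
  by apply: measurableT_comp => //; exact: measurable_funTS mv.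
have mphi : measurable_fun (B1 : set X) (phi : X -> R).
  apply: measurable_sum => j; apply: measurable_funM => //.
  by apply: measurable_funTS; exact: measurable_kern.
have L0 : 0 <= L by have := le_trans (normr_ge0 _) (psi_lip 1 0); rewrite subr0 normr1 mulr1.
have phib x : B1 x -> `|phi x| <= L * (2 * w) + 1.
  move=> Bx; rewrite -(subrK (psi (v x)) (phi x)); apply: le_trans (ler_normD _ _) _.
  by apply: lerD => //; exact: phi_approx.
have i1 := integrableM_bounded mB igK mpv (fun x _ => psi_le1 (v x)).
have i2 := integrableM_bounded mB igK mphi phib.
have E1 : Rintegral mu B1 (fun x => g x * psi (v x)) = Rintegral mu B1 (fun x => gK x * psi (v x)).
  apply: eq_Rintegral => x _; rewrite /gK indicE.
  have [|/negP] := boolP (x \in K); first by rewrite mulr1.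
  rewrite inE /K /superlevel /= => /negP; rewrite -ltNge => vx.
  by rewrite psi0 ?mulr0// (le_trans (ltW vx))//; move: delta0; lra.
have E2 : Rintegral mu B1 (fun x => g x * phi x) = Rintegral mu B1 (fun x => gK x * phi x).
  apply: eq_Rintegral => x _; rewrite /gK indicE.
  have [|/negP] := boolP (x \in K); first by rewrite mulr1.
  by rewrite inE => /phi_support ->; rewrite !mulr0.
have E3 : Rintegral mu B1 (fun x => g x * phi x) <=
    n.+1%:R * ((6 * l)%:R ^+ n.+1 * (l%:R ^+ 2 * C / m%:R * l1_norm)).
  have sF j := @smooth_kern_family R n l (node l m (j : J)).
  rewrite (lap sF cK KB mK phi_support).
  apply: le_trans (ler_sum _ (fun i _ => second_order_le i)) _.
  by rewrite sumr_const card_ord mulr_natl.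
rewrite E1 -(subrK (Rintegral mu B1 (fun x => gK x * phi x))
  (Rintegral mu B1 (fun x => gK x * psi (v x)))).
apply: lerD; last by rewrite -E2.
rewrite -RintegralB// -RintegralZl//; last exact: integrable_norm.
apply: le_Rintegral => //.
- by have := integrableB mB i1 i2; apply: eq_integrable.
- by have := integrableZl mB (L * (2 * w)) (integrable_norm igK); apply: eq_integrable.
move=> x Bx; rewrite -mulrBr; apply: le_trans (ler_norm _) _.
by rewrite normrM mulrC ler_wpM2r// distrC phi_approx.
Qed.

End step.

(** Were the integral I positive, one could choose w small, then l large, then m
    large, so that both terms of the grid estimate are below I / 2. *)
Lemma kato : Rintegral mu B1 (fun x => g x * psi (v x)) <= 0.
Proof.
set I := Rintegral _ _ _; rewrite leNgt; apply/negP => I0.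
set G := Rintegral mu B1 (fun x => `|g x * \1_(superlevel (delta / 2)) x|).
have G0 : 0 <= G by apply: Rintegral_ge0.
have L0 : 0 <= L by have := le_trans (normr_ge0 _) (psi_lip 1 0); rewrite subr0 normr1 mulr1.
have l1_norm0 : 0 <= l1_norm by apply: Rintegral_ge0.
have LG0 : 0 < L * G + 1 by rewrite ltr_wpDl ?mulr_ge0.
(* The first term of the grid estimate is 2 w L G, at most I / 2 for this w. *)
pose w := Num.min (delta / 4) (I / (4 * (L * G + 1))).
have w0 : 0 < w by rewrite lt_min !divr_gt0// mulr_gt0.
have w_delta : 4 * w <= delta.
  by rewrite -ler_pdivlMl// mulrC ge_min lexx.
have wI : L * (2 * w) * G <= I / 2.
  have : w * (4 * (L * G + 1)) <= I.
    by rewrite -ler_pdivlMr ?mulr_gt0// ge_min lexx orbT.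
  have -> : w * (4 * (L * G + 1)) = 2 * (L * (2 * w) * G) + 4 * w by ring.
  by move: w0; lra.
have [d d0 dv] := uniform_continuity cv v0 w0.
have [k kd] : exists k : nat, k.+1%:R^-1 < d.
  have [k _ /(_ k (leqnn k)) kP] := @near_infty_natSinv_lt R (PosNum d0).
  by exists k.
have osc x y : (forall i, `|y ord0 i - x ord0 i| <= k.+1%:R^-1) -> `|v y - v x| <= w.
  by move=> yx; apply: dv => i; apply: le_trans (yx i) (ltW kd).
(* The second term is E / m, with E independent of m. *)
pose E : R := n.+1%:R * ((6 * k.+1)%:R ^+ n.+1 * (k.+1%:R ^+ 2 * C * l1_norm)).
have E0 : 0 <= E by rewrite !mulr_ge0 ?exprn_ge0.
have IE : 0 < I / 2 / (E + 1) by rewrite !divr_gt0// ltr_wpDl.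
have [j jE] : exists j : nat, j.+1%:R^-1 < I / 2 / (E + 1).
  have [j _ /(_ j (leqnn j)) jP] := @near_infty_natSinv_lt R (PosNum IE).
  by exists j.
have := @kato_grid_estimate w k.+1 j.+1 w_delta isT isT osc.
rewrite -/I -/G.
have -> : n.+1%:R * ((6 * k.+1)%:R ^+ n.+1 * (k.+1%:R ^+ 2 * C / j.+1%:R * l1_norm)) =
  E * j.+1%:R^-1 by rewrite /E; ring.
have : E * j.+1%:R^-1 < I / 2.
  apply: (@le_lt_trans _ _ ((E + 1) * j.+1%:R^-1)).
    by rewrite ler_wpM2r ?invr_ge0// lerDl.
  by rewrite mulrC -ltr_pdivlMr// ltr_wpDl.
have split2 (a b c : R) : a <= c / 2 -> b < c / 2 -> c <= a + b -> False.
  move=> ac bc cab; have : c < c by lra.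
  by rewrite ltxx.
exact: split2 wI.
Qed.

End kato.

(** * Weak derivatives *)
Section weak_derivatives.
Context {R : realType} {n : nat}.
Local Notation pt := 'rV[R]_n.+1.
Local Notation X := (Rn_leb R n).
Local Notation mu := (@lebesgue R n).
Local Notation B1 := (@unit_ball R n).
Local Notation B1c := (@closed_unit_ball R n).
Implicit Types (x y : pt) (i j : 'I_n.+1) (u w f g : pt -> R).

Lemma Lp_loc_integrable (D K : set pt) f : Lp_loc D 1 f -> compact K -> K `<=` D ->
  measurable (D : set X) -> measurable (K : set X) ->
  mu.-integrable (K : set X) (EFin \o (f : X -> R)).
Proof.
move=> [mf fK] cK KD mD mK; apply/integrableP; split.
  by apply/measurable_EFinP; exact: measurable_funS mf.
have := fK K cK KD; rewrite /Lp_norm Lnorm1; apply: le_lt_trans.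
rewrite [leLHS]integral_mkcond le_eqVlt; apply/orP; left; apply/eqP.
by apply: eq_integral => x _; rewrite restrict_abse /= restrict_EFin.
Qed.

Lemma weak_derivativeP (D : set pt) s f g : is_weak_derivative D s f g ->
  is_weak_derivative D s f (weak_derivative D s f).
Proof. by move=> fg; rewrite /weak_derivative; case: xgetP => [h -> //|/(_ g)]. Qed.

Lemma closed_unit_ballE x : B1c x <-> \sum_i x ord0 i ^+ 2 <= 1.
Proof. by rewrite /closed_unit_ball /enorm /= -{1}(@sqrtr1 R) ler_sqrt. Qed.

Lemma unit_ball_closed x : B1 x -> B1c x.
Proof. exact: ltW. Qed.

Lemma compact_closed_unit_ball : compact B1c.
Proof.
apply: (@subclosed_compact _ _ (closed_box (const_mx (-1)) (const_mx 1))).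
- have -> : B1c = (fun x : pt => \sum_i x ord0 i ^+ 2) @^-1` [set u | u <= 1].
    by apply/seteqP; split => x /closed_unit_ballE.
  apply: closed_comp; last exact: closed_le.
  by move=> x _; exact: continuous_sqr_enorm.
- exact: compact_closed_box.
- move=> x x1 i; rewrite !mxE -ler_norml.
  exact: le_trans (coord_le_enorm x i) x1.
Qed.

Lemma integrable_continuous_closed_ball u : {within B1c, continuous u} ->
  measurable_fun (B1 : set X) (u : X -> R) ->
  mu.-integrable (B1 : set X) (EFin \o (u : X -> R)).
Proof.
move=> cu mmu; have B0 : B1c !=set0.
  by exists 0; apply/closed_unit_ballE; rewrite big1// => i _; rewrite mxE expr0n.
have cN : {within B1c, continuous (fun x => `|u x|)}.
  move=> x; apply: (@continuous_comp _ _ _ (u : subspace B1c -> R) (fun t : R => `|t|)).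
    exact: cu.
  exact: norm_continuous.
have [c _ cmax] := compact_EVT_max B0 compact_closed_unit_ball cN.
apply: measurable_bounded_integrable => //.
- exact: measurable_unit_ball.
- exact: lebesgue_unit_ball_lty.
- exists `|u c|; split; first exact: num_real.
  move=> M cM x Bx; apply: le_trans (ltW cM); apply: cmax; rewrite inE.
  exact: unit_ball_closed.
Qed.

Lemma comb_bounded (I : Type) (r : seq I) c (Fs : I -> 'I_n.+1 -> R -> R) :
  (forall a, smooth_family (Fs a)) -> exists M, forall x, B1 x -> `|comb r c Fs x| <= M.
Proof.
move=> sF; have B0 : B1c !=set0.
  by exists 0; apply/closed_unit_ballE; rewrite big1// => i _; rewrite mxE expr0n.
have cN : {within B1c, continuous (fun x => `|comb r c Fs x|)}.
  apply: continuous_subspaceT => x.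
  apply: (@continuous_comp _ _ _ (comb r c Fs) (fun t : R => `|t|)).
    by apply: differentiable_continuous; exact: differentiable_comb.
  exact: norm_continuous.
have [y _ ymax] := compact_EVT_max B0 compact_closed_unit_ball cN.
by exists `|comb r c Fs y| => x Bx; apply: ymax; rewrite inE; exact: unit_ball_closed.
Qed.

Lemma measurable_comb (I : Type) (r : seq I) c (Fs : I -> 'I_n.+1 -> R -> R) :
  (forall a, smooth_family (Fs a)) -> measurable_fun (B1 : set X) (comb r c Fs : X -> R).
Proof.
move=> sF; apply: measurable_sum => a; apply: measurable_funM => //.
by apply: measurable_funTS; apply: measurable_prodf => i; exact/smooth_continuous/sF.
Qed.

Lemma integrable_mul_comb u (I : Type) (r : seq I) c (Fs : I -> 'I_n.+1 -> R -> R) :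
  mu.-integrable (B1 : set X) (EFin \o (u : X -> R)) ->
  (forall a, smooth_family (Fs a)) ->
  mu.-integrable (B1 : set X) (EFin \o (fun x : X => u x * comb r c Fs x)).
Proof.
move=> iu sF; have [M cM] := comb_bounded r c sF.
exact: (integrableM_bounded (@measurable_unit_ball R n) iu (measurable_comb r c sF) cM).
Qed.

Lemma integrable_loc_mul_comb g (K : set pt) (I : Type) (r : seq I) c (Fs : I -> 'I_n.+1 -> R -> R) :
  Lp_loc B1 1 g -> compact K -> K `<=` B1 -> measurable (K : set X) ->
  (forall a, smooth_family (Fs a)) -> (forall x, ~ K x -> comb r c Fs x = 0) ->
  mu.-integrable (B1 : set X) (EFin \o (fun x : X => g x * comb r c Fs x)).
Proof.
move=> lg cK KB mK sF c0; have mB := @measurable_unit_ball R n.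
have ig := Lp_loc_integrable lg cK KB mB mK.
have [M cM] := comb_bounded r c sF.
have := integrableM_bounded mB (integrable_mul_indic mB mK KB ig) (measurable_comb r c sF) cM.
apply: eq_integrable => // x _ /=; rewrite indicE.
have [|/negP] := boolP (x \in K); first by rewrite mulr1.
by rewrite inE => /c0 ->; rewrite !mulr0.
Qed.

Lemma weak_derivative_comb u s g (K : set pt) (I : Type) (r : seq I) c
    (Fs : I -> 'I_n.+1 -> R -> R) : is_weak_derivative B1 s u g ->
  compact K -> K `<=` B1 -> (forall a, smooth_family (Fs a)) ->
  (forall x, ~ K x -> comb r c Fs x = 0) ->
  Rintegral mu B1 (fun x => u x * comb r c (fun a => partial_family s (Fs a)) x) =
  (-1) ^+ size s * Rintegral mu B1 (fun x => g x * comb r c Fs x).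
Proof.
move=> [_ _ ug] cK KB sF c0; rewrite -partials_comb//.
exact/ug/(test_function_comb sF cK KB c0).
Qed.

(** The classical second derivatives of a test function commute, so both weak
    derivatives have the same integrals against test functions. *)
Lemma weak_derivativeC u i j g h : is_weak_derivative B1 [:: i; j] u g ->
  is_weak_derivative B1 [:: j; i] u h ->
  {ae mu, forall x, B1 x -> g x = h x}.
Proof.
move=> ug uh; have [_ lg _] := ug; have [_ lh _] := uh.
have mB := @measurable_unit_ball R n.
suff : {ae mu, forall x, B1 x -> g x - h x = 0}.
  by apply: ae_imply => x gh Bx; apply/eqP; rewrite -subr_eq0 gh.
apply: (@du_bois_reymond R n (fun x => g x - h x)).
- by apply: measurable_funB; [exact: lg.1|exact: lh.1].
- move=> K cK KB mK.
  have := integrableB mK (Lp_loc_integrable lg cK KB mB mK) (Lp_loc_integrable lh cK KB mB mK).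
  by apply: eq_integrable.
move=> F K sF cK KB mK F0.
have FE : prodf F = comb [:: tt] (fun=> 1) (fun=> F).
  by apply/funext => x; rewrite /comb big_cons big_nil addr0 mul1r.
have F0' x : ~ K x -> comb [:: tt] (fun=> 1) (fun=> F) x = 0 by rewrite -FE; exact: F0.
have sF' (_ : unit) : smooth_family F := sF.
have ig := integrable_loc_mul_comb lg cK KB mK sF' F0'.
have ih := integrable_loc_mul_comb lh cK KB mK sF' F0'.
have gE := weak_derivative_comb ug cK KB sF' F0'.
have hE := weak_derivative_comb uh cK KB sF' F0'.
have sgn2 : (-1) ^+ 2 = 1 :> R by rewrite sqrrN expr1n.
rewrite [size _]/= sgn2 mul1r in gE; rewrite [size _]/= sgn2 mul1r in hE.
rewrite FE; under eq_Rintegral do rewrite mulrBl.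
by rewrite RintegralB// -hE -gE partial_familyC subrr.
Qed.

End weak_derivatives.

(** * The L^1 contraction *)
Section sign_approximation.
Context {R : realType}.
Implicit Types (a b t k : R).

(** A Lipschitz function equal to 0 for t <= 1/k and to 1 for t >= 2/k. It
    vanishes on a neighbourhood of 0, which confines the test functions of Kato's
    inequality to the interior of the ball. *)
Definition half_sign k t : R := Num.min 1 (Num.max 0 (k * t - 1)).

Definition soft_sign k t : R := half_sign k t - half_sign k (- t).

Lemma half_sign_homo k a b : 0 <= k -> a <= b -> half_sign k a <= half_sign k b.
Proof.
move=> k0 ab; have kab : k * a <= k * b by rewrite ler_wpM2l.
rewrite /half_sign; move: (k * a) (k * b) kab => x y xy.
by rewrite le_min ge_min lexx /= ge_min; apply/orP; right; rewrite ge_max !le_max lexx /=;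
  apply/orP; right; rewrite lerD2r.
Qed.

Lemma half_sign_itv k t : 0 <= half_sign k t <= 1.
Proof.
rewrite /half_sign ge_min lexx /= le_min ler01 /=.
by rewrite le_max lexx.
Qed.

Lemma half_sign_eq0 k t : k * t <= 1 -> half_sign k t = 0.
Proof.
move=> kt; rewrite /half_sign.
have -> : Num.max 0 (k * t - 1) = 0 by apply/max_idPl; lra.
by apply/min_idPr.
Qed.

Lemma half_sign_eq1 k t : 2 <= k * t -> half_sign k t = 1.
Proof. by move=> kt; apply/min_idPl; rewrite le_max; apply/orP; right; lra. Qed.

Lemma half_sign_lip k a b : 0 <= k -> `|half_sign k a - half_sign k b| <= k * `|a - b|.
Proof.
move=> k0; rewrite -(ger0_norm k0) -normrM mulrBr (ger0_norm k0) /half_sign.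
have clip (u : R) : [\/ u <= 1 /\ Num.min 1 (Num.max 0 (u - 1)) = 0,
    1 <= u <= 2 /\ Num.min 1 (Num.max 0 (u - 1)) = u - 1
    | 2 <= u /\ Num.min 1 (Num.max 0 (u - 1)) = 1].
  have [u1|/ltW u1] := leP u 1.
    apply: Or31; split=> //; have -> : Num.max 0 (u - 1) = 0 by apply/max_idPl; lra.
    by apply/min_idPr.
  have -> : Num.max 0 (u - 1) = u - 1 by apply/max_idPr; lra.
  have [u2|/ltW u2] := leP u 2.
    by apply: Or32; split; [rewrite u1|apply/min_idPr; lra].
  by apply: Or33; split => //; apply/min_idPl; lra.
move: (k * a) (k * b) => x y.
have := ler_norm (x - y); have := ler_norm (- (x - y)); rewrite normrN => h1 h2.
have [[x1 ->]|[/andP[x1 x2] ->]|[x1 ->]] := clip x;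
  have [[y1 ->]|[/andP[y1 y2] ->]|[y1 ->]] := clip y;
  by rewrite ler_norml; apply/andP; split; lra.
Qed.

Lemma soft_sign_homo k a b : 0 <= k -> a <= b -> soft_sign k a <= soft_sign k b.
Proof. by move=> k0 ab; apply: lerB; apply: half_sign_homo => //; rewrite lerN2. Qed.

Lemma soft_sign_le1 k t : `|soft_sign k t| <= 1.
Proof.
have /andP[? ?] := half_sign_itv k t; have /andP[? ?] := half_sign_itv k (- t).
by rewrite ler_norml /soft_sign; lra.
Qed.

Lemma soft_sign_lip k a b : 0 <= k -> `|soft_sign k a - soft_sign k b| <= 2 * k * `|a - b|.
Proof.
move=> k0; have h1 := half_sign_lip a b k0; have h2 := half_sign_lip (- a) (- b) k0.
have E : `|- a - - b| = `|a - b| by rewrite -normrN; congr `|_|; ring.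
rewrite E in h2.
have -> : soft_sign k a - soft_sign k b = (half_sign k a - half_sign k b) -
  (half_sign k (- a) - half_sign k (- b)) by rewrite /soft_sign; ring.
by apply: le_trans (ler_normB _ _) _; lra.
Qed.

Lemma soft_sign_eq0 k t : 0 < k -> `|t| <= k^-1 -> soft_sign k t = 0.
Proof.
move=> k0; rewrite ler_norml => /andP[t1 t2]; rewrite /soft_sign !half_sign_eq0 ?subrr//.
  by rewrite -ler_pdivlMl// mulr1 lerNl.
by rewrite -ler_pdivlMl// mulr1.
Qed.

Lemma soft_sign_near_gt0 t : 0 < t -> \forall k \near \oo, soft_sign k.+1%:R t = 1.
Proof.
move=> t0; have := @nbhs_infty_ger R (2 / t); apply: filterS => k kt.
rewrite /soft_sign half_sign_eq1 ?half_sign_eq0 ?subr0//.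
  by rewrite mulrN; apply: (@le_trans _ _ 0) => //; rewrite oppr_le0 mulr_ge0// ltW.
by rewrite -ler_pdivrMr//; apply: le_trans kt _; rewrite ler_nat.
Qed.

Lemma soft_signN k t : soft_sign k (- t) = - soft_sign k t.
Proof. by rewrite /soft_sign opprK opprB. Qed.

Lemma measurable_soft_sign k : measurable_fun setT (soft_sign k).
Proof.
have mh : measurable_fun setT (half_sign k).
  apply: measurable_minr => //; apply: measurable_maxr => //.
  by apply: measurable_funB => //; exact: measurable_funM.
apply: measurable_funB => //; apply: measurableT_comp => //.
Qed.

End sign_approximation.

Section contraction.
Context {R : realType} {n : nat}.
Local Notation pt := 'rV[R]_n.+1.
Local Notation X := (Rn_leb R n).
Local Notation mu := (@lebesgue R n).
Local Notation B1 := (@unit_ball R n).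
Local Notation B1c := (@closed_unit_ball R n).
Implicit Types (x y : pt) (i j : 'I_n.+1) (d : pt -> R).

Definition zero_extension d x : R := d x * \1_B1 x.

Lemma zero_extension_in d x : B1 x -> zero_extension d x = d x.
Proof. by move=> Bx; rewrite /zero_extension indicE mem_set// mulr1. Qed.

Lemma zero_extension_out d x : ~ B1 x -> zero_extension d x = 0.
Proof. by move=> Bx; rewrite /zero_extension indicE memNset// mulr0. Qed.

(** This is where the equality of the boundary values enters. *)
Lemma continuous_zero_extension d : {within B1c, continuous d} ->
  (forall x, unit_sphere x -> d x = 0) -> continuous (zero_extension d).
Proof.
move=> /subspace_continuousP dc d0 x.
apply/(@cvgrPdist_le _ _ _ _ (nbhs_filter x)) => e e0.
have [Bx|nBx] := pselect (B1 x).
  have xc := unit_ball_closed Bx.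
  have nearB : \forall y \near x, B1 y.
    have [r r0 rB] := unit_ball_open Bx.
    apply/nbhs_ballP; exists r => // y [_ yx]; apply: rB => i.
    by have := yx ord0 i; rewrite /ball /= distrC.
  have nearD : \forall y \near x, B1c y -> `|d x - d y| <= e.
    by have /cvgrPdist_le/(_ _ e0) := dc x xc.
  near=> y; have By : B1 y by near: y.
  rewrite !zero_extension_in//; move: (unit_ball_closed By); near: y.
  exact: nearD.
rewrite (zero_extension_out _ nBx).
have [xc|nxc] := pselect (B1c x).
  have dx : d x = 0.
    by apply: d0; apply/eqP; rewrite eq_le xc /= leNgt; exact/negP.
  have nearD : \forall y \near x, B1c y -> `|d x - d y| <= e.
    by have /cvgrPdist_le/(_ _ e0) := dc x xc.
  near=> y; have [By|nBy] := pselect (B1 y); last first.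
    by rewrite zero_extension_out// subrr normr0 ltW.
  rewrite zero_extension_in// -dx; move: (unit_ball_closed By); near: y.
  exact: nearD.
have nearC : \forall y \near x, ~ B1 y.
  have x1 : 1 < \sum_i x ord0 i ^+ 2.
    by rewrite ltNge; apply/negP => /closed_unit_ballE.
  have : \forall y \near x, 1 < \sum_i (y : pt) ord0 i ^+ 2.
    by move: (@continuous_sqr_enorm R n x) => /cvgr_gt; apply.
  by apply: filterS => y y1 /unit_ballE; rewrite ltNge (ltW y1).
near=> y; rewrite zero_extension_out ?subrr ?normr0 ?ltW//; near: y.
exact: nearC.
Unshelve. all: by end_near. Qed.

(** Kato's inequality for g = h - f with psi a soft sign gives an upper bound
    for the integral of h psi(d); since h has the sign of d, this tends to the
    integral of |h| as psi tends to the sign function. *)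
Lemma l1_contraction d (g h f : X -> R) :
  {within B1c, continuous d} -> (forall x, unit_sphere x -> d x = 0) ->
  measurable_fun (B1 : set X) (d : X -> R) -> measurable_fun (B1 : set X) g ->
  (forall K : set pt, compact K -> K `<=` B1 -> measurable (K : set X) ->
    mu.-integrable (K : set X) (EFin \o g)) ->
  weak_laplacian d g ->
  measurable_fun (B1 : set X) h -> (forall x, B1 x -> `|h x| <= 1) ->
  (forall x, B1 x -> 0 < d x -> 0 <= h x) -> (forall x, B1 x -> d x < 0 -> h x <= 0) ->
  (forall x, B1 x -> d x = 0 -> h x = 0) ->
  mu.-integrable (B1 : set X) (EFin \o f) ->
  {ae mu, forall x, B1 x -> g x = h x - f x} -> (0 < mu B1)%E ->
  Rintegral mu B1 (fun x => `|h x|) <= Rintegral mu B1 (fun x => `|f x|).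
Proof.
move=> cd d0 md mg ig lap mh h1 hpos hneg hzero fi ghf B10.
have mB : measurable (B1 : set X) := @measurable_unit_ball R n.
have cv := continuous_zero_extension cd d0.
have mv : measurable_fun setT (zero_extension d : X -> R).
  rewrite (_ : zero_extension d = d \_ B1); last by rewrite patch_indic.
  exact/(measurable_restrictT _ mB).1.
have [C C0 d2C] := @kern_d2_approx R n.
pose psi k : R -> R := soft_sign k.+1%:R.
have k0 k : (0 : R) < k.+1%:R by [].
have mpv k : measurable_fun (B1 : set X) (fun x => psi k (zero_extension d x)).
  by apply: measurableT_comp; [exact: measurable_soft_sign|exact: measurable_funTS mv].
have hi : mu.-integrable (B1 : set X) (EFin \o h).
  apply: measurable_bounded_integrable => //; first exact: lebesgue_unit_ball_lty.
  exists 1; split; first exact: num_real.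
  by move=> M M1 x Bx; apply: le_trans (h1 x Bx) (ltW M1).
have hpsi k := integrableM_bounded mB hi (mpv k) (fun x _ => soft_sign_le1 k.+1%:R _).
have fpsi k := integrableM_bounded mB fi (mpv k) (fun x _ => soft_sign_le1 k.+1%:R _).
have le_k k : Rintegral mu B1 (fun x => h x * psi k (zero_extension d x)) <=
    Rintegral mu B1 (fun x => `|f x|).
  have := @kato R n _ cv (@zero_extension_out d) mv C C0 d2C g ig _ (psi k)
    (2 * k.+1%:R) k.+1%:R^-1 (fun a b => @soft_sign_homo _ _ a b (ltW (k0 k)))
    (soft_sign_le1 _) (fun a b => soft_sign_lip a b (ltW (k0 k)))
    (fun a => @soft_sign_eq0 _ _ a (k0 k)) (measurable_soft_sign _) _ B10.
  have lap' : weak_laplacian (zero_extension d) g.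
    move=> J c Fs K sF cK KB mK F0; rewrite (lap _ _ _ _ sF cK KB mK F0).
    apply: eq_bigr => i _; apply: eq_Rintegral => x; rewrite inE => Bx.
    by rewrite zero_extension_in.
  rewrite invr_gt0 k0 => /(_ lap' isT).
  have -> : Rintegral mu B1 (fun x => g x * psi k (zero_extension d x)) =
    Rintegral mu B1 (fun x => h x * psi k (zero_extension d x) -
      f x * psi k (zero_extension d x)).
    apply: (@ae_eq_Rintegral _ _ _ mu (B1 : set X) (fun x => g x * psi k (zero_extension d x))
      (fun x => h x * psi k (zero_extension d x) - f x * psi k (zero_extension d x)) mB).
    - exact: measurable_funM.
    - by apply: measurable_funB; [exact: integrable_measurable (hpsi k)|
        exact: integrable_measurable (fpsi k)].
    - by apply: ae_imply ghf => x gx Bx; rewrite gx// mulrBl.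
  rewrite RintegralB// subr_le0 => le1; apply: le_trans le1 _.
  apply: le_Rintegral => //; first exact: integrable_norm.
  move=> x _; apply: le_trans (ler_norm _) _.
  by rewrite normrM ler_piMr// soft_sign_le1.
have cvh : Rintegral mu B1 (fun x => h x * psi k (zero_extension d x)) @[k --> \oo] -->
    Rintegral mu B1 (fun x => `|h x|).
  apply: (@Rintegral_dominated_cvg _ _ _ mu (B1 : set X)
    (fun k x => h x * psi k (zero_extension d x)) (fun x => `|h x|) (fun x => `|h x|) mB).
  - by move=> k; exact: integrable_measurable (hpsi k).
  - exact: integrable_measurable (integrable_norm hi).
  - apply: aeW => x Bx; apply: cvg_near_cst; rewrite zero_extension_in//.
    have [dx|dx|dx] := ltgtP (d x) 0.
    + have ndx : 0 < - d x by rewrite oppr_gt0.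
      have := soft_sign_near_gt0 ndx; apply: filterS => k.
      rewrite soft_signN /psi => /eqP; rewrite eqr_oppLR => /eqP ->.
      by rewrite mulrN1 ler0_norm// hneg.
    + have := soft_sign_near_gt0 dx; apply: filterS => k; rewrite /psi => ->.
      by rewrite mulr1 ger0_norm// hpos.
    + by apply: nearW => k; rewrite (hzero x Bx dx) mul0r normr0.
  - exact: integrable_norm.
  - by move=> k x _; rewrite normrM ler_piMr// soft_sign_le1.
rewrite -(cvg_lim _ cvh)//; apply: limr_le; first by apply/cvg_ex; eexists; exact: cvh.
exact: nearW.
Qed.

End contraction.

(** * Interpolation between Lebesgue norms *)
Section interpolation.
Context {R : realType}.
Implicit Types (a b c s t p q : R).

(** Where a exceeds s, it is below its q-th power suitably rescaled. *)
Lemma le_add_powR a s q : 0 <= a -> 0 < s -> 1 <= q -> a <= s + s / s `^ q * a `^ q.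
Proof.
move=> a0 s0 q1; have sq0 : 0 < s `^ q by exact: powR_gt0.
have [as_|sa] := leP a s.
  by rewrite (le_trans as_)// lerDl mulr_ge0 ?powR_ge0 ?divr_ge0 ?powR_ge0// ltW.
have a1 : 1 <= a / s by rewrite ler_pdivlMr// mul1r ltW.
have : a <= s * (a / s) `^ q.
  by rewrite -ler_pdivrMl// mulrC le1r_powR.
have -> : s * (a / s) `^ q = s / s `^ q * a `^ q.
  have -> : a `^ q = (a / s) `^ q * s `^ q.
    by rewrite -powRM ?divfK ?gt_eqF// ?divr_ge0// ltW.
  by rewrite mulrACA mulVf ?mulr1 ?gt_eqF.
by move=> /le_trans; apply; rewrite lerDr ltW.
Qed.

(** Below the height t the factor b is harmless; above it, a is replaced by its
    bound c and b by its p-th power suitably rescaled. *)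
Lemma mul_le_powR a b c t p : 0 <= a -> a <= c -> 0 <= b -> 0 < t -> 1 <= p ->
  a * b <= t * a + c * t / t `^ p * b `^ p.
Proof.
move=> a0 ac b0 t0 p1; have tp0 : 0 < t `^ p by exact: powR_gt0.
have c0 := le_trans a0 ac.
have [bt|tb] := leP b t.
  rewrite (@le_trans _ _ (a * t)) ?ler_wpM2l// mulrC lerDl.
  by rewrite mulr_ge0 ?powR_ge0// divr_ge0 ?powR_ge0// mulr_ge0// ltW.
have b1 : 1 <= b / t by rewrite ler_pdivlMr// mul1r ltW.
have bp : b <= t * (b / t) `^ p by rewrite -ler_pdivrMl// mulrC le1r_powR.
have -> : c * t / t `^ p * b `^ p = c * (t * (b / t) `^ p).
  have -> : b `^ p = (b / t) `^ p * t `^ p.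
    by rewrite -powRM ?divfK ?gt_eqF// ?divr_ge0// ltW.
  by rewrite mulrACA mulVf ?gt_eqF// mulr1 mulrA.
apply: (@le_trans _ _ (c * (t * (b / t) `^ p))); first exact: ler_pM.
by rewrite lerDr mulr_ge0// ltW.
Qed.

(** Ellipticity holds only almost everywhere; truncating the coefficients makes
    their bound hold everywhere. *)
Definition clip c t : R := Num.max (- c) (Num.min c t).

Lemma clip_le c t : 0 <= c -> `|clip c t| <= c.
Proof.
move=> c0; rewrite ler_norml /clip le_max lexx /= ge_max; apply/andP; split.
  by rewrite (le_trans _ c0)// oppr_le0.
by rewrite ge_min lexx.
Qed.

Lemma clip_le_norm c t : 0 <= c -> `|clip c t| <= `|t|.
Proof.
move=> c0; rewrite ler_norml /clip le_max ge_max le_min ge_min.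
have := ler_norm t; have := ler_norm (- t); rewrite normrN => h1 h2.
have h3 := normr_ge0 t; apply/andP; split.
  apply/orP; right; apply/andP; split; last by lra.
  by rewrite (le_trans _ c0)// oppr_le0.
apply/andP; split; last by rewrite h2 orbT.
by rewrite (le_trans _ h3)// oppr_le0.
Qed.

Lemma clip_id c t : `|t| <= c -> clip c t = t.
Proof.
rewrite ler_norml => /andP[h1 h2]; rewrite /clip.
have -> : Num.min c t = t by apply/min_idPr.
by apply/max_idPr.
Qed.

Lemma measurable_clip c : measurable_fun setT (clip c).
Proof. by apply: measurable_maxr => //; exact: measurable_minr. Qed.

End interpolation.

Section interpolation_integral.
Context d (T : measurableType d) {R : realType} (mu : {measure set T -> \bar R}).
Implicit Types (D : set T) (f g : T -> R).

Lemma integrable_dominated D f g : measurable D -> measurable_fun D f ->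
  (forall x, D x -> `|f x| <= g x) -> mu.-integrable D (EFin \o g) ->
  mu.-integrable D (EFin \o f).
Proof.
move=> mD mf fg ig; apply: (@le_integrable _ _ _ mu D mD _ (EFin \o g)) => //.
  exact/measurable_EFinP.
by move=> x Dx; rewrite /= lee_fin (le_trans (fg x Dx))// ler_norm.
Qed.

(** Hoelder's inequality does not apply when 1/p + 1/q > 1; the bound c on f
    makes up for it, by cutting g at height t and f at height s. *)
Lemma le_Rintegral_interpolation D f g (c s t p q M : R) : measurable D ->
  (mu D < +oo)%E -> 0 <= c -> 0 < s -> 0 < t -> 1 <= p -> 1 <= q ->
  measurable_fun D f -> measurable_fun D g -> (forall x, `|f x| <= c) ->
  mu.-integrable D (EFin \o (fun x => `|f x| `^ q)) ->
  Rintegral mu D (fun x => `|f x| `^ q) <= s `^ q ->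
  mu.-integrable D (EFin \o (fun x => `|g x| `^ p)) ->
  Rintegral mu D (fun x => `|g x| `^ p) <= M `^ p ->
  mu.-integrable D (EFin \o (fun x => f x * g x)) /\
  Rintegral mu D (fun x => `|f x * g x|) <=
    t * s * (fine (mu D) + 1) + c * t / t `^ p * M `^ p.
Proof.
move=> mD Dfin c0 s0 t0 p1 q1 mf mg fc ifq fq igp gp.
pose b x := t * s + (t * (s / s `^ q) * `|f x| `^ q + c * t / t `^ p * `|g x| `^ p).
have i1 : mu.-integrable D (EFin \o (fun _ : T => t * s)).
  apply: measurable_bounded_integrable => //.
  exists `|t * s|; split; first exact: num_real.
  by move=> N N1 x _; exact: ltW.
have i2 : mu.-integrable D (EFin \o (fun x => t * (s / s `^ q) * `|f x| `^ q)).
  by have := integrableZl mD (t * (s / s `^ q)) ifq; apply: eq_integrable.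
have i3 : mu.-integrable D (EFin \o (fun x => c * t / t `^ p * `|g x| `^ p)).
  by have := integrableZl mD (c * t / t `^ p) igp; apply: eq_integrable.
have i23 : mu.-integrable D (EFin \o (fun x =>
    t * (s / s `^ q) * `|f x| `^ q + c * t / t `^ p * `|g x| `^ p)).
  by have := integrableD mD i2 i3; apply: eq_integrable.
have ib : mu.-integrable D (EFin \o b).
  by have := integrableD mD i1 i23; apply: eq_integrable.
have fgb x : `|f x * g x| <= b x.
  rewrite normrM; apply: le_trans (mul_le_powR (normr_ge0 _) (fc x) (normr_ge0 _) t0 p1) _.
  rewrite /b addrA lerD2r -!mulrA -mulrDr ler_wpM2l ?(ltW t0)//.
  by rewrite mulrA; exact: le_add_powR.
have ifg : mu.-integrable D (EFin \o (fun x => f x * g x)).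
  by apply: (integrable_dominated mD _ (fun x _ => fgb x) ib); exact: measurable_funM.
split=> //; apply: (@le_trans _ _ (Rintegral mu D b)).
  by apply: le_Rintegral => //; exact: integrable_norm.
rewrite /b RintegralD// RintegralD// Rintegral_cst// RintegralZl// RintegralZl//.
rewrite mulrDr mulr1 -addrA lerD2l; apply: lerD.
  apply: (@le_trans _ _ (t * (s / s `^ q) * s `^ q)).
    by rewrite ler_wpM2l// mulr_ge0 ?divr_ge0 ?powR_ge0// ltW.
  by rewrite -mulrA divfK// gt_eqF// powR_gt0.
by rewrite ler_wpM2l// divr_ge0 ?powR_ge0// mulr_ge0// ltW.
Qed.

Lemma measurable_norm_powR D f (p : R) : measurable_fun D f ->
  measurable_fun D (fun x => `|f x| `^ p).
Proof.
move=> mf; apply: (@measurableT_comp _ _ _ _ _ _ (fun t : R => t `^ p)) => //.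
exact: measurableT_comp.
Qed.

Lemma Lnorm_integrable D f (p M : R) : measurable D -> measurable_fun D f ->
  0 < p -> 0 <= M -> (Lnorm mu p%:E (EFin \o (f \_ D)) <= M%:E)%E ->
  mu.-integrable D (EFin \o (fun x => `|f x| `^ p)) /\
  Rintegral mu D (fun x => `|f x| `^ p) <= M `^ p.
Proof.
move=> mD mf p0 M0 fM.
have mfp := @measurable_norm_powR D f p mf.
have E : (\int[mu]_(x in D) (`|f x| `^ p)%:E = Lnorm mu p%:E (EFin \o (f \_ D)) `^ p)%E.
  rewrite poweR_Lnorm ?gt_eqF// [LHS]integral_mkcond.
  apply: eq_integral => x _; rewrite /patch /=; case: ifPn => _ //.
  by rewrite normr0 powR0// gt_eqF.
have le_M : (\int[mu]_(x in D) (`|f x| `^ p)%:E <= (M `^ p)%:E)%E.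
  rewrite E -poweR_EFin; apply: gt0_ler_poweR => //; first exact: ltW.
    by rewrite in_itv /= leey andbT; exact: Lnorm_ge0.
  by rewrite in_itv /= leey andbT lee_fin.
have fin : (\int[mu]_(x in D) (`|f x| `^ p)%:E)%E \is a fin_num.
  rewrite ge0_fin_numE; first exact: le_lt_trans le_M (ltry _).
  by apply: integral_ge0 => x _; rewrite lee_fin powR_ge0.
split.
  apply/integrableP; split; first exact/measurable_EFinP.
  under eq_integral do rewrite /= ger0_norm ?powR_ge0//.
  exact: le_lt_trans le_M (ltry _).
by rewrite -lee_fin /Rintegral fineK.
Qed.

End interpolation_integral.

Lemma lee_bigsum_term {R : realType} (I : finType) (P : rel I) (a : \bar R)
    (b : I -> \bar R) (c : I -> I -> \bar R) (i j : I) : (0 <= a)%E ->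
  (forall k, 0 <= b k)%E -> (forall k l, 0 <= c k l)%E -> P i j ->
  (c i j <= a + \sum_k b k + \sum_k \sum_(l | P k l) c k l)%E.
Proof.
move=> a0 b0 c0 Pij.
have s0 k : (0 <= \sum_(l | P k l) c k l)%E by apply: sume_ge0 => l _; exact: c0.
apply: (@le_trans _ _ (\sum_k \sum_(l | P k l) c k l)%E); last first.
  by rewrite leeDr// adde_ge0// sume_ge0.
rewrite (bigD1 i)//=; apply: (@le_trans _ _ (\sum_(l | P i l) c i l)%E); last first.
  by rewrite leeDl// sume_ge0.
by rewrite (bigD1 j)//= leeDl// sume_ge0.
Qed.

Section norms.
Context {R : realType} {n : nat}.
Local Notation pt := 'rV[R]_n.+1.
Local Notation X := (Rn_leb R n).
Local Notation mu := (@lebesgue R n).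
Implicit Types (D : set pt) (f : pt -> R).

(** The derivatives with i <= j are exactly the second-order terms of the norm. *)
Lemma W2_norm_ge D (p M : R) f (i j : 'I_n.+1) : 0 < p -> 0 <= M ->
  W2_norm p D f = M%:E -> (i <= j)%N ->
  (Lp_norm D p (weak_derivative D [:: i; j] f) <= M%:E)%E.
Proof.
move=> p0 M0 fM ij.
have pp r : (r `^ p >= 0)%E by exact: poweR_ge0.
set t := Lp_norm _ _ _; have t0 : (0 <= t)%E := Lnorm_ge0 _ _ _.
have -> : t = ((t `^ p) `^ p^-1)%E.
  by rewrite -poweRrM divff ?gt_eqF// poweRe1.
rewrite -fM /W2_norm; apply: gt0_ler_poweR.
- by rewrite invr_ge0 ltW.
- by rewrite in_itv /= leey andbT.
- rewrite in_itv /= leey andbT; apply: adde_ge0; first apply: adde_ge0.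
  + exact: pp.
  + by apply: sume_ge0 => k _; exact: pp.
  + by apply: sume_ge0 => k _; apply: sume_ge0 => l _; exact: pp.
- apply: (@lee_bigsum_term R 'I_n.+1 (fun k l : 'I_n.+1 => (k <= l)%N) (Lp_norm D p f `^ p)%E
    (fun k => Lp_norm D p (weak_derivative D [:: k] f) `^ p)%E
    (fun k l => Lp_norm D p (weak_derivative D [:: k; l] f) `^ p)%E i j) => //.
Qed.

End norms.

(** * The residual of the perturbed equation *)
Section coefficients.
Context {R : realType} {n : nat}.
Local Notation pt := 'rV[R]_n.+1.
Implicit Types (i j k : 'I_n.+1).

Lemma sum_two_coord (f : 'I_n.+1 -> R) i j (s : R) :
  \sum_k f k * ((k == i)%:R + s * (k == j)%:R) = f i + s * f j.
Proof.
under eq_bigr do rewrite mulrDr.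
rewrite big_split /=; congr (_ + _).
  rewrite (bigD1 i)//= eqxx mulr1 big1 ?addr0// => k /negbTE ->; exact: mulr0.
rewrite (bigD1 j)//= eqxx mulr1 big1 ?addr0; first by rewrite mulrC.
by move=> k /negbTE ->; rewrite !mulr0.
Qed.

(** Polarisation: the quadratic form at e_i and e_i + e_j, e_i - e_j bounds the
    entries of a symmetric matrix. *)
Lemma elliptic_entry (A : 'M[R]_n.+1) (lambda Lambda : R) i j : 0 < lambda ->
  A^T = A ->
  (forall xi : pt, lambda * enorm xi ^+ 2
       <= \sum_i \sum_j A i j * xi ord0 i * xi ord0 j
       <= Lambda * enorm xi ^+ 2) ->
  `|(i == j)%:R - A i j| <= Lambda + 1.
Proof.
move=> l0 AT AQ.
have symA k l : A k l = A l k by rewrite -{1}AT mxE.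
have Q (s : R) k l : k != l -> 0 <= A k k + 2 * s * A k l + s ^+ 2 * A l l
    <= Lambda * (1 + s ^+ 2).
  move=> kl; pose xi : pt := \row_i' ((i' == k)%:R + s * (i' == l)%:R).
  have E2 : enorm xi ^+ 2 = 1 + s ^+ 2.
    rewrite /enorm sqr_sqrtr; last by apply: sumr_ge0 => i' _; exact: sqr_ge0.
    under eq_bigr do rewrite expr2 {2}mxE.
    by rewrite sum_two_coord !mxE !eqxx (eq_sym l k) (negbTE kl) /=; ring.
  have EQ : \sum_i' \sum_j' A i' j' * xi ord0 i' * xi ord0 j' =
      A k k + 2 * s * A k l + s ^+ 2 * A l l.
    transitivity (\sum_i' (A i' k + s * A i' l) * ((i' == k)%:R + s * (i' == l)%:R)).
      apply: eq_bigr => i' _; rewrite -sum_two_coord mulr_suml; apply: eq_bigr => j' _.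
      by rewrite !mxE; ring.
    by rewrite (sum_two_coord (fun i' => A i' k + s * A i' l)) (symA l k); ring.
  have /andP[h1 h2] := AQ xi; rewrite E2 EQ in h1 h2; rewrite h2 andbT.
  by apply: le_trans h1; rewrite mulr_ge0 ?addr_ge0 ?sqr_ge0// ltW.
have diag k : 0 <= A k k <= Lambda.
  pose xi : pt := \row_i' ((i' == k)%:R + 0 * (i' == k)%:R).
  have E2 : enorm xi ^+ 2 = 1.
    rewrite /enorm sqr_sqrtr; last by apply: sumr_ge0 => i' _; exact: sqr_ge0.
    under eq_bigr do rewrite expr2 {2}mxE.
    by rewrite sum_two_coord !mxE !eqxx /=; ring.
  have EQ : \sum_i' \sum_j' A i' j' * xi ord0 i' * xi ord0 j' = A k k.
    transitivity (\sum_i' (A i' k + 0 * A i' k) * ((i' == k)%:R + 0 * (i' == k)%:R)).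
      apply: eq_bigr => i' _; rewrite -sum_two_coord mulr_suml; apply: eq_bigr => j' _.
      by rewrite !mxE; ring.
    by rewrite (sum_two_coord (fun i' => A i' k + 0 * A i' k)); ring.
  have /andP[h1 h2] := AQ xi; rewrite E2 EQ mulr1 in h1 h2; rewrite mulr1 in h2.
  by rewrite h2 andbT (le_trans _ h1)// ltW.
have /andP[ai0 aiL] := diag i; have /andP[aj0 ajL] := diag j.
have [->|ij] := eqVneq i j.
  by rewrite ler_norml /=; have /andP[? ?] := diag j; apply/andP; split; lra.
have /andP[_ q1] := Q 1 i j ij; have /andP[_ q2] := Q (-1) i j ij.
by rewrite /= sub0r normrN ler_norml; apply/andP; split; lra.
Qed.

End coefficients.

Section modulus.
Context {R : realType}.
Variables (N b c K p : R).
Hypotheses (N0 : 0 <= N) (b0 : 0 <= b) (c0 : 0 <= c) (K0 : 0 <= K) (p1 : 1 < p).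

(** The interpolation bound with the cut-off height t = e^(-1/2), which makes both
    t e and t^(1 - p) vanish with e. *)
Definition contact_modulus (e : R) : R :=
  N * (e `^ 2^-1 * b + c * e `^ ((p - 1) / 2) * K).

Lemma contact_modulus_ge0 e : 0 <= contact_modulus e.
Proof. by rewrite /contact_modulus mulr_ge0// addr_ge0// !mulr_ge0// powR_ge0. Qed.

Lemma contact_modulusP : modulus_of_continuity contact_modulus.
Proof.
have p2 : 0 < (p - 1) / 2 by rewrite divr_gt0// subr_gt0.
split.
- move=> s t s0 st; have t0 := lt_le_trans s0 st.
  have mono r : 0 <= r -> s `^ r <= t `^ r.
    by move=> r0; apply: ge0_ler_powR; rewrite ?nnegrE ?(ltW s0) ?(ltW t0).
  rewrite /contact_modulus ler_wpM2l// lerD// ler_wpM2r//; first exact: mono.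
  by rewrite ler_wpM2l// mono// ltW.
- by move=> t _; exact: contact_modulus_ge0.
- rewrite [X in _ --> X](_ : 0 = N * (0 * b + c * 0 * K)); last by ring.
  apply: cvgM; first exact: cvg_cst.
  apply: cvgD.
    by apply: cvgM; [apply: powR_cvg0|exact: cvg_cst].
  apply: cvgM; last exact: cvg_cst.
  by apply: cvgM; [exact: cvg_cst|exact: powR_cvg0].
Qed.

End modulus.

Section reduction.
Context {R : realType} {n : nat}.
Local Notation pt := 'rV[R]_n.+1.
Local Notation X := (Rn_leb R n).
Local Notation mu := (@lebesgue R n).
Local Notation B1 := (@unit_ball R n).
Local Notation B1c := (@closed_unit_ball R n).
Implicit Types (x y : pt) (i j : 'I_n.+1) (u w v : pt -> R).

Definition hessian_entry v i j : pt -> R := weak_derivative B1 [:: i; j] v.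

Lemma sobolev_hessian (S : set (pt -> R)) v i j : sobolev S B1 2 v ->
  is_weak_derivative B1 [:: i; j] v (hessian_entry v i j).
Proof. by move=> [_ /(_ [:: i; j] isT) [g vg _]]; exact: weak_derivativeP vg. Qed.

Lemma weak_laplacian_sub u w (gu gw : 'I_n.+1 -> pt -> R) :
  {within B1c, continuous u} -> {within B1c, continuous w} ->
  measurable_fun (B1 : set X) (u : X -> R) -> measurable_fun (B1 : set X) (w : X -> R) ->
  (forall i, is_weak_derivative B1 [:: i; i] u (gu i)) ->
  (forall i, is_weak_derivative B1 [:: i; i] w (gw i)) ->
  weak_laplacian (fun x => u x - w x) (fun x => \sum_i (gu i x - gw i x)).
Proof.
move=> cu cw mu_ mw_ Du Dw J c Fs K sF cK KB mK F0.
have mB : measurable (B1 : set X) := @measurable_unit_ball R n.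
have lu i : Lp_loc B1 1 (gu i) by have [] := Du i.
have lw i : Lp_loc B1 1 (gw i) by have [] := Dw i.
have iu i := integrable_loc_mul_comb (lu i) cK KB mK sF F0.
have iw i := integrable_loc_mul_comb (lw i) cK KB mK sF F0.
pose h i (x : X) := gu i x * comb (index_enum J) c Fs x - gw i x * comb (index_enum J) c Fs x.
have ih i : mu.-integrable (B1 : set X) (EFin \o h i).
  by have := integrableB mB (iu i) (iw i); apply: eq_integrable.
rewrite (@eq_Rintegral _ _ _ mu B1 (fun x => \sum_i h i x)); last first.
  by move=> x _; rewrite mulr_suml; apply: eq_bigr => i _; rewrite mulrBl.
have [_ ->] := @Rintegral_sum _ _ _ mu B1 _ (index_enum 'I_n.+1) h mB ih.
apply: eq_bigr => i _; rewrite /h (RintegralB mB (iu i) (iw i)).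
have sF' a := smooth_partial_family [:: i; i] (sF a).
have iu' := integrable_mul_comb (index_enum J) c (integrable_continuous_closed_ball cu mu_) sF'.
have iw' := integrable_mul_comb (index_enum J) c (integrable_continuous_closed_ball cw mw_) sF'.
rewrite (@eq_Rintegral _ _ _ mu B1 (fun x =>
    u x * comb (index_enum J) c (fun a => partial_family [:: i; i] (Fs a)) x -
    w x * comb (index_enum J) c (fun a => partial_family [:: i; i] (Fs a)) x)
    (fun x => (u x - w x) * _)); last by move=> x _; rewrite mulrBl.
rewrite (RintegralB mB iu' iw').
rewrite (weak_derivative_comb (Du i) cK KB sF F0) (weak_derivative_comb (Dw i) cK KB sF F0).
by rewrite [size _]/= sqrrN expr1n !mul1r.
Qed.

(** The representative that the Sobolev norm controls. *)
Definition sym_hessian_entry v i j : pt -> R :=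
  if (i <= j)%N then hessian_entry v i j else hessian_entry v j i.

Lemma ae_sym_hessian_entry (S : set (pt -> R)) v : sobolev S B1 2 v ->
  {ae mu, forall x, B1 x -> forall i j, sym_hessian_entry v i j x = hessian_entry v i j x}.
Proof.
move=> Sv; have ae_ij (ij : 'I_n.+1 * 'I_n.+1) : {ae mu, forall x, B1 x ->
    sym_hessian_entry v ij.1 ij.2 x = hessian_entry v ij.1 ij.2 x}.
  rewrite /sym_hessian_entry; case: ifP => _; first exact: aeW.
  by apply: (weak_derivativeC (u := v)); exact: sobolev_hessian Sv.
by apply: ae_imply (ae_forall ae_ij) => x H Bx i j; exact: (H (i, j) Bx).
Qed.

(** Almost everywhere this is Delta w - a_ij D_ij w. The truncation and the choice
    of representatives make all bounds pointwise or norm bounds. *)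
Definition residual (c : R) (a : pt -> 'M[R]_n.+1) w x : R :=
  \sum_(ij : 'I_n.+1 * 'I_n.+1)
    clip c ((ij.1 == ij.2)%:R - a x ij.1 ij.2) * sym_hessian_entry w ij.1 ij.2 x.

Lemma residual_bound (a : pt -> 'M[R]_n.+1) w (lambda Lambda p q M e : R) :
  0 <= Lambda -> 1 < p -> 1 < q -> 0 <= M -> 0 < e ->
  elliptic lambda Lambda a -> W2 p B1 w -> W2_norm p B1 w = M%:E ->
  (forall i j, (Lp_norm B1 q (fun x => a x i j - (i == j)%:R)%R < e%:E)%E) ->
  mu.-integrable (B1 : set X) (EFin \o (residual (Lambda + 1) a w : X -> R)) /\
  Rintegral mu B1 (fun x => `|residual (Lambda + 1) a w x|) <=
    contact_modulus (#|{: 'I_n.+1 * 'I_n.+1}|%:R) (fine (mu B1) + 1) (Lambda + 1) (M `^ p) p e.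
Proof.
move=> L0 p1 q1 M0 e0 [ma _] Ww wM aq.
have mB : measurable (B1 : set X) := @measurable_unit_ball R n.
have Bfin := @lebesgue_unit_ball_lty R n.
have c0 : 0 <= Lambda + 1 by rewrite addr_ge0.
have p0 : 0 < p := lt_trans ltr01 p1.
have q0 : 0 < q := lt_trans ltr01 q1.
pose t := e `^ (- 2^-1); have t0 : 0 < t by exact: powR_gt0.
pose E (ij : 'I_n.+1 * 'I_n.+1) (x : X) : R := clip (Lambda + 1) ((ij.1 == ij.2)%:R - a x ij.1 ij.2).
pose D (ij : 'I_n.+1 * 'I_n.+1) : X -> R := sym_hessian_entry w ij.1 ij.2.
have mH i j : measurable_fun (B1 : set X) (hessian_entry w i j : X -> R).
  by have [_ [mw _] _] := sobolev_hessian i j Ww.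
have mD ij : measurable_fun (B1 : set X) (D ij).
  by rewrite /D /sym_hessian_entry; case: ifP => _; exact: mH.
have md (ij : 'I_n.+1 * 'I_n.+1) : measurable_fun (B1 : set X)
    ((fun x => (ij.1 == ij.2)%:R - a x ij.1 ij.2) : X -> R).
  by apply: measurable_funB => //; exact: ma.
have mE ij : measurable_fun (B1 : set X) (E ij).
  by apply: measurableT_comp (md ij); exact: measurable_clip.
have Ec ij x : `|E ij x| <= Lambda + 1 by exact: clip_le.
have Dp ij : mu.-integrable (B1 : set X) (EFin \o (fun x : X => `|D ij x| `^ p)) /\
    Rintegral mu B1 (fun x => `|D ij x| `^ p) <= M `^ p.
  apply: (Lnorm_integrable mB (mD ij) p0 M0).
  rewrite /D /sym_hessian_entry; case: ifP => [le_ij|/negbT]; first exact: W2_norm_ge.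
  by rewrite -ltnNge => /ltnW; exact: W2_norm_ge.
have aE ij : mu.-integrable (B1 : set X)
    (EFin \o (fun x : X => `|a x ij.1 ij.2 - (ij.1 == ij.2)%:R| `^ q)) /\
    Rintegral mu B1 (fun x => `|a x ij.1 ij.2 - (ij.1 == ij.2)%:R| `^ q) <= e `^ q.
  apply: (Lnorm_integrable mB _ q0 (ltW e0)); last exact: ltW (aq _ _).
  by apply: measurable_funB => //; exact: ma.
have Ea ij x : `|E ij x| `^ q <= `|a x ij.1 ij.2 - (ij.1 == ij.2)%:R| `^ q.
  apply: ge0_ler_powR; rewrite ?nnegrE ?(ltW q0)//.
  by rewrite distrC; exact: clip_le_norm.
have mEq ij : measurable_fun (B1 : set X) (fun x : X => `|E ij x| `^ q).
  exact: measurable_norm_powR.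
have Eq ij : mu.-integrable (B1 : set X) (EFin \o (fun x : X => `|E ij x| `^ q)) /\
    Rintegral mu B1 (fun x => `|E ij x| `^ q) <= e `^ q.
  have [ia lea] := aE ij.
  have iE : mu.-integrable (B1 : set X) (EFin \o (fun x : X => `|E ij x| `^ q)).
    apply: (integrable_dominated mB (mEq ij) _ ia) => x _.
    by rewrite ger0_norm ?powR_ge0// Ea.
  split=> //; apply: le_trans lea; apply: (le_Rintegral mB iE ia) => x _.
  exact: Ea.
have key ij := le_Rintegral_interpolation mB Bfin c0 e0 t0 (ltW p1) (ltW q1) (mE ij) (mD ij)
  (Ec ij) (Eq ij).1 (Eq ij).2 (Dp ij).1 (Dp ij).2.
have [iR _] := @Rintegral_sum _ _ _ mu B1 _ (index_enum _) (fun ij x => E ij x * D ij x) mB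
  (fun ij => (key ij).1).
split; first exact: iR.
have iN ij := integrable_norm (key ij).1.
have [iS SE] := @Rintegral_sum _ _ _ mu B1 _ (index_enum _) (fun ij x => `|E ij x * D ij x|) mB iN.
apply: (@le_trans _ _ (Rintegral mu B1 (fun x => \sum_ij `|E ij x * D ij x|))).
  apply: le_Rintegral => //; first exact: integrable_norm.
  by move=> x _; exact: ler_norm_sum.
rewrite SE; apply: le_trans (ler_sum _ (fun ij _ => (key ij).2)) _.
rewrite sumr_const /contact_modulus mulr_natl.
rewrite lerMn2r; apply/orP; right.
have -> : t * e = e `^ 2^-1.
  rewrite /t -{2}(powRr1 (ltW e0)) -powRD; last by rewrite (gt_eqF e0) implybT.
  by congr (_ `^ _); lra.
have -> : (Lambda + 1) * t / t `^ p = (Lambda + 1) * e `^ ((p - 1) / 2).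
  rewrite -mulrA; congr (_ * _); rewrite /t -powRrM -powRN -powRD; last first.
    by rewrite (gt_eqF e0) implybT.
  by congr (_ `^ _); lra.
by [].
Qed.

End reduction.

(** * Contact sets and conclusion *)
Section contact_sets.
Context {R : realType} {n : nat}.
Local Notation pt := 'rV[R]_n.+1.
Local Notation X := (Rn_leb R n).
Local Notation mu := (@lebesgue R n).
Local Notation B1 := (@unit_ball R n).
Local Notation B1c := (@closed_unit_ball R n).
Implicit Types (x : pt) (u w v : pt -> R).

Lemma measurable_positivity_set v : measurable_fun (B1 : set X) (v : X -> R) ->
  measurable (positivity_set v : set X).
Proof.
move=> mv; have := mv (@measurable_unit_ball R n) `]0, +oo[%classic (measurable_itv _).
by congr measurable; apply/seteqP; split => x /= [Bx]; rewrite in_itv/= andbT.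
Qed.

Lemma measurable_zero_set v : measurable_fun (B1 : set X) (v : X -> R) ->
  measurable (zero_set v : set X).
Proof.
move=> mv; have := mv (@measurable_unit_ball R n) [set 0] (measurable_set1 _).
by congr measurable; apply/seteqP; split => x /= [].
Qed.

Lemma indic_positivity_set v x : B1 x -> 0 <= v x ->
  (\1_(positivity_set v) x : R) = (v x != 0)%:R.
Proof.
move=> Bx v0; rewrite indicE; congr (_%:R); congr nat_of_bool.
rewrite neq_lt ltNge v0 /=; have [vx|vx] := boolP (0 < v x); first by rewrite mem_set.
by rewrite memNset// => -[_ vx0]; move: vx; rewrite vx0.
Qed.

(** Nonnegative functions: inside the ball, contact is the failure of
    positivity. *)
Lemma indic_contact_difference u w x : B1 x -> 0 <= u x -> 0 <= w x ->
  `|(\1_(positivity_set u) x : R) - \1_(positivity_set w) x| =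
  \1_((zero_set u `+` zero_set w) `&` B1) x.
Proof.
move=> Bx u0 w0; rewrite !indic_positivity_set// indicE.
have [ux|ux] := eqVneq (u x) 0; have [wx|wx] := eqVneq (w x) 0.
- rewrite subrr normr0 memNset// => -[[[_ nw]|[_ nu]] _]; first exact: nw.
  exact: nu.
- rewrite sub0r normrN normr1 mem_set//; split=> //; left; split=> // -[_ /eqP].
  by rewrite (negbTE wx).
- rewrite subr0 normr1 mem_set//; split=> //; right; split=> // -[_ /eqP].
  by rewrite (negbTE ux).
- rewrite subrr normr0 memNset// => -[[[[_ /eqP]]|[[_ /eqP]]] //].
    by rewrite (negbTE ux).
  by rewrite (negbTE wx).
Qed.

End contact_sets.

Theorem theorem5p4 (R : realType) (n : nat) (lambda Lambda p q M : R)
    (lambda_gt0 : 0 < lambda) (le_lambda_Lambda : lambda <= Lambda)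
    (p_gt : n.+1%:R < p) (q_gt : n.+1%:R < q) (M_ge0 : 0 <= M) :
  exists2 sigma : R -> R, modulus_of_continuity sigma &
  forall (a : 'rV[R]_n.+1 -> 'M[R]_n.+1) (w u : 'rV[R]_n.+1 -> R)
    (epsilon : R),
  elliptic lambda Lambda a ->
  W2 p unit_ball w ->
  W2_norm p unit_ball w = M%:E ->
  obstacle_solution a w ->
  boundary (positivity_set w) 0 ->
  0 < epsilon ->
  (forall i j,
     (Lp_norm unit_ball q (fun x => a x i j - (i == j)%:R)%R < epsilon%:E)%E) ->
  W2_loc p unit_ball u ->
  laplace_obstacle_solution u ->
  (forall x, unit_sphere x -> u x = w x) ->
  (lebesgue ((zero_set u `+` zero_set w) `&` unit_ball)
     <= (sigma epsilon)%:E)%E.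
Proof.
have n1 : (1 : R) <= n.+1%:R by rewrite ler1n.
have p1 := le_lt_trans n1 p_gt; have q1 := le_lt_trans n1 q_gt.
have L0 : 0 <= Lambda := le_trans (ltW lambda_gt0) le_lambda_Lambda.
pose mu := @lebesgue R n; pose B1 := @unit_ball R n.
have mB : measurable (B1 : set (Rn_leb R n)) := @measurable_unit_ball R n.
pose sigma := contact_modulus (#|{: 'I_n.+1 * 'I_n.+1}|%:R : R) (fine (mu B1) + 1)
  (Lambda + 1) (M `^ p) p.
have b0 : 0 <= fine (mu B1) + 1 by rewrite addr_ge0// fine_ge0.
have c0 : 0 <= Lambda + 1 by rewrite addr_ge0.
exists sigma.
  exact: (contact_modulusP (ler0n _ _) b0 c0 (powR_ge0 _ _) p1).
move=> a w u e ell Ww wM [cw w0 aew] _ e0 aq Wu [cu u0 aeu] uw.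
have mw : measurable_fun (B1 : set (Rn_leb R n)) (w : Rn_leb R n -> R) := Ww.1.1.
have mu_ : measurable_fun (B1 : set (Rn_leb R n)) (u : Rn_leb R n -> R) := Wu.1.1.
set S := (zero_set u `+` zero_set w) `&` unit_ball.
have mS : measurable (S : set (Rn_leb R n)).
  have mu0 := measurable_zero_set mu_; have mw0 := measurable_zero_set mw.
  by apply: measurableI => //; apply: measurableU; exact: measurableD.
have SB : (lebesgue S <= mu B1)%E by apply: le_lebesgue_outer => x [].
(* Kato's inequality divides by integrals of kernels, whose positivity comes from
   that of the measure of the ball; otherwise the claim is trivial. *)
have [B10|B1_gt0] := leP (mu B1) 0%E.
  apply: (le_trans SB); apply: (le_trans B10); rewrite lee_fin.
  exact: (contact_modulus_ge0 p (ler0n _ _) b0 c0 (powR_ge0 _ _) e).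
pose h (x : Rn_leb R n) : R := \1_(positivity_set u) x - \1_(positivity_set w) x.
pose g (x : Rn_leb R n) : R := \sum_i (hessian_entry u i i x - hessian_entry w i i x).
have hu i j := sobolev_hessian i j Wu; have hw i j := sobolev_hessian i j Ww.
have lu i j : Lp_loc B1 1 (hessian_entry u i j) by have [] := hu i j.
have lw i j : Lp_loc B1 1 (hessian_entry w i j) by have [] := hw i j.
have [iR le_sigma] := residual_bound L0 p1 q1 M_ge0 e0 ell Ww wM aq.
have contraction : Rintegral mu B1 (fun x => `|h x|) <=
    Rintegral mu B1 (fun x => `|residual (Lambda + 1) a w x|).
  apply: (@l1_contraction R n (fun x => u x - w x) g h (residual (Lambda + 1) a w)).
  - by move=> x; apply: cvgB; [exact: cu|exact: cw].
  - by move=> x /uw ->; rewrite subrr.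
  - exact: measurable_funB.
  - by apply: measurable_sum => i; apply: measurable_funB; [exact: (lu i i).1|exact: (lw i i).1].
  - move=> K cK KB mK.
    have iuw i : mu.-integrable (K : set (Rn_leb R n))
        (EFin \o (fun x : Rn_leb R n => hessian_entry u i i x - hessian_entry w i i x)).
      have := integrableB mK (Lp_loc_integrable (lu i i) cK KB mB mK)
        (Lp_loc_integrable (lw i i) cK KB mB mK).
      by apply: eq_integrable.
    by have [] := @Rintegral_sum _ _ _ mu K _ (index_enum 'I_n.+1) _ mK iuw.
  - exact: weak_laplacian_sub.
  - by apply: measurable_funB; apply: measurable_indic; exact: measurable_positivity_set.
  - by move=> x Bx; rewrite /h indic_contact_difference ?u0 ?w0.
  - move=> x Bx; rewrite subr_gt0 => wu; rewrite /h !indic_positivity_set ?u0 ?w0//.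
    have u1 : u x != 0 by rewrite gt_eqF// (le_lt_trans (w0 _ Bx)).
    by rewrite u1 subr_ge0 lern1 leq_b1.
  - move=> x Bx; rewrite subr_lt0 => wu; rewrite /h !indic_positivity_set ?u0 ?w0//.
    have w1 : w x != 0 by rewrite gt_eqF// (le_lt_trans (u0 _ Bx)).
    by rewrite w1 subr_le0 lern1 leq_b1.
  - move=> x Bx /eqP; rewrite subr_eq0 => /eqP uwx.
    by rewrite /h !indic_positivity_set ?u0 ?w0// uwx subrr.
  - exact: iR.
  - have ae_all : {ae mu, forall x, B1 x ->
        (forall i j, sym_hessian_entry w i j x = hessian_entry w i j x) /\
        (forall i j, `|(i == j)%:R - a x i j| <= Lambda + 1)}.
      apply: (ae_imply2 _ (ae_sym_hessian_entry Ww) ell.2) => x H1 H2 Bx.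
      split; first exact: H1.
      by move=> i j; have [aT aQ] := H2 Bx; exact: elliptic_entry lambda_gt0 aT aQ.
    have ae_eqs : {ae mu, forall x, B1 x ->
        \sum_i hessian_entry u i i x = \1_(positivity_set u) x /\
        \sum_i \sum_j a x i j * hessian_entry w i j x = \1_(positivity_set w) x}.
      by apply: (ae_imply2 _ aeu aew) => x H1 H2 Bx; split; [exact: H1|exact: H2].
    apply: (ae_imply2 _ ae_all ae_eqs) => x H1 H2 Bx.
    have [sym bnd] := H1 Bx; have [equ eqw] := H2 Bx.
    rewrite /g /h -equ -eqw sumrB -addrA -opprD; congr (_ - _).
    rewrite /residual -(pair_bigA _ (fun i j =>
      clip (Lambda + 1) ((i == j)%:R - a x i j) * sym_hessian_entry w i j x)) /=.
    rewrite -big_split /=; apply: eq_bigr => i _; rewrite -big_split /=.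
    rewrite (bigD1 i)//= big1 ?addr0 => [|j ji].
      by rewrite clip_id// sym eqxx /=; ring.
    by rewrite clip_id// sym [i == j]eq_sym (negbTE ji) /=; ring.
  - exact: B1_gt0.
have hS : Rintegral mu B1 (fun x => `|h x|) = fine (lebesgue S).
  rewrite /Rintegral; congr (fine _).
  transitivity (\int[mu]_(x in B1) ((\1_S x : R)%:E))%E.
    apply: eq_integral => x; rewrite inE => Bx; congr EFin.
    by apply: indic_contact_difference; rewrite ?u0 ?w0.
  rewrite integral_indic//; congr (mu _); apply/seteqP; split => x; first by case.
  by move=> [? ?]; split.
rewrite -(@fineK _ (lebesgue S)); last first.
  rewrite ge0_fin_numE ?lebesgue_outer_ge0//.
  exact: le_lt_trans SB (@lebesgue_unit_ball_lty R n).
by rewrite lee_fin -hS; exact: le_trans contraction le_sigma.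
Qed.
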